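(* Let $\mathcal D$ be a brane diagram with bow variety $\mathcal C(\mathcal D)=\widetilde{\mathcal M}^s/\mathcal G$ and torus $\mathbb T=\mathbb A\times\mathbb C^\times_\hbar$ acting on it. Every $\mathbb T$ fixed point of $\mathcal C(\mathcal D)$ is represented by a butterfly diagram for $\mathcal D$, i.e. it is the class of the tuple $m_S\in\mathbb M$ for some tie diagram $S$ of $\mathcal D$. Conversely, for every tie diagram $S$ of $\mathcal D$ the tuple $m_S$ given by the butterfly diagram belongs to $\widetilde{\mathcal M}^s$, and its class in $\mathcal C(\mathcal D)$ is a $\mathbb T$ fixed point.
   Context: **Brane diagrams.** A brane diagram $\mathcal D$ is a finite sequence of 5-branes arranged from left to right, each being either a D5 brane or an NS5 brane. The D3 branes are the intervals between consecutive 5-branes, together with one D3 brane to the left of all 5-branes and one to the right of all of them. Each D3 brane $X$ carries a multiplicity $d_X\in\mathbb Z_{\ge0}$; the two outer D3 branes have multiplicity $0$. The D5 branes are $U_1,\dots,U_n$ and the NS5 branes are $V_1,\dots,V_m$, numbered left to right. For a 5-brane $W$, $W^-$ and $W^+$ are the D3 branes directly left and right of it; for a D3 brane $X$, $X^-$ and $X^+$ are the 5-branes directly left and right of it. Put $\mathrm{charge}(V)=d_{V^+}-d_{V^-}+\#\{\text{D5 branes left of }V\}$ for NS5 branes and $\mathrm{charge}(U)=d_{U^-}-d_{U^+}+\#\{\text{NS5 branes right of }U\}$ for D5 branes; $r_i=\mathrm{charge}(V_i)$, $c_j=\mathrm{charge}(U_j)$. Standing assumption, part of the definition of brane diagram: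 there is at least one $m\times n$ matrix with entries in $\{0,1\}$ with row sums $r$ and column sums $c$. **Bow variety.** For each D3 brane $X$ let $W_X$ be a complex vector space of dimension $d_X$; for each D5 brane $U$ let $\mathbb C_U$ be a one-dimensional vector space. Let $\mathbb M_U=\mathrm{Hom}(W_{U^+},W_{U^-})\oplus\mathrm{Hom}(W_{U^+},\mathbb C_U)\oplus\mathrm{Hom}(\mathbb C_U,W_{U^-})\oplus\mathrm{End}(W_{U^-})\oplus\mathrm{End}(W_{U^+})\ni(A_U,b_U,a_U,B_U,B'_U)$ for D5 branes $U$, $\mathbb M_V=\mathrm{Hom}(W_{V^+},W_{V^-})\oplus\mathrm{Hom}(W_{V^-},W_{V^+})\ni(C_V,D_V)$ for NS5 branes $V$, and $\mathbb M=\bigoplus_U\mathbb M_U\oplus\bigoplus_V\mathbb M_V$. Let $\mathbb N=\bigoplus_{U}\mathrm{Hom}(W_{U^+},W_{U^-})\oplus\bigoplus_{X}\mathrm{End}(W_X)$. The moment map $\mu:\mathbb M\to\mathbb N$ has $U$-component $B_UA_U-A_UB'_U+a_Ub_U$, and $X$-component: $B'_{X^-}-B_{X^+}$ if $X^-,X^+$ are both D5; $C_{X^+}D_{X^+}-D_{X^-}C_{X^-}$ if both are NS5; $-D_{X^-}C_{X^-}-B_{X^+}$ if $X^-$ is NS5 and $X^+$ is D5; $C_{X^+}D_{X^+}+B'_{X^-}$ if $X^-$ is D5 and $X^+$ is NS5. Let $\widetilde{\mathcal M}$ be the set of points of $\mu^{-1}(0)$ such that for every D5 brane $U$: (S1)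 if $S\le W_{U^+}$ with $B'_U(S)\subset S$, $A_U(S)=0$, $b_U(S)=0$ then $S=0$; (S2) if $T\le W_{U^-}$ with $B_U(T)\subset T$, $\mathrm{Im}A_U+\mathrm{Im}\,a_U\subset T$ then $T=W_{U^-}$. Let $\mathcal G=\prod_X\mathrm{GL}(W_X)$ act naturally on $\mathbb M$, and let $\chi:\mathcal G\to\mathbb C^\times$, $\chi((g_X)_X)=\prod_{X'}\det g_{X'}$, the product over D3 branes $X'$ for which $X'^-$ is an NS5 brane. Let $\mathcal G$ act on $\widetilde{\mathcal M}\times\mathbb C$ by $g.(m,z)=(gm,\chi^{-1}(g)z)$. Then $m\in\widetilde{\mathcal M}$ is stable, $m\in\widetilde{\mathcal M}^s$, if for $z\ne0$ the orbit $\mathcal G(m,z)$ is closed and the stabilizer of $(m,z)$ is finite. The bow variety is $\mathcal C(\mathcal D)=\widetilde{\mathcal M}^s/\mathcal G$ (a smooth variety). **Torus action.** $\mathbb A=(\mathbb C^\times)^{\{\text{D5 branes}\}}$ acts by rescaling the lines $\mathbb C_U$. The torus $\mathbb C^\times_\hbar$ acts on $\mathbb M$ by multiplying all $B_U,B'_U,b_U,C_V$ by the scalar $\hbar$ and fixing all $A_U,a_U,D_V$. Both descend to $\mathcal C(\mathcal D)$; $\mathbb T=\mathbb A\times\mathbb C^\times_\hbar$. **Tie diagrams.** A tie diagram of $\mathcal D$ is a set $S$ of pairs (ties), each consisting of one D5 and one NS5 brane, such that each D3 brane $X$ is covered by (lies between the two members of) exactly $d_X$ of the pairs. **Butterfly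 diagrams.** Given a tie diagram $S$ and a D5 brane $U$, let $n_U(X)$ be the number of ties of $S$ that contain $U$ and cover $X$, and let $l=n_U(U^-)$, $\rho=n_U(U^+)$. The butterfly of $U$ has, below each D3 brane $X$, a column of $n_U(X)$ dots at consecutive integer heights with top height $t_U(X)$ (so heights $t_U(X)-n_U(X)+1,\dots,t_U(X)$), where $t_U(X)=\rho-l$ if $X$ is to the right of $U$, and $t_U(X)=-\#\{\text{NS5 branes between }X\text{ and }U\}$ if $X$ is to the left of $U$. The butterfly diagram is the disjoint union of the butterflies of all D5 branes. Take $W_X$ to have as basis the dots below $X$ in all butterflies (there are $d_X$ of them). Define $m_S\in\mathbb M$ as the tuple acting within each butterfly as follows (an image is $0$ if the named dot does not exist): $A_{U'}$ sends the dot at height $s$ below $U'^+$ to the dot at height $s$ below $U'^-$ (any D5 brane $U'$); $-B_{U'}$ and $-B'_{U'}$ send the dot at height $s$ to the dot at height $s-1$ in the same column; $C_V$ sends the dot at height $s$ below $V^+$ to the dot at height $s-1$ below $V^-$; $D_V$ sends the dot at height $s$ below $V^-$ to the dot at height $s$ below $V^+$. Finally $a_U$ sends a generator $1\in\mathbb C_U$ to the top dot (height $0$) below $U^-$ in the butterfly of $U$ (and $a_U=0$ if $l=0$), and $-b_U$ sends the dot at height $1$ below $U^+$ in the butterfly of $U$, if it exists, to $1\in\mathbb C_U$, and all other dots to $0$. *)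

(* Defs.v *)
From HB Require Import structures.
From mathcomp Require Import all_boot all_order all_algebra.
From mathcomp Require Import boolp classical_sets cardinality.

Set Implicit Arguments.
Unset Strict Implicit.
Unset Printing Implicit Defensive.
Import Order.TTheory GRing.Theory Num.Theory.
Local Open Scope ring_scope.
Local Open Scope classical_set_scope.

(** * Brane diagrams *)

Inductive fivebrane := D5brane | NS5brane.

Definition is_D5 (w : fivebrane) := if w is D5brane then true else false.
Definition is_NS5 (w : fivebrane) := if w is NS5brane then true else false.

(* The 5-branes are at positions 0, ..., N-1 from left to right; the D3 branes
   are numbered 0, ..., N, so that the 5-brane at position k has the D3 brane
   k on its left and k.+1 on its right. *)
Record brane_data := BraneData {
  fivebranes : seq fivebrane;
  multiplicities : seq nat }.

Definition nb5 (D : brane_data) : nat := size (fivebranes D).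
Definition kind (D : brane_data) (k : nat) : fivebrane :=
  nth D5brane (fivebranes D) k.
Definition mult (D : brane_data) (x : nat) : nat :=
  nth 0%N (multiplicities D) x.

Definition D3 (D : brane_data) := 'I_(nb5 D).+1.
Definition D5 (D : brane_data) := {k : 'I_(nb5 D) | is_D5 (kind D k)}.
Definition NS5 (D : brane_data) := {k : 'I_(nb5 D) | is_NS5 (kind D k)}.
HB.instance Definition _ D := Finite.on (D5 D).
HB.instance Definition _ D := Finite.on (NS5 D).

Definition leftD3 (D : brane_data) (k : 'I_(nb5 D)) : D3 D :=
  widen_ord (leqnSn (nb5 D)) k.
Definition rightD3 (D : brane_data) (k : 'I_(nb5 D)) : D3 D :=
  @Ordinal (nb5 D).+1 k.+1 (ltn_ord k).

Definition posD5 (D : brane_data) (U : D5 D) : 'I_(nb5 D) := val U.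
Definition posNS5 (D : brane_data) (V : NS5 D) : 'I_(nb5 D) := val V.

Definition charge_NS5 (D : brane_data) (V : NS5 D) : int :=
  let k := posNS5 V in
  (mult D k.+1)%:Z - (mult D k)%:Z + #|[set U : D5 D | (posD5 U < k)%N]%SET|%:Z.

Definition charge_D5 (D : brane_data) (U : D5 D) : int :=
  let k := posD5 U in
  (mult D k)%:Z - (mult D k.+1)%:Z + #|[set V : NS5 D | (k < posNS5 V)%N]%SET|%:Z.

(* The rows and columns of the 0-1 matrix are indexed by the branes. *)
Definition has_01_matrix (D : brane_data) : Prop :=
  exists b : NS5 D -> D5 D -> bool,
    (forall V, (\sum_(U : D5 D) (b V U : nat))%N%:Z = charge_NS5 V) /\
    (forall U, (\sum_(V : NS5 D) (b V U : nat))%N%:Z = charge_D5 U).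

Record brane_diagram := BraneDiagram {
  diagram_data :> brane_data;
  size_multiplicities : size (multiplicities diagram_data) = (nb5 diagram_data).+1;
  mult_first : mult diagram_data 0 = 0%N;
  mult_last : mult diagram_data (nb5 diagram_data) = 0%N;
  diagram_01_matrix : has_01_matrix diagram_data }.

(** * The representation space M *)

(* W_X is the space 'cV_(d_X) of column vectors and C_U is 'cV_1; linear maps
   act by multiplication on the left. In the two records below, p is the
   dimension of the space on the left of the 5-brane and q the dimension of
   the one on its right. *)
Record repD5 (F : fieldType) (p q : nat) := RepD5 {
  opA : 'M[F]_(p, q);
  opb : 'M[F]_(1, q);
  opa : 'M[F]_(p, 1);
  opB : 'M[F]_p;
  opB' : 'M[F]_q }.

Record repNS5 (F : fieldType) (p q : nat) := RepNS5 {
  opC : 'M[F]_(p, q);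
  opD : 'M[F]_(q, p) }.

Definition rep (F : fieldType) (w : fivebrane) (p q : nat) : Type :=
  match w with D5brane => repD5 F p q | NS5brane => repNS5 F p q end.

Definition bigM (F : fieldType) (D : brane_data) : Type :=
  forall k : 'I_(nb5 D), rep F (kind D k) (mult D k) (mult D k.+1).

Definition if_D5 (F : fieldType) (P : forall p q, repD5 F p q -> Prop)
    (w : fivebrane) (p q : nat) : rep F w p q -> Prop :=
  match w return rep F w p q -> Prop with
  | D5brane => P p q
  | NS5brane => fun _ => True
  end.

(** * Moment map and the conditions (S1), (S2) *)

Definition momentU (F : fieldType) (p q : nat) (x : repD5 F p q) : 'M[F]_(p, q) :=
  opB x *m opA x - opA x *m opB' x + opa x *m opb x.

(* Here x sits at X^- and y at X^+. *)
Definition momentX (F : fieldType) (w w' : fivebrane) (p q r : nat) :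
    rep F w p q -> rep F w' q r -> 'M[F]_q :=
  match w, w' return rep F w p q -> rep F w' q r -> 'M[F]_q with
  | D5brane, D5brane => fun x y => opB' x - opB y
  | NS5brane, NS5brane => fun x y => opC y *m opD y - opD x *m opC x
  | NS5brane, D5brane => fun x y => - (opD x *m opC x) - opB y
  | D5brane, NS5brane => fun x y => opC y *m opD y + opB' x
  end.

(* The outer D3 branes give no equation, as End(W_X) = 0 there. *)
Definition moment_zero (F : fieldType) (D : brane_data) (m : bigM F D) : Prop :=
  (forall k, if_D5 (fun p q (x : repD5 F p q) => momentU x = 0) (m k)) /\
  (forall (i : nat) (lt_iN : (i.+1 < nb5 D)%N),
     momentX (m (Ordinal (ltnW lt_iN))) (m (Ordinal lt_iN)) = 0).

Definition condS1 (F : fieldType) (p q : nat) (x : repD5 F p q) : Prop :=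
  forall S : {vspace 'cV[F]_q},
    (forall v, v \in S -> opB' x *m v \in S) ->
    (forall v, v \in S -> opA x *m v = 0) ->
    (forall v, v \in S -> opb x *m v = 0) ->
    S = 0%VS.

Definition condS2 (F : fieldType) (p q : nat) (x : repD5 F p q) : Prop :=
  forall T : {vspace 'cV[F]_p},
    (forall v, v \in T -> opB x *m v \in T) ->
    (forall (v : 'cV[F]_q) (c : 'cV[F]_1), opA x *m v + opa x *m c \in T) ->
    T = fullv.

Definition Mtilde (F : fieldType) (D : brane_data) : set (bigM F D) :=
  [set m | moment_zero m /\
     forall k, if_D5 (fun p q (x : repD5 F p q) => condS1 x /\ condS2 x) (m k)].

(** * The gauge group and its character *)

Definition gauge (F : fieldType) (D : brane_data) : Type :=
  forall X : D3 D, 'M[F]_(mult D X).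

Definition gauge_group (F : fieldType) (D : brane_data) : set (gauge F D) :=
  [set g | forall X, g X \in unitmx].

Definition rep_gauge (F : fieldType) (w : fivebrane) (p q : nat)
    (gl : 'M[F]_p) (gr : 'M[F]_q) : rep F w p q -> rep F w p q :=
  match w return rep F w p q -> rep F w p q with
  | D5brane => fun x => RepD5
      (gl *m opA x *m invmx gr) (opb x *m invmx gr) (gl *m opa x)
      (gl *m opB x *m invmx gl) (gr *m opB' x *m invmx gr)
  | NS5brane => fun y => RepNS5
      (gl *m opC y *m invmx gr) (gr *m opD y *m invmx gl)
  end.

Definition gauge_act (F : fieldType) (D : brane_data) (g : gauge F D)
    (m : bigM F D) : bigM F D :=
  fun k => rep_gauge (g (leftD3 k)) (g (rightD3 k)) (m k).

Definition chi (F : fieldType) (D : brane_data) (g : gauge F D) : F :=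
  \prod_(V : NS5 D) \det (g (rightD3 (posNS5 V))).

Definition gauge_actz (F : fieldType) (D : brane_data) (g : gauge F D)
    (y : bigM F D * F) : bigM F D * F :=
  (gauge_act g y.1, (chi g)^-1 * y.2).

Definition gauge_orbit (F : fieldType) (D : brane_data) (m : bigM F D) :
    set (bigM F D) :=
  [set gauge_act g m | g in @gauge_group F D].

Definition gauge_orbitz (F : fieldType) (D : brane_data) (y : bigM F D * F) :
    set (bigM F D * F) :=
  [set gauge_actz g y | g in @gauge_group F D].

Definition stabilizerz (F : fieldType) (D : brane_data) (y : bigM F D * F) :
    set (gauge F D) :=
  [set g | gauge_group g /\ gauge_actz g y = y].

(** * Zariski topology on M x C *)

Inductive coordD5 (F : fieldType) (p q : nat) : (repD5 F p q -> F) -> Prop :=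
| CoordA i j : coordD5 (fun x => opA x i j)
| Coordb i j : coordD5 (fun x => opb x i j)
| Coorda i j : coordD5 (fun x => opa x i j)
| CoordB i j : coordD5 (fun x => opB x i j)
| CoordB' i j : coordD5 (fun x => opB' x i j).

Inductive coordNS5 (F : fieldType) (p q : nat) : (repNS5 F p q -> F) -> Prop :=
| CoordC i j : coordNS5 (fun y => opC y i j)
| CoordD i j : coordNS5 (fun y => opD y i j).

Definition coord_rep (F : fieldType) (w : fivebrane) (p q : nat) :
    (rep F w p q -> F) -> Prop :=
  match w return (rep F w p q -> F) -> Prop with
  | D5brane => @coordD5 F p q
  | NS5brane => @coordNS5 F p q
  end.

Inductive polyfun (F : fieldType) (D : brane_data) :
    (bigM F D * F -> F) -> Prop :=
| PolyCst (c : F) : polyfun (fun=> c)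
| PolyZ : polyfun (fun y => y.2)
| PolyCoord (k : 'I_(nb5 D))
    (f : rep F (kind D k) (mult D k) (mult D k.+1) -> F) :
    coord_rep f -> polyfun (fun y => f (y.1 k))
| PolyAdd f g : polyfun f -> polyfun g -> polyfun (fun y => f y + g y)
| PolyMul f g : polyfun f -> polyfun g -> polyfun (fun y => f y * g y).

Definition zariski_closed_in (F : fieldType) (D : brane_data)
    (Y Z : set (bigM F D * F)) : Prop :=
  exists2 I : set (bigM F D * F -> F),
    (forall f, I f -> polyfun f) &
    Z = Y `&` [set y | forall f, I f -> f y = 0].

(** * Stability and the bow variety *)

(* Orbits are required to be closed in Mtilde x C, where the group acts;
   they need not be closed in M x C. *)
Definition stable_point (F : fieldType) (D : brane_data) : set (bigM F D) :=
  [set m | Mtilde m /\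
     forall z : F, z != 0 ->
       zariski_closed_in [set y | Mtilde y.1] (gauge_orbitz (m, z)) /\
       finite_set (stabilizerz (m, z))].

Definition bow_variety (F : fieldType) (D : brane_data) :
    set (set (bigM F D)) :=
  [set gauge_orbit m | m in @stable_point F D].

(** * Torus action *)

(* (tau, h) is the element of A x C^* acting on the line C_U by tau U. *)
Definition torus (F : fieldType) (D : brane_data) : set ((D5 D -> F) * F) :=
  [set t | (forall U, t.1 U != 0) /\ t.2 != 0].

(* The value 1 is only ever taken at NS5 branes, where it plays no role. *)
Definition line_weight (F : fieldType) (D : brane_data) (tau : D5 D -> F)
    (k : 'I_(nb5 D)) : F :=
  oapp tau 1 (insub k).

Definition rep_torus (F : fieldType) (w : fivebrane) (p q : nat) (s h : F) :
    rep F w p q -> rep F w p q :=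
  match w return rep F w p q -> rep F w p q with
  | D5brane => fun x => RepD5
      (opA x) (h *: (s *: opb x)) (s^-1 *: opa x) (h *: opB x) (h *: opB' x)
  | NS5brane => fun y => RepNS5 (h *: opC y) (opD y)
  end.

Definition torus_act (F : fieldType) (D : brane_data) (t : (D5 D -> F) * F)
    (m : bigM F D) : bigM F D :=
  fun k => rep_torus (line_weight t.1 k) t.2 (m k).

Definition torus_fixed (F : fieldType) (D : brane_data)
    (O : set (bigM F D)) : Prop :=
  forall t, @torus F D t -> torus_act t @` O = O.

(** * Tie diagrams and butterflies *)

Definition tie (D : brane_data) : finType := (D5 D * NS5 D)%type.

Definition covers (D : brane_data) (t : tie D) (x : nat) : bool :=
  let u : nat := posD5 t.1 in let v : nat := posNS5 t.2 in
  (minn u v < x <= maxn u v)%N.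

Definition tie_diagram (D : brane_data) (S : {set tie D}) : Prop :=
  forall X : D3 D, #|[set t in S | covers t X]%SET| = mult D X.

Definition nties (D : brane_data) (S : {set tie D}) (U : D5 D) (x : nat) : nat :=
  #|[set t in S | (t.1 == U) && covers t x]%SET|.

Definition top_height (D : brane_data) (S : {set tie D}) (U : D5 D) (x : nat) :
    int :=
  let u : nat := posD5 U in
  if (u < x)%N then (nties S U u.+1)%:Z - (nties S U u)%:Z
  else - #|[set V : NS5 D | (x <= posNS5 V < u)%N]%SET|%:Z.

(* A dot (u, s) is at height s in the butterfly of the D5 brane at position u. *)
Definition dot : Type := (nat * int)%type.

Definition dots (D : brane_data) (S : {set tie D}) (x : nat) : seq dot :=
  [seq ((posD5 U : nat), top_height S U x - i%:Z)
     | U <- enum {: D5 D}, i <- iota 0 (nties S U x)].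

(* The i-th basis vector of W_X is the i-th dot of [dots S X] (see [size_dots]
   and [uniq_dots] below); another order of the dots changes the tuple by an
   element of the gauge group. *)
Definition ith_dot (D : brane_data) (S : {set tie D}) (x i : nat) : dot :=
  nth (0%N, 0) (dots S x) i.

Definition same_height (c : dot) : dot := c.
Definition lower (c : dot) : dot := (c.1, c.2 - 1).

(* The linear map W_x -> W_y sending the dot c below x to the dot f c below y,
   or to 0 if there is no such dot. *)
Definition dot_map (F : fieldType) (D : brane_data) (S : {set tie D})
    (f : dot -> dot) (x y : nat) : 'M[F]_(mult D y, mult D x) :=
  \matrix_(i, j) (ith_dot S y i == f (ith_dot S x j))%:R.

Definition dot_vec (F : fieldType) (D : brane_data) (S : {set tie D})
    (c : dot) (x : nat) : 'M[F]_(mult D x, 1) :=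
  \matrix_(i, j) (ith_dot S x i == c)%:R.

Definition dot_covec (F : fieldType) (D : brane_data) (S : {set tie D})
    (c : dot) (x : nat) : 'M[F]_(1, mult D x) :=
  \matrix_(i, j) (ith_dot S x j == c)%:R.

Definition butterfly_rep (F : fieldType) (D : brane_data) (S : {set tie D})
    (w : fivebrane) (k : nat) : rep F w (mult D k) (mult D k.+1) :=
  match w return rep F w (mult D k) (mult D k.+1) with
  | D5brane => RepD5
      (dot_map F S same_height k.+1 k)
      (- dot_covec F S (k, 1) k.+1)
      (dot_vec F S (k, 0) k)
      (- dot_map F S lower k k)
      (- dot_map F S lower k.+1 k.+1)
  | NS5brane => RepNS5
      (dot_map F S lower k.+1 k)
      (dot_map F S same_height k k.+1)
  end.

Definition butterfly (F : fieldType) (D : brane_data) (S : {set tie D}) :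
    bigM F D :=
  fun k => butterfly_rep F S (kind D k) k.

Lemma size_dots (D : brane_data) (S : {set tie D}) (X : D3 D) :
  tie_diagram S -> size (dots S X) = mult D X.
Proof.
move=> /(_ X) <-.
rewrite /dots size_allpairs_dep.
rewrite (eq_map (g := fun U => nties S U X)); last by move=> U; rewrite size_iota.
rewrite sumnE big_map big_enum /= -sum1_card.
rewrite (partition_big (fun t : tie D => t.1) xpredT) //=.
apply: eq_bigr => U _; rewrite /nties -sum1_card; apply: eq_bigl => t.
by rewrite !inE -andbA [covers _ _ && _]andbC.
Qed.

Lemma uniq_dots (D : brane_data) (S : {set tie D}) (x : nat) : uniq (dots S x).
Proof.
apply: allpairs_uniq_dep; first exact: enum_uniq.
  by move=> U _; apply: iota_uniq.
move=> [U i] [V j] _ _ /= [] /val_inj/val_inj eUV; rewrite -{}eUV.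
by move=> /addrI/oppr_inj[->].
Qed.

(* Main.v *)
Require Import Defs.
From mathcomp Require Import all_boot all_order all_algebra.
From mathcomp Require Import boolp classical_sets cardinality reals complex.
From mathcomp Require Import zify ring.

Set Implicit Arguments.
Unset Strict Implicit.
Unset Printing Implicit Defensive.
Import Order.TTheory GRing.Theory Num.Theory.
Local Open Scope ring_scope.
Local Open Scope classical_set_scope.

(** Why the theorem holds.

    A point of the zero fibre is a chain of vector spaces with maps A, C, D
    between neighbours. The moment map equations say that the endomorphisms - B,
    - B', C D and D C of one space W_X all agree; write beta for them. Then beta
    commutes with C and D, and with A up to the term a b.

    Stability is a numerical criterion ([generated]): a subrepresentation that
    contains every im a_U, and whose quotient has all its A_U injective, is
    everything. If a stable point had a proper subrepresentation of this kind,
    scaling a complement of it by a one-parameter subgroup would have a limit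
    in [Mtilde], while the character sends the coordinate z to 0; the limit would
    lie in the closure of the orbit but not in the orbit ([stable_generated]).
    Conversely, let m be generated. A homomorphism from m to a point m' of
    [Mtilde], the identity on the lines C_U, is unique if it exists, so it is the
    unique solution of a linear system in which m' enters polynomially. Cramer's
    rule then produces polynomial equations for the orbit, and uniqueness for
    m' = m makes stabilizers trivial ([generated_stable]).

    The butterfly of a tie diagram is generated: its dots are reached from the
    top dots a_U by beta, C and A to the left of U and by D and the inverse of A
    to the right ([butterfly_generated]). It is a torus fixed point because a
    diagonal gauge transformation, with entries the weights of the dots, acts on
    it as the given torus element ([butterfly_torus_fixed]).

    Let m be a stable fixed point. One torus element, chosen so that the
    weights of all possible dots (U, s) are distinct, acts on m as a gauge
    transformation G. The sums of eigenvectors of G for these weights satisfy the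
    hypotheses of [generated], so G is diagonalizable with only these weights
    ([all_decomposable]). At a D5 brane other than U the map A is bijective on the
    weights of U ([A_injective], [A_surjective]), by (S1) and (S2). Applying
    [generated] once more, to the subspaces that a_U generates in the weights of
    U ([all_good]), shows that the weight spaces of U are at most lines, that C is
    onto to the left of U and D to the right. As C D = D C = beta, crossing an NS5
    brane can only remove the bottom dot of a column ([columns]). The NS5 branes
    at which this happens are the ties, and the vectors of the dots are the
    columns of an isomorphism from the butterfly to m
    ([weighted_point_butterfly]). *)
(** * Subspaces given by predicates *)

Section Subspaces.
Variables (F : fieldType) (V : vectType F).

(** Invariant subspaces are described by formulas below; as predicates they need
    no construction. *)
Definition subspace (P : V -> Prop) : Prop :=
  P 0 /\ forall k v w, P v -> P w -> P (k *: v + w).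

Lemma subspace0 P : subspace P -> P 0. Proof. by case. Qed.

Lemma subspaceD P v w : subspace P -> P v -> P w -> P (v + w).
Proof. by case=> _ lin Pv Pw; rewrite -[v]scale1r; apply: (lin _ _ _ Pv Pw). Qed.

Lemma subspaceZ P k v : subspace P -> P v -> P (k *: v).
Proof. by case=> P0 lin Pv; rewrite -[_ *: _]addr0; apply: lin. Qed.

Lemma subspaceN P v : subspace P -> P v -> P (- v).
Proof. by move=> sP Pv; rewrite -scaleN1r; apply: subspaceZ. Qed.

Lemma subspaceB P v w : subspace P -> P v -> P w -> P (v - w).
Proof. by move=> sP Pv Pw; apply: subspaceD => //; apply: subspaceN. Qed.

Lemma subspace_sum P (I : eqType) (r : seq I) (f : I -> V) :
  subspace P -> (forall i, i \in r -> P (f i)) -> P (\sum_(i <- r) f i).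
Proof.
move=> sP; elim: r => [|i r IH] Pf; first by rewrite big_nil; apply: subspace0.
rewrite big_cons; apply: subspaceD => //; first by apply: Pf; rewrite mem_head.
by apply: IH => j jr; apply: Pf; rewrite inE jr orbT.
Qed.

(** A subspace of maximal dimension among those contained in [P] absorbs every
    vector of [P]. *)
Lemma subspace_vspace P : subspace P ->
  exists U : {vspace V}, forall v, v \in U <-> P v.
Proof.
move=> sP.
pose Q n := `[< exists2 U : {vspace V}, \dim U = n & forall v, v \in U -> P v >].
have exQ : exists n, Q n.
  exists 0%N; apply/asboolP; exists 0%VS; first by rewrite dimv0.
  by move=> v; rewrite memv0 => /eqP ->; apply: subspace0.
have ubQ n : Q n -> (n <= dim V)%N.
  by move=> /asboolP[U <- _]; apply: (leq_trans (dimvS (subvf U))); rewrite dimvf.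
case: (ex_maxnP exQ ubQ) => n /asboolP[U dU sUP] maxn.
exists U => v; split=> [|Pv]; first exact: sUP.
have /maxn : Q (\dim (U + <[v]>)).
  apply/asboolP; exists (U + <[v]>)%VS => // _ /memv_addP[u uU [_ /vlineP[k ->] ->]].
  by apply: subspaceD => //; [apply: sUP | apply: subspaceZ].
rewrite -dU => dle.
have /eqP -> : U == (U + <[v]>)%VS by rewrite eqEdim addvSl.
exact: (subvP (addvSr U <[v]>)) (memv_line v).
Qed.

End Subspaces.

Lemma subspace_projector (F : fieldType) n (P : 'cV[F]_n -> Prop) : subspace P ->
  exists M : 'M[F]_n, (forall v, P (M *m v)) /\ (forall v, P v -> M *m v = v).
Proof.
move=> /subspace_vspace[U UP].
exists (\matrix_(i, j) projv U (delta_mx j 0) i 0).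
suff E v : (\matrix_(i, j) projv U (delta_mx j 0) i 0) *m v = projv U v.
  split=> v; rewrite E; first by apply/UP; apply: memv_proj.
  by move=> /UP vU; rewrite projv_id.
have {2}-> : v = \sum_j v j 0 *: delta_mx j 0.
  rewrite {1}(matrix_sum_delta v); apply: eq_bigr => j _.
  by rewrite big_ord1.
apply/matrixP=> i j; rewrite ord1 linear_sum mxE summxE; apply: eq_bigr => k _.
by rewrite linearZ !mxE mulrC.
Qed.

Lemma rV_subspace_full (F : fieldType) n (P : 'rV[F]_n -> Prop) : subspace P ->
  (forall w : 'cV[F]_n, (forall v, P v -> v *m w = 0) -> w = 0) -> forall v, P v.
Proof.
move=> sP ann v.
have [U UP] := subspace_vspace sP.
pose M := \matrix_i tnth (vbasis U) i.
have MP i : P (row i M).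
  by rewrite rowK; apply/UP; apply: vbasis_mem; apply: mem_tnth.
have PM u : P u -> (u <= M)%MS.
  move=> /UP uU; rewrite (coord_vbasis uU); apply: summx_sub => i _.
  apply: scalemx_sub; have -> : (vbasis U)`_i = row i M by rewrite rowK (tnth_nth 0).
  exact: row_sub.
have full : row_full M.
  rewrite -cokermx_eq0; apply/eqP/trmx_inj/row_matrixP => j.
  rewrite trmx0 row0; apply: trmx_inj; rewrite trmx0 tr_row trmxK.
  apply: ann => u /PM /submxP[D ->].
  by rewrite colE mulmxA -(mulmxA D) mulmx_coker mulmx0 mul0mx.
have /submxP[D ->] : (v <= M)%MS by apply: submx_full.
rewrite mulmx_sum_row; apply: subspace_sum => // i _.
exact: subspaceZ.
Qed.

(** * Representations as families of matrices indexed by natural numbers *)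

(** Families over 'I_n are made total on nat with a default value, so that
    neighbouring D3 branes k and k.+1 can be handled without casts between
    matrix types. *)
Definition extend n (T : nat -> Type) (t0 : forall k, T k)
    (f : forall k : 'I_n, T k) (k : nat) : T k :=
  match @idP (k < n)%N with
  | ReflectT lt_kn => f (Ordinal lt_kn)
  | ReflectF _ => t0 k
  end.

Lemma extendE n T t0 f (k : 'I_n) : @extend n T t0 f k = f k.
Proof.
case: k => k lt_kn; rewrite /extend /=; case: {-}_ / idP => // lt'.
by rewrite (bool_irrelevance lt' lt_kn).
Qed.

Lemma extend_out n T t0 f k : (n <= k)%N -> @extend n T t0 f k = t0 k.
Proof.
by move=> le_nk; rewrite /extend; case: {-}_ / idP => // lt; rewrite leqNgt lt in le_nk.
Qed.

Section Getters.
Variables (F : fieldType) (w : fivebrane) (p q : nat).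

Definition repA (x : rep F w p q) : 'M[F]_(p, q) :=
  match w return rep F w p q -> 'M[F]_(p, q) with
  | D5brane => fun x => opA x | NS5brane => fun=> 0 end x.
Definition repb (x : rep F w p q) : 'M[F]_(1, q) :=
  match w return rep F w p q -> 'M[F]_(1, q) with
  | D5brane => fun x => opb x | NS5brane => fun=> 0 end x.
Definition repa (x : rep F w p q) : 'M[F]_(p, 1) :=
  match w return rep F w p q -> 'M[F]_(p, 1) with
  | D5brane => fun x => opa x | NS5brane => fun=> 0 end x.
Definition repB (x : rep F w p q) : 'M[F]_p :=
  match w return rep F w p q -> 'M[F]_p with
  | D5brane => fun x => opB x | NS5brane => fun=> 0 end x.
Definition repB' (x : rep F w p q) : 'M[F]_q :=
  match w return rep F w p q -> 'M[F]_q with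
  | D5brane => fun x => opB' x | NS5brane => fun=> 0 end x.
Definition repC (x : rep F w p q) : 'M[F]_(p, q) :=
  match w return rep F w p q -> 'M[F]_(p, q) with
  | NS5brane => fun x => opC x | D5brane => fun=> 0 end x.
Definition repD (x : rep F w p q) : 'M[F]_(q, p) :=
  match w return rep F w p q -> 'M[F]_(q, p) with
  | NS5brane => fun x => opD x | D5brane => fun=> 0 end x.

End Getters.

Lemma rep_ext (F : fieldType) w p q (x y : rep F w p q) :
  repA x = repA y -> repb x = repb y -> repa x = repa y -> repB x = repB y ->
  repB' x = repB' y -> repC x = repC y -> repD x = repD y -> x = y.
Proof.
case: w x y => /= [[? ? ? ? ?] [? ? ? ? ?]|[? ?] [? ?]] /=.
  by move=> -> -> -> -> -> _ _.
by move=> _ _ _ _ _ -> ->.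
Qed.

Lemma if_D5P (F : fieldType) (P : forall p q, repD5 F p q -> Prop) w p q
    (x : rep F w p q) :
  if_D5 P x <->
  (is_D5 w -> P p q (RepD5 (repA x) (repb x) (repa x) (repB x) (repB' x))).
Proof. by case: w x => x; split=> //=; case: x => // > /(_ isT). Qed.

Section Families.
Variables (F : fieldType) (D : brane_diagram).
Implicit Types (m : bigM F D) (g : gauge F D).

Local Notation N := (nb5 D).
Local Notation d := (mult D).

Definition D5_at k := (k < N)%N && is_D5 (kind D k).
Definition NS5_at k := (k < N)%N && is_NS5 (kind D k).

Lemma is_NS5N w : is_NS5 w = ~~ is_D5 w. Proof. by case: w. Qed.

Variant brane_at_spec k : bool -> bool -> Type :=
  | BraneD5 of D5_at k : brane_at_spec k true false
  | BraneNS5 of NS5_at k : brane_at_spec k false true.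

Lemma brane_atP k : (k < N)%N -> brane_at_spec k (D5_at k) (NS5_at k).
Proof.
rewrite /D5_at /NS5_at => lt_kN; have := @BraneD5 k; have := @BraneNS5 k.
rewrite /D5_at /NS5_at lt_kN is_NS5N.
by case: (is_D5 _) => [_ /(_ isT)|/(_ isT) ? _].
Qed.

Definition mA m k : 'M[F]_(d k, d k.+1) :=
  extend (fun k => 0 : 'M[F]_(d k, d k.+1)) (fun k => repA (m k)) k.
Definition mb m k : 'M[F]_(1, d k.+1) :=
  extend (fun k => 0 : 'M[F]_(1, d k.+1)) (fun k => repb (m k)) k.
Definition ma m k : 'M[F]_(d k, 1) :=
  extend (fun k => 0 : 'M[F]_(d k, 1)) (fun k => repa (m k)) k.
Definition mB m k : 'M[F]_(d k) :=
  extend (fun k => 0 : 'M[F]_(d k)) (fun k => repB (m k)) k.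
Definition mB' m k : 'M[F]_(d k.+1) :=
  extend (fun k => 0 : 'M[F]_(d k.+1)) (fun k => repB' (m k)) k.
Definition mC m k : 'M[F]_(d k, d k.+1) :=
  extend (fun k => 0 : 'M[F]_(d k, d k.+1)) (fun k => repC (m k)) k.
Definition mD m k : 'M[F]_(d k.+1, d k) :=
  extend (fun k => 0 : 'M[F]_(d k.+1, d k)) (fun k => repD (m k)) k.

Lemma mAE m (k : 'I_N) : mA m k = repA (m k). Proof. exact: extendE. Qed.
Lemma mbE m (k : 'I_N) : mb m k = repb (m k). Proof. exact: extendE. Qed.
Lemma maE m (k : 'I_N) : ma m k = repa (m k). Proof. exact: extendE. Qed.
Lemma mBE m (k : 'I_N) : mB m k = repB (m k). Proof. exact: extendE. Qed.
Lemma mB'E m (k : 'I_N) : mB' m k = repB' (m k). Proof. exact: extendE. Qed.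
Lemma mCE m (k : 'I_N) : mC m k = repC (m k). Proof. exact: extendE. Qed.
Lemma mDE m (k : 'I_N) : mD m k = repD (m k). Proof. exact: extendE. Qed.
Definition mE := (mAE, mbE, maE, mBE, mB'E, mCE, mDE).

Lemma m_out m k : (N <= k)%N ->
  [/\ mA m k = 0, mb m k = 0, ma m k = 0 & mB m k = 0] /\
  [/\ mB' m k = 0, mC m k = 0 & mD m k = 0].
Proof. by move=> le_Nk; split; split; apply: extend_out. Qed.

Lemma bigM_ext m m' :
  (forall k, D5_at k -> [/\ mA m k = mA m' k, mb m k = mb m' k, ma m k = ma m' k,
                            mB m k = mB m' k & mB' m k = mB' m' k]) ->
  (forall k, NS5_at k -> mC m k = mC m' k /\ mD m k = mD m' k) ->
  m = m'.
Proof.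
move=> eqD eqV; apply: functional_extensionality_dep => k.
have {}eqD := eqD k; have {}eqV := eqV k; move: eqD eqV.
rewrite /D5_at /NS5_at ltn_ord /= !mE; move: (m k) (m' k).
case: (kind D k) => x y eqD eqV; apply: rep_ext => //.
all: try by case: (eqD isT).
all: by case: (eqV isT).
Qed.

(** The default value is invertible, so that all values are when g is in the
    gauge group. *)
Definition gaugeN g x : 'M[F]_(d x) :=
  extend (fun x => 1%:M : 'M[F]_(d x)) (g : forall X : 'I_N.+1, _) x.

Lemma gaugeNE g (X : D3 D) : gaugeN g X = g X.
Proof. exact: (extendE _ (g : forall X : 'I_N.+1, _)). Qed.

Lemma gaugeN_left g (k : 'I_N) : gaugeN g k = g (leftD3 k).
Proof. exact: (gaugeNE g (leftD3 k)). Qed.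

Lemma gaugeN_right g (k : 'I_N) : gaugeN g k.+1 = g (rightD3 k).
Proof. exact: (gaugeNE g (rightD3 k)). Qed.

Lemma gaugeN_unit g x : gauge_group g -> gaugeN g x \in unitmx.
Proof.
move=> Gg; case: (ltnP x N.+1) => [lt_xN|le_Nx].
  exact: (eq_ind_r (fun M => M \in unitmx) (Gg (Ordinal lt_xN)) (gaugeNE g (Ordinal lt_xN))).
by rewrite /gaugeN extend_out ?unitmx1.
Qed.

Lemma gauge_ext g g' : (forall x, (x <= N)%N -> gaugeN g x = gaugeN g' x) -> g = g'.
Proof.
move=> eg; apply: functional_extensionality_dep => X.
by rewrite -!gaugeNE eg // -ltnS ltn_ord.
Qed.

Section GaugeAct.
Variables (g : gauge F D) (m : bigM F D) (k : nat).
Local Notation gl := (gaugeN g k).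
Local Notation gr := (gaugeN g k.+1).

Lemma gauge_actE :
  [/\ mA (gauge_act g m) k = gl *m mA m k *m invmx gr,
      mb (gauge_act g m) k = mb m k *m invmx gr,
      ma (gauge_act g m) k = gl *m ma m k &
      mB (gauge_act g m) k = gl *m mB m k *m invmx gl] /\
  [/\ mB' (gauge_act g m) k = gr *m mB' m k *m invmx gr,
      mC (gauge_act g m) k = gl *m mC m k *m invmx gr &
      mD (gauge_act g m) k = gr *m mD m k *m invmx gl].
Proof.
case: (ltnP k N) => [lt_kN|le_Nk]; last first.
  have [[-> -> -> ->] [-> -> ->]] := m_out (gauge_act g m) le_Nk.
  have [[-> -> -> ->] [-> -> ->]] := m_out m le_Nk.
  by rewrite !(mulmx0, mul0mx).
pose k' := Ordinal lt_kN; rewrite -[k]/(nat_of_ord k') !gaugeN_left !gaugeN_right !mE.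
rewrite /gauge_act; move: (m k') (g _) (g _).
by case: (kind D k') => x u v; rewrite /= !(mulmx0, mul0mx).
Qed.

End GaugeAct.

(** The endomorphism of W_X that the moment map equations attach to the 5-brane
    on the right of X; [beta_left] is its analogue for the 5-brane on the left.
    On the zero fibre both agree, and [beta] then plays the role of every one
    of [- B], [- B'], [C D] and [D C]. *)
Definition beta m x : 'M[F]_(d x) :=
  if is_D5 (kind D x) then - mB m x else mC m x *m mD m x.
Definition beta_left m k : 'M[F]_(d k.+1) :=
  if is_D5 (kind D k) then - mB' m k else mD m k *m mC m k.

Lemma beta_D5 m k : D5_at k -> beta m k = - mB m k.
Proof. by rewrite /beta => /andP[_ ->]. Qed.

Lemma beta_NS5 m k : NS5_at k -> beta m k = mC m k *m mD m k.
Proof. by rewrite /beta => /andP[_]; rewrite is_NS5N => /negbTE ->. Qed.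

Lemma beta_left_D5 m k : D5_at k -> beta_left m k = - mB' m k.
Proof. by rewrite /beta_left => /andP[_ ->]. Qed.

Lemma beta_left_NS5 m k : NS5_at k -> beta_left m k = mD m k *m mC m k.
Proof. by rewrite /beta_left => /andP[_]; rewrite is_NS5N => /negbTE ->. Qed.

Lemma momentX_eq0 w w' p q r (x : rep F w p q) (y : rep F w' q r) :
  momentX x y = 0 <->
  (if is_D5 w then - repB' x else repD x *m repC x) =
  (if is_D5 w' then - repB y else repC y *m repD y).
Proof.
case: w w' x y => [] [] x y /=.
- split=> [/eqP|/oppr_inj ->]; last by rewrite subrr.
  by rewrite subr_eq0 => /eqP ->.
- rewrite addrC; split=> [/eqP|<-]; last by rewrite subrr.
  by rewrite addr_eq0 => /eqP ->; rewrite opprK.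
- split=> [/eqP|->]; last by rewrite opprK subrr.
  by rewrite subr_eq0 eqr_oppLR => /eqP ->.
- by split=> [/eqP|->]; rewrite ?subrr // subr_eq0 => /eqP ->.
Qed.

Lemma moment_zeroP m : moment_zero m <->
  (forall k, D5_at k ->
     beta m k *m mA m k = mA m k *m beta_left m k + ma m k *m mb m k) /\
  (forall k, (k.+1 < N)%N -> beta_left m k = beta m k.+1).
Proof.
have momUE k : D5_at k ->
    beta m k *m mA m k = mA m k *m beta_left m k + ma m k *m mb m k <->
    mB m k *m mA m k - mA m k *m mB' m k + ma m k *m mb m k = 0.
  move=> Dk; rewrite beta_D5 // beta_left_D5 // mulNmx mulmxN; split=> [/eqP|/eqP].
    by rewrite eq_sym -addr_eq0 addrC addrA => /eqP.
  by move=> e; apply/esym/eqP; rewrite -addr_eq0 addrC addrA.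
have momXE k (lt : (k.+1 < N)%N) :
    momentX (m (Ordinal (ltnW lt))) (m (Ordinal lt)) = 0 <->
    beta_left m k = beta m k.+1.
  rewrite momentX_eq0 /beta_left /beta.
  by rewrite -(mB'E m (Ordinal (ltnW lt))) -(mDE m (Ordinal (ltnW lt)))
    -(mCE m (Ordinal (ltnW lt))) -(mBE m (Ordinal lt)) -(mDE m (Ordinal lt))
    -(mCE m (Ordinal lt)).
split=> -[momU momX]; split.
- move=> k /[dup] Dk /andP[lt_kN kD]; apply/momUE => //.
  have /if_D5P /(_ kD) := momU (Ordinal lt_kN).
  by rewrite -!mE /momentU /=.
- by move=> k lt; apply/momXE/momX.
- move=> k; apply/if_D5P => kD; rewrite -!mE /momentU /=; apply/momUE; last first.
    by apply: momU; rewrite /D5_at ltn_ord.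
  by rewrite /D5_at ltn_ord.
- by move=> k lt; apply/momXE/momX.
Qed.

(** Used at the outer D3 branes, where all spaces vanish. *)
Lemma mx_norows_eq p q (X Y : 'M[F]_(p, q)) : p = 0%N -> X = Y.
Proof. by move=> p0; apply/matrixP => -[i lt_ip]; exfalso; rewrite p0 in lt_ip. Qed.

Lemma condS1P p q (x : repD5 F p q) : condS1 x <->
  forall K : 'cV[F]_q -> Prop, subspace K -> (forall v, K v -> K (opB' x *m v)) ->
    (forall v, K v -> opA x *m v = 0) -> (forall v, K v -> opb x *m v = 0) ->
    forall v, K v -> v = 0.
Proof.
split=> [S1 K sK KB KA Kb v Kv|S1 K KB KA Kb].
  have [U UK] := subspace_vspace sK.
  suff U0 : U = 0%VS by apply/eqP; rewrite -memv0 -U0; apply/UK.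
  by apply: S1 => w /UK Kw; [apply/UK/KB | apply: KA | apply: Kb].
apply/eqP; rewrite -subv0; apply/subvP => v Kv; rewrite memv0; apply/eqP.
apply: (S1 (fun v => v \in K)) => //.
by split=> [|k v1 v2 K1 K2]; rewrite ?mem0v ?memvD ?memvZ.
Qed.

Lemma condS2P p q (x : repD5 F p q) : condS2 x <->
  forall T : 'cV[F]_p -> Prop, subspace T -> (forall v, T v -> T (opB x *m v)) ->
    (forall v, T (opA x *m v)) -> (forall v, T (opa x *m v)) -> forall v, T v.
Proof.
split=> [S2 T sT TB TA Ta v|S2 T TB TAa].
  have [U UT] := subspace_vspace sT.
  suff Uf : U = fullv by apply/UT; rewrite Uf memvf.
  apply: S2 => [w /UT Tw|w c]; apply/UT; first exact: TB.
  exact: subspaceD.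
apply/vspaceP => v; rewrite memvf.
apply: (S2 (fun v => v \in T)) => // [|w|w].
- by split=> [|k v1 v2 K1 K2]; rewrite ?mem0v ?memvD ?memvZ.
- by have := TAa w 0; rewrite mulmx0 addr0.
- by have := TAa 0 w; rewrite mulmx0 add0r.
Qed.

Definition S1_at m k := forall K : 'cV[F]_(d k.+1) -> Prop, subspace K ->
  (forall v, K v -> K (beta_left m k *m v)) ->
  (forall v, K v -> mA m k *m v = 0) -> (forall v, K v -> mb m k *m v = 0) ->
  forall v, K v -> v = 0.

Definition S2_at m k := forall T : 'cV[F]_(d k) -> Prop, subspace T ->
  (forall v, T v -> T (beta m k *m v)) ->
  (forall v, T (mA m k *m v)) -> (forall v, T (ma m k *m v)) -> forall v, T v.

Lemma MtildeP m : Mtilde m <->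
  moment_zero m /\ (forall k, D5_at k -> S1_at m k /\ S2_at m k).
Proof.
have subN n (P : 'cV[F]_n -> Prop) (M : 'M[F]_n) : subspace P ->
    (forall v, P v -> P (- M *m v)) <-> (forall v, P v -> P (M *m v)).
  move=> sP; split=> PM v /PM; last by rewrite mulNmx; apply: subspaceN.
  by rewrite mulNmx => /(subspaceN sP); rewrite opprK.
suff E (k : 'I_N) : is_D5 (kind D k) ->
    (condS1 (RepD5 (repA (m k)) (repb (m k)) (repa (m k)) (repB (m k)) (repB' (m k))) /\
     condS2 (RepD5 (repA (m k)) (repb (m k)) (repa (m k)) (repB (m k)) (repB' (m k))))
    <-> S1_at m k /\ S2_at m k.
  rewrite /Mtilde /=; split=> -[mom S12]; split=> //.
    move=> k /andP[lt_kN kD]; apply/(E (Ordinal lt_kN) kD).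
    by have /if_D5P /(_ kD) := S12 (Ordinal lt_kN).
  move=> k; apply/if_D5P => kD; apply/(E k kD)/S12.
  by rewrite /D5_at ltn_ord.
move=> kD; have Dk : D5_at k by rewrite /D5_at ltn_ord.
rewrite condS1P condS2P -!mE /S1_at /S2_at /= beta_D5 // beta_left_D5 //.
split=> -[S1 S2]; split=> K sK.
- by move=> /(subN _ _ _ sK); apply: S1.
- by move=> /(subN _ _ _ sK); apply: S2.
- by move=> /(subN _ _ _ sK); apply: S1.
- by move=> /(subN _ _ _ sK); apply: S2.
Qed.
End Families.

(** * Homomorphisms and the generation criterion *)

Lemma injective_unitmx (F : fieldType) n (M : 'M[F]_n) :
  (forall v : 'cV_n, M *m v = 0 -> v = 0) -> M \in unitmx.
Proof.
move=> inj; rewrite -unitmx_tr -row_free_unit -kermx_eq0.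
apply/eqP/row_matrixP => i; rewrite row0; apply: trmx_inj; rewrite trmx0.
apply: inj; apply: trmx_inj; rewrite trmx_mul trmxK trmx0.
by rewrite -row_mul mulmx_ker row0.
Qed.

Lemma mulmx_ext (F : fieldType) p q (A B : 'M[F]_(p, q)) :
  (forall v : 'cV_q, A *m v = B *m v) -> A = B.
Proof.
move=> eqAB; apply/matrixP => i j.
by have /matrixP /(_ i 0) := eqAB (delta_mx j 0); rewrite -!colE !mxE.
Qed.

Section Homomorphisms.
Variables (F : fieldType) (D : brane_diagram).
Implicit Types (m : bigM F D) (g : gauge F D).

Local Notation N := (nb5 D).
Local Notation d := (mult D).

Lemma mult_ge_nb5 x : (N <= x)%N -> d x = 0%N.
Proof.
rewrite leq_eqVlt => /orP[/eqP <-|lt_Nx]; first exact: mult_last.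
by rewrite /mult nth_default // size_multiplicities.
Qed.

Lemma beta_leftE m k : moment_zero m -> (k < N)%N -> beta_left m k = beta m k.+1.
Proof.
move=> /moment_zeroP[_ momX]; rewrite leq_eqVlt => /orP[/eqP kN|]; last exact: momX.
by apply/mx_norows_eq/mult_ge_nb5; rewrite kN.
Qed.

Lemma beta_mA m k : moment_zero m -> D5_at D k ->
  beta m k *m mA m k = mA m k *m beta m k.+1 + ma m k *m mb m k.
Proof.
by move=> mom Dk; rewrite -beta_leftE //; [move/moment_zeroP: mom => [->] | case/andP: Dk].
Qed.

Lemma beta_mC m k : moment_zero m -> NS5_at D k ->
  beta m k *m mC m k = mC m k *m beta m k.+1.
Proof.
by move=> mom Vk; rewrite -beta_leftE ?beta_NS5 ?beta_left_NS5 ?mulmxA //; case/andP: Vk.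
Qed.

Lemma beta_mD m k : moment_zero m -> NS5_at D k ->
  beta m k.+1 *m mD m k = mD m k *m beta m k.
Proof.
by move=> mom Vk; rewrite -beta_leftE ?beta_NS5 ?beta_left_NS5 ?mulmxA //; case/andP: Vk.
Qed.

Lemma Mtilde_S1 m k : Mtilde m -> D5_at D k ->
  forall K : 'cV[F]_(d k.+1) -> Prop, subspace K ->
  (forall v, K v -> K (beta m k.+1 *m v)) ->
  (forall v, K v -> mA m k *m v = 0) -> (forall v, K v -> mb m k *m v = 0) ->
  forall v, K v -> v = 0.
Proof.
move=> /MtildeP[mom S12] Dk; have [S1 _] := S12 k Dk.
by move: S1; rewrite /S1_at beta_leftE //; case/andP: Dk.
Qed.

Lemma Mtilde_S2 m k : Mtilde m -> D5_at D k -> S2_at m k.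
Proof. by move=> /MtildeP[_ S12] /S12[]. Qed.

Lemma Mtilde_moment m : Mtilde m -> moment_zero m.
Proof. by case. Qed.

(** The subspaces S that matter are those for which a one-parameter subgroup that
    fixes S and scales a complement has a limit in [Mtilde]: this explains the
    condition im a in S, and the condition that A be injective on the quotient,
    where it is onto by (S2). *)
Definition subrep m (S : forall x, 'cV[F]_(d x) -> Prop) : Prop :=
  [/\ forall x, subspace (@S x),
      forall x v, (x < N)%N -> S x v -> S x (beta m x *m v),
      forall k, D5_at D k -> [/\ forall v, S k.+1 v -> S k (mA m k *m v),
         forall v, S k (mA m k *m v) -> S k.+1 v & forall c, S k (ma m k *m c)] &
      forall k, NS5_at D k -> (forall v, S k.+1 v -> S k (mC m k *m v)) /\
         (forall v, S k v -> S k.+1 (mD m k *m v))].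

Definition generated m := forall S, subrep m S -> forall x v, S x v.

(** For c = 1, a homomorphism that is the identity on the lines C_U; for c = 0,
    the difference of two of them. *)
Definition intertwines (c : F) m m' (E : forall x, 'M[F]_(d x)) : Prop :=
  [/\ forall x, (x < N)%N -> beta m' x *m E x = E x *m beta m x,
      forall k, D5_at D k -> [/\ mA m' k *m E k.+1 = E k *m mA m k,
         mb m' k *m E k.+1 = c *: mb m k & E k *m ma m k = c *: ma m' k] &
      forall k, NS5_at D k -> mC m' k *m E k.+1 = E k *m mC m k /\
         mD m' k *m E k = E k.+1 *m mD m k].

Lemma hom_beta c m m' E x : intertwines c m m' E -> beta m' x *m E x = E x *m beta m x.
Proof.
case=> homb _ _; case: (ltnP x N) => [/homb //|le_Nx].
by apply/mx_norows_eq/mult_ge_nb5.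
Qed.

(** The kernel of a homomorphism that is zero on the lines C_U satisfies the
    conditions of [generated]; for the injectivity of [A_U] on the quotient,
    note that ker A'_U intersected with the image of E is beta-invariant and
    killed by b'_U, hence zero by (S1). *)
Lemma hom0_eq0 m m' E : generated m -> Mtilde m' -> intertwines 0 m m' E ->
  forall x, E x = 0.
Proof.
move=> gen Mm' homE x; have [_ homD homV] := homE.
have mom' := Mtilde_moment Mm'.
apply: mulmx_ext => v; rewrite mul0mx.
apply: (gen (fun x v => E x *m v = 0)); split=> //.
- move=> y; split=> [|k v1 v2 Ev1 Ev2]; first by rewrite mulmx0.
  by rewrite mulmxDr -scalemxAr Ev1 Ev2 scaler0 addr0.
- by move=> y w _ Ew; rewrite mulmxA -(hom_beta _ homE) -mulmxA Ew mulmx0.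
- move=> k Dk; have [EA Eb Ea] := homD k Dk; split=> [w Ew|w Ew|c].
  + by rewrite mulmxA -EA -mulmxA Ew mulmx0.
  + pose K (u : 'cV[F]_(d k.+1)) := mA m' k *m u = 0 /\ exists w, u = E k.+1 *m w.
    apply: (Mtilde_S1 Mm' Dk (K := K)).
    * split; first by split; [rewrite mulmx0 | exists 0; rewrite mulmx0].
      move=> c v1 v2 [Au [u e1]] [Av [v' e2]]; rewrite {}e1 {}e2 in Au Av *; split.
        by rewrite mulmxDr -scalemxAr Au Av scaler0 addr0.
      by exists (c *: u + v'); rewrite mulmxDr scalemxAr.
    * move=> v1 [Au [u e1]]; rewrite {}e1 in Au *; split; last first.
        by exists (beta m k.+1 *m u); rewrite !mulmxA (hom_beta _ homE).
      have := beta_mA mom' Dk => /(congr1 (mulmx^~ (E k.+1 *m u))).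
      rewrite /= mulmxDl -!mulmxA Au mulmx0 (mulmxA (mb _ _)) Eb scale0r mul0mx.
      by rewrite mulmx0 addr0.
    * by move=> u [].
    * by move=> _ [_ [u ->]]; rewrite mulmxA Eb scale0r mul0mx.
    * by split; [rewrite mulmxA EA -mulmxA | exists w].
  + by rewrite mulmxA Ea scale0r mul0mx.
- move=> k Vk; have [EC ED] := homV k Vk; split=> w Ew.
  + by rewrite mulmxA -EC -mulmxA Ew mulmx0.
  + by rewrite mulmxA -ED -mulmxA Ew mulmx0.
Qed.

(** A vector of ker E_{k+1} is killed by b_k, and by A_k as soon as E_k is
    injective; (S1) then propagates injectivity to the right through D5 branes. *)
Lemma hom1_unitmx m m' E : Mtilde m -> intertwines 1 m m' E ->
  (forall k, NS5_at D k -> E k.+1 \in unitmx) -> forall x, E x \in unitmx.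
Proof.
move=> Mm homE unitV x; have [_ homD _] := homE.
have unit_out y : d y = 0%N -> E y \in unitmx.
  by move=> dy0; apply: injective_unitmx => v _; apply: mx_norows_eq.
elim: x => [|k IH]; first by apply/unit_out/mult_first.
case: (ltnP k N) => [lt_kN|le_Nk]; last by apply/unit_out/mult_ge_nb5/leqW.
case: (brane_atP lt_kN) => [Dk|Vk]; last exact: unitV.
have [EA Eb _] := homD k Dk; apply: injective_unitmx.
apply: (Mtilde_S1 Mm Dk).
- split=> [|c v1 v2 Ev1 Ev2]; first by rewrite mulmx0.
  by rewrite mulmxDr -scalemxAr Ev1 Ev2 scaler0 addr0.
- by move=> w Ew; rewrite mulmxA -(hom_beta _ homE) -mulmxA Ew mulmx0.
- by move=> w Ew; rewrite -(mulKmx IH (_ *m w)) mulmxA -mulmxA (mulmxA (E k)) -EA -mulmxA Ew !mulmx0.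
- by move=> w Ew; rewrite -[mb m k]scale1r -Eb -mulmxA Ew mulmx0.
Qed.

Lemma gauge_act_beta g m x : gauge_group g ->
  beta (gauge_act g m) x = gaugeN g x *m beta m x *m invmx (gaugeN g x).
Proof.
move=> Gg; rewrite /beta; have [[_ _ _ ->] [_ -> ->]] := gauge_actE g m x.
case: ifP => _; first by rewrite mulmxN mulNmx.
by rewrite !mulmxA mulmxKV ?gaugeN_unit.
Qed.

Lemma gauge_act_beta_left g m k : gauge_group g ->
  beta_left (gauge_act g m) k = gaugeN g k.+1 *m beta_left m k *m invmx (gaugeN g k.+1).
Proof.
move=> Gg; rewrite /beta_left; have [_ [-> -> ->]] := gauge_actE g m k.
case: ifP => _; first by rewrite mulmxN mulNmx.
by rewrite !mulmxA mulmxKV ?gaugeN_unit.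
Qed.

Lemma gauge_act_Mtilde g m : gauge_group g -> Mtilde m -> Mtilde (gauge_act g m).
Proof.
move=> Gg /MtildeP[/moment_zeroP[momU momX] S12]; apply/MtildeP; split.
  apply/moment_zeroP; split=> [k Dk|k lt].
    have [[-> -> -> _] _] := gauge_actE g m k.
    rewrite gauge_act_beta // gauge_act_beta_left // !mulmxA !mulmxKV ?gaugeN_unit //.
    by rewrite -[_ *m beta m k *m _]mulmxA momU // mulmxDr mulmxDl !mulmxA.
  by rewrite gauge_act_beta_left // gauge_act_beta // momX.
have subsp x (K : 'cV[F]_(d x) -> Prop) : subspace K ->
    subspace (fun v => K (gaugeN g x *m v)).
  move=> sK; split=> [|c v w Kv Kw]; first by rewrite mulmx0; apply: subspace0.
  by rewrite mulmxDr -scalemxAr; apply: subspaceD => //; apply: subspaceZ.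
move=> k Dk; have [S1 S2] := S12 k Dk; have [[EA Eb Ea _] _] := gauge_actE g m k.
split=> [K sK KB KA Kb v Kv|T sT TB TA Ta v].
  have Gk := gaugeN_unit k.+1 Gg; rewrite -(mulKVmx Gk v).
  suff -> : invmx (gaugeN g k.+1) *m v = 0 by rewrite mulmx0.
  apply: (S1 _ (subsp _ K sK)); last by rewrite mulKVmx.
  - by move=> w /KB; rewrite gauge_act_beta_left // -!mulmxA mulKmx.
  - move=> w /KA; rewrite EA -!mulmxA mulKmx // => /(congr1 (mulmx (invmx (gaugeN g k)))).
    by rewrite mulKmx ?gaugeN_unit // mulmx0.
  - by move=> w /Kb; rewrite Eb -!mulmxA mulKmx.
have Gk := gaugeN_unit k Gg; rewrite -(mulKVmx Gk v).
apply: (S2 _ (subsp _ T sT)).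
- by move=> w /TB; rewrite gauge_act_beta // -!mulmxA mulKmx.
- by move=> w; have := TA (gaugeN g k.+1 *m w); rewrite EA -!mulmxA mulKmx // gaugeN_unit.
- by move=> w; have := Ta w; rewrite Ea -!mulmxA.
Qed.

Lemma gauge_hom g m : gauge_group g -> intertwines 1 m (gauge_act g m) (gaugeN g).
Proof.
move=> Gg; split=> [x _|k Dk|k Vk].
- by rewrite gauge_act_beta // mulmxKV ?gaugeN_unit.
- have [[-> -> -> _] _] := gauge_actE g m k.
  by rewrite !scale1r !mulmxKV ?gaugeN_unit.
- have [_ [_ -> ->]] := gauge_actE g m k.
  by rewrite !mulmxKV ?gaugeN_unit.
Qed.

Lemma hom_gauge m m' E : Mtilde m -> Mtilde m' -> intertwines 1 m m' E ->
  (forall x, E x \in unitmx) ->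
  let g : gauge F D := fun X => E X in
  [/\ gauge_group g, m' = gauge_act g m & forall x, (x <= N)%N -> gaugeN g x = E x].
Proof.
move=> Mm Mm' homE Eu g.
have gE x : (x <= N)%N -> gaugeN g x = E x by rewrite -ltnS => lt; apply: (gaugeNE g (Ordinal lt)).
have Gg : gauge_group g by move=> X; apply: Eu.
have [mom mom'] := (Mtilde_moment Mm, Mtilde_moment Mm').
have [_ homD homV] := homE; split=> //; apply: bigM_ext => k Hk.
  have lt_kN : (k < N)%N by case/andP: Hk.
  have [EA Eb Ea] := homD k Hk.
  have [[-> -> -> ->] [-> _ _]] := gauge_actE g m k.
  rewrite !gE ?(ltnW lt_kN) // -EA.
  have e x : E x *m beta m x *m invmx (E x) = beta m' x.
    by rewrite -(hom_beta _ homE) mulmxK.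
  rewrite mulmxK // -[mb m k]scale1r -Eb mulmxK // Ea scale1r; split=> //.
    by rewrite -[LHS]opprK -beta_D5 // -e beta_D5 // mulmxN mulNmx opprK.
  rewrite -[LHS]opprK -beta_left_D5 // beta_leftE // -e -beta_leftE // beta_left_D5 //.
  by rewrite mulmxN mulNmx opprK.
have lt_kN : (k < N)%N by case/andP: Hk.
have [EC ED] := homV k Hk; have [_ [_ -> ->]] := gauge_actE g m k.
by rewrite !gE ?(ltnW lt_kN) // -EC -ED !mulmxK.
Qed.

End Homomorphisms.

(** * Solvability of linear systems with polynomial coefficients *)

Section FunctionRings.
Variables (F : fieldType) (Y : Type) (poly : (Y -> F) -> Prop).

Definition function_ring : Prop :=
  [/\ forall c : F, poly (fun=> c),
      forall f g, poly f -> poly g -> poly (fun y => f y + g y) &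
      forall f g, poly f -> poly g -> poly (fun y => f y * g y)].

Hypothesis ringP : function_ring.

Lemma poly_cst c : poly (fun=> c). Proof. by case: ringP. Qed.
Lemma poly_add f g : poly f -> poly g -> poly (fun y => f y + g y).
Proof. by case: ringP => _ + _; apply. Qed.
Lemma poly_mul f g : poly f -> poly g -> poly (fun y => f y * g y).
Proof. by case: ringP => _ _; apply. Qed.

Lemma poly_eq f g : f =1 g -> poly f -> poly g.
Proof. by move=> /funext ->. Qed.

Lemma poly_opp f : poly f -> poly (fun y => - f y).
Proof.
move=> Pf; apply: (@poly_eq (fun y => -1 * f y)) => [y|]; first by rewrite mulN1r.
exact/poly_mul/Pf/poly_cst.
Qed.

Lemma poly_sub f g : poly f -> poly g -> poly (fun y => f y - g y).
Proof. by move=> Pf Pg; apply/poly_add/poly_opp. Qed.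

Lemma poly_sum (I : Type) (r : seq I) (f : I -> Y -> F) :
  (forall i, poly (f i)) -> poly (fun y => \sum_(i <- r) f i y).
Proof.
move=> Pf; elim: r => [|i r IH].
  by apply: poly_eq (poly_cst 0) => y; rewrite big_nil.
by apply: poly_eq (poly_add (Pf i) IH) => y; rewrite big_cons.
Qed.

Lemma poly_prod (I : Type) (r : seq I) (f : I -> Y -> F) :
  (forall i, poly (f i)) -> poly (fun y => \prod_(i <- r) f i y).
Proof.
move=> Pf; elim: r => [|i r IH].
  by apply: poly_eq (poly_cst 1) => y; rewrite big_nil.
by apply: poly_eq (poly_mul (Pf i) IH) => y; rewrite big_cons.
Qed.

Lemma poly_exp f n : poly f -> poly (fun y => f y ^+ n).
Proof.
move=> Pf; elim: n => [|n IH]; first exact: poly_cst.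
by apply: poly_eq (poly_mul Pf IH) => y; rewrite exprS.
Qed.

Definition poly_mx p q (M : Y -> 'M[F]_(p, q)) : Prop :=
  forall i j, poly (fun y => M y i j).

Lemma poly_mx_cst p q (M : 'M[F]_(p, q)) : poly_mx (fun=> M).
Proof. by move=> i j; apply: poly_cst. Qed.

Lemma poly_mx_add p q (M M' : Y -> 'M[F]_(p, q)) :
  poly_mx M -> poly_mx M' -> poly_mx (fun y => M y + M' y).
Proof.
by move=> PM PM' i j; apply: poly_eq (poly_add (PM i j) (PM' i j)) => y; rewrite mxE.
Qed.

Lemma poly_mx_opp p q (M : Y -> 'M[F]_(p, q)) : poly_mx M -> poly_mx (fun y => - M y).
Proof.
by move=> PM i j; apply: poly_eq (poly_opp (PM i j)) => y; rewrite mxE.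
Qed.

Lemma poly_mx_scale p q f (M : Y -> 'M[F]_(p, q)) :
  poly f -> poly_mx M -> poly_mx (fun y => f y *: M y).
Proof.
by move=> Pf PM i j; apply: poly_eq (poly_mul Pf (PM i j)) => y; rewrite mxE.
Qed.

Lemma poly_mx_mul p q r (M : Y -> 'M[F]_(p, q)) (M' : Y -> 'M[F]_(q, r)) :
  poly_mx M -> poly_mx M' -> poly_mx (fun y => M y *m M' y).
Proof.
move=> PM PM' i j; have P k := poly_mul (PM i k) (PM' k j).
by apply: poly_eq (poly_sum (index_enum 'I_q) P) => y; rewrite mxE.
Qed.

Lemma poly_det p (M : Y -> 'M[F]_p) : poly_mx M -> poly (fun y => \det (M y)).
Proof.
move=> PM; apply: poly_sum => s; apply: poly_mul; first exact: poly_cst.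
by apply: poly_prod => i; apply: PM.
Qed.

Lemma poly_adj p (M : Y -> 'M[F]_p) : poly_mx M -> poly_mx (fun y => \adj (M y)).
Proof.
move=> PM i j; apply: (@poly_eq (fun y => (-1) ^+ (j + i) * \det (row' j (col' i (M y))))).
  by move=> y; rewrite mxE.
apply: poly_mul; first exact: poly_cst.
by apply: poly_det => k l; apply: poly_eq (PM (lift j k) (lift i l)) => y; rewrite !mxE.
Qed.

Section Cramer.
Variables (n : nat) (Sol : Y -> 'cV[F]_n -> Prop).

Definition valid_equation (R : Y -> 'rV[F]_n) (s : Y -> F) : Prop :=
  [/\ poly_mx R, poly s & forall y w, Sol y w -> (R y *m w) 0 0 = s y].

(** The coefficient rows at y0 of the valid equations form a subspace. Nothing
    is orthogonal to it, so it contains the unit rows: some n valid equations have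
    the identity as coefficient matrix at y0, and Cramer's rule applies to them. *)
Lemma cramer y0 :
  (forall w : 'cV_n, (forall R s, valid_equation R s -> R y0 *m w = 0) -> w = 0) ->
  exists Delta (num : Y -> 'cV[F]_n),
    [/\ poly Delta, poly_mx num, Delta y0 != 0 &
        forall y w, Sol y w -> Delta y *: w = num y].
Proof.
move=> uniq_sol.
pose P (r : 'rV[F]_n) := exists R s, valid_equation R s /\ R y0 = r.
have sP : subspace P.
  split=> [|k _ _ [R [s [[PR Ps SR] <-]]] [R' [s' [[PR' Ps' SR'] <-]]]].
    exists (fun=> 0), (fun=> 0); split=> //; split; first exact: poly_mx_cst.
      exact: poly_cst.
    by move=> y w _; rewrite mul0mx mxE.
  exists (fun y => k *: R y + R' y), (fun y => k * s y + s' y); split=> //; split.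
  - by apply/poly_mx_add/PR'/poly_mx_scale/PR/poly_cst.
  - by apply/poly_add/Ps'/poly_mul/Ps/poly_cst.
  - by move=> y w S; rewrite mulmxDl -scalemxAl !mxE -(SR y w S) -(SR' y w S) !mxE.
have full : forall r, P r.
  apply: rV_subspace_full => // w ann; apply: uniq_sol => R s RS.
  by apply: ann; exists R, s.
have /choice[R /choice[s Rs]] := fun i : 'I_n => full (delta_mx 0 i).
pose M y := \matrix_i R i y.
have PM : poly_mx M.
  move=> i j; have [[PR _ _] _] := Rs i.
  by apply: poly_eq (PR 0 j) => y; rewrite mxE.
exists (fun y => \det (M y)), (fun y => \adj (M y) *m \col_i s i y); split.
- exact: poly_det.
- apply: poly_mx_mul; first exact: poly_adj.
  move=> i j; have [[_ Ps _] _] := Rs i.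
  by apply: poly_eq Ps => y; rewrite mxE.
- suff -> : M y0 = 1%:M by rewrite det1 oner_eq0.
  apply/row_matrixP => i; rewrite rowK row1; by have [_ ->] := Rs i.
- move=> y w S; rewrite -mul_scalar_mx -mul_adj_mx -mulmxA; congr (_ *m _).
  apply/matrixP => i j; rewrite ord1 [RHS]mxE; have [[_ _ SR] _] := Rs i.
  by rewrite -(SR y w S) !mxE; apply: eq_bigr => k _; rewrite !mxE.
Qed.

End Cramer.
End FunctionRings.

(** * Generated points are stable *)

Section ClosedOrbits.
Variables (F : fieldType) (D : brane_diagram).
Implicit Types (m : bigM F D) (g : gauge F D).

Local Notation N := (nb5 D).
Local Notation d := (mult D).
Local Notation Y := (bigM F D * F)%type.
Local Notation poly := (@polyfun F D).

Lemma polyfun_ring : function_ring poly.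
Proof. by split; [apply: PolyCst | apply: PolyAdd | apply: PolyMul]. Qed.
Let pr := polyfun_ring.

(** Each entry of the nat-indexed families is a coordinate or constantly zero. *)
Lemma polyfun_coordinates k :
  [/\ poly_mx poly (fun y : Y => mA y.1 k), poly_mx poly (fun y : Y => mb y.1 k),
      poly_mx poly (fun y : Y => ma y.1 k) & poly_mx poly (fun y : Y => mB y.1 k)] /\
  (poly_mx poly (fun y : Y => mC y.1 k) /\ poly_mx poly (fun y : Y => mD y.1 k)).
Proof.
case: (ltnP k N) => [lt_kN|le_Nk]; last first.
  split; split=> i j; apply: poly_eq (poly_cst pr 0) => y.
  1-6: have [[e1 e2 e3 e4] [_ e5 e6]] := m_out y.1 le_Nk.
  1-6: by rewrite ?e1 ?e2 ?e3 ?e4 ?e5 ?e6 mxE.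
pose k' := Ordinal lt_kN; rewrite -[k]/(nat_of_ord k').
have coordE (f : rep F (kind D k') (d k') (d k'.+1) -> F) (h : Y -> F) :
    (forall y, h y = f (y.1 k')) -> coord_rep f \/ (forall x, f x = 0) -> poly h.
  move=> hE [cf|f0]; first by apply: (poly_eq (fun y => esym (hE y))); apply: PolyCoord.
  by apply: poly_eq (poly_cst pr 0) => y; rewrite hE f0.
split; split=> i j.
- by apply: (coordE (fun x => repA x i j)) => [y|]; [rewrite mAE|case: (kind D k') => /=; do [by left; constructor|by right=> x; rewrite mxE]].
- by apply: (coordE (fun x => repb x i j)) => [y|]; [rewrite mbE|case: (kind D k') => /=; do [by left; constructor|by right=> x; rewrite mxE]].
- by apply: (coordE (fun x => repa x i j)) => [y|]; [rewrite maE|case: (kind D k') => /=; do [by left; constructor|by right=> x; rewrite mxE]].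
- by apply: (coordE (fun x => repB x i j)) => [y|]; [rewrite mBE|case: (kind D k') => /=; do [by left; constructor|by right=> x; rewrite mxE]].
- by apply: (coordE (fun x => repC x i j)) => [y|]; [rewrite mCE|case: (kind D k') => /=; do [by left; constructor|by right=> x; rewrite mxE]].
- by apply: (coordE (fun x => repD x i j)) => [y|]; [rewrite mDE|case: (kind D k') => /=; do [by left; constructor|by right=> x; rewrite mxE]].
Qed.

Lemma polyfun_beta x : poly_mx poly (fun y : Y => beta y.1 x).
Proof.
have [[_ _ _ PB] [PC PD]] := polyfun_coordinates x.
move=> i j; case E: (is_D5 (kind D x)).
  by apply: poly_eq (poly_mx_opp pr PB i j) => y; rewrite /beta E.
by apply: poly_eq (poly_mx_mul pr PC PD i j) => y; rewrite /beta E.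
Qed.

Definition gauge_index : finType := {X : D3 D & ('I_(d X) * 'I_(d X))%type}.

Definition gauge_vec g : 'cV[F]_#|gauge_index| :=
  \col_i g (tag (enum_val i)) (tagged (enum_val i)).1 (tagged (enum_val i)).2.

Definition vec_gauge (w : 'cV[F]_#|gauge_index|) : gauge F D :=
  fun X => \matrix_(i, j)
    w (enum_rank (Tagged (fun X : D3 D => ('I_(d X) * 'I_(d X))%type) (i, j))) 0.

Lemma vec_gaugeK w : gauge_vec (vec_gauge w) = w.
Proof.
apply/matrixP => i j; rewrite ord1 !mxE; congr (w _ 0); rewrite -[RHS]enum_valK.
by congr enum_rank; case: (enum_val i) => X [].
Qed.

Lemma gauge_vecK g : vec_gauge (gauge_vec g) = g.
Proof.
by apply: functional_extensionality_dep => X; apply/matrixP => i j; rewrite !mxE enum_rankK.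
Qed.

Definition linear_form (L : Y -> gauge F D -> F) : Prop :=
  exists2 R : Y -> 'rV[F]_#|gauge_index|, poly_mx poly R &
    forall y g, L y g = (R y *m gauge_vec g) 0 0.

Lemma linear_form_eq L L' : (forall y g, L y g = L' y g) -> linear_form L -> linear_form L'.
Proof. by move=> e [R PR RL]; exists R => // y g; rewrite -e. Qed.

Lemma linear_form_add L L' : linear_form L -> linear_form L' ->
  linear_form (fun y g => L y g + L' y g).
Proof.
move=> [R PR RL] [R' PR' RL']; exists (fun y => R y + R' y).
  exact: (poly_mx_add pr).
by move=> y g; rewrite RL RL' mulmxDl [RHS]mxE.
Qed.

Lemma linear_form_scale f L : poly f -> linear_form L ->
  linear_form (fun y g => f y * L y g).
Proof.
move=> Pf [R PR RL]; exists (fun y => f y *: R y).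
  exact: (poly_mx_scale pr).
by move=> y g; rewrite RL -scalemxAl [RHS]mxE.
Qed.

Lemma linear_form_sum (I : Type) (r : seq I) (L : I -> Y -> gauge F D -> F) :
  (forall i, linear_form (L i)) -> linear_form (fun y g => \sum_(i <- r) L i y g).
Proof.
move=> lL; elim: r => [|i r IH].
  exists (fun=> 0); first exact: (poly_mx_cst pr).
  by move=> y g; rewrite big_nil mul0mx mxE.
by apply: linear_form_eq (linear_form_add (lL i) IH) => y g; rewrite big_cons.
Qed.

Lemma linear_form_gaugeN x i j : (x <= N)%N -> linear_form (fun _ g => gaugeN g x i j).
Proof.
rewrite -ltnS => lt; pose X : D3 D := Ordinal lt.
pose t := enum_rank (Tagged (fun X : D3 D => ('I_(d X) * 'I_(d X))%type) ((i, j) : 'I_(d X) * 'I_(d X))).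
exists (fun=> delta_mx 0 t); first exact: (poly_mx_cst pr).
by move=> y g; rewrite -rowE !mxE enum_rankK /= -(gaugeNE g X).
Qed.

Definition linear_mx p q (L : Y -> gauge F D -> 'M[F]_(p, q)) : Prop :=
  forall i j, linear_form (fun y g => L y g i j).

Lemma linear_mx_mull p q r (M : Y -> 'M[F]_(p, q)) (L : Y -> gauge F D -> 'M[F]_(q, r)) :
  poly_mx poly M -> linear_mx L -> linear_mx (fun y g => M y *m L y g).
Proof.
move=> PM lL i j; have l k := linear_form_scale (PM i k) (lL k j).
by apply: linear_form_eq (linear_form_sum (index_enum 'I_q) l) => y g; rewrite mxE.
Qed.

Lemma linear_mx_mulr p q r (M : Y -> 'M[F]_(q, r)) (L : Y -> gauge F D -> 'M[F]_(p, q)) :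
  poly_mx poly M -> linear_mx L -> linear_mx (fun y g => L y g *m M y).
Proof.
move=> PM lL i j; have l k := linear_form_scale (PM k j) (lL i k).
apply: linear_form_eq (linear_form_sum (index_enum 'I_q) l) => y g; rewrite mxE.
by apply: eq_bigr => k _; rewrite mulrC.
Qed.

Lemma linear_mx_sub p q (L L' : Y -> gauge F D -> 'M[F]_(p, q)) :
  linear_mx L -> linear_mx L' -> linear_mx (fun y g => L y g - L' y g).
Proof.
move=> lL lL' i j; have l := linear_form_scale (poly_cst pr (-1)) (lL' i j).
by apply: linear_form_eq (linear_form_add (lL i j) l) => y g; rewrite !mxE mulN1r.
Qed.

(** An inductive family because the equations of a homomorphism have different
    shapes but are to be treated alike: each is linear in g, with coefficients and
    right hand side polynomial in the target point. *)
Inductive hom_equation m : forall p q,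
    (Y -> gauge F D -> 'M[F]_(p, q)) -> (Y -> 'M[F]_(p, q)) -> Prop :=
| HomBeta x of (x < N)%N : hom_equation m
    (fun y g => beta y.1 x *m gaugeN g x - gaugeN g x *m beta m x) (fun=> 0)
| HomA k of D5_at D k : hom_equation m
    (fun y g => mA y.1 k *m gaugeN g k.+1 - gaugeN g k *m mA m k) (fun=> 0)
| Homb k of D5_at D k : hom_equation m
    (fun y g => mb y.1 k *m gaugeN g k.+1) (fun=> mb m k)
| Homa k of D5_at D k : hom_equation m
    (fun y g => gaugeN g k *m ma m k) (fun y => ma y.1 k)
| HomC k of NS5_at D k : hom_equation m
    (fun y g => mC y.1 k *m gaugeN g k.+1 - gaugeN g k *m mC m k) (fun=> 0)
| HomD k of NS5_at D k : hom_equation m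
    (fun y g => mD y.1 k *m gaugeN g k - gaugeN g k.+1 *m mD m k) (fun=> 0).

Lemma hom_equationP c m y g :
  (forall p q L s, @hom_equation m p q L s -> L y g = c *: s y) <->
  intertwines c m y.1 (gaugeN g).
Proof.
split=> [eqs|[homb homD homV] p q L s].
  split=> [x lt|k Dk|k Vk].
  - by apply/subr0_eq; have /eqs := HomBeta m lt; rewrite scaler0.
  - split; last first.
    + exact: (eqs _ _ _ _ (Homa m Dk)).
    + exact: (eqs _ _ _ _ (Homb m Dk)).
    + by apply/subr0_eq; have /eqs := HomA m Dk; rewrite scaler0.
  - by split; apply/subr0_eq; [have /eqs := HomC m Vk|have /eqs := HomD m Vk]; rewrite scaler0.
case=> {p q L s} [x /homb ->|k /homD[-> _ _]|k /homD[]|k /homD[]|k /homV[-> _]|k /homV[_ ->]] //.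
all: by rewrite subrr scaler0.
Qed.

Lemma hom_equation_linear m p q L s : @hom_equation m p q L s ->
  linear_mx L /\ poly_mx poly s.
Proof.
case=> {p q L s} [x lt|k H|k H|k H|k H|k H].
all: have lin x' : (x' <= N)%N -> linear_mx (fun _ g => gaugeN g x')
  by move=> le i j; apply: linear_form_gaugeN.
2-6: have lt : (k < N)%N by case/andP: H.
2-6: have [[PA Pb Pa _] [PC PD]] := polyfun_coordinates k.
all: split; try exact: (poly_mx_cst pr).
all: try apply: linear_mx_sub.
all: try apply: linear_mx_mull => //.
all: try apply: linear_mx_mulr => //.
all: try exact: (poly_mx_cst pr).
all: try exact: polyfun_beta.
all: try by apply: lin => //; apply: ltnW.
all: by [].
Qed.

Lemma vec_gaugeZ k w X : vec_gauge (k *: w) X = k *: vec_gauge w X.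
Proof. by apply/matrixP => i j; rewrite !mxE. Qed.

Lemma chiZ k g : chi (fun X => k *: g X : 'M_(d X)) =
  k ^+ (\sum_(V : NS5 D) d (rightD3 (posNS5 V))) * chi g.
Proof.
rewrite /chi (eq_bigr _ (fun V _ => detZ k (g (rightD3 (posNS5 V))))) big_split /=.
by congr (_ * _); rewrite (big_morph _ (exprD k) (expr0 k)).
Qed.

Lemma intertwines_sub m m' E E' :
  intertwines 1 m m' E -> intertwines 1 m m' E' ->
  intertwines 0 m m' (fun x => E x - E' x).
Proof.
move=> [homb homD homV] [homb' homD' homV'].
split=> [x lt|k Dk|k Vk].
- by rewrite mulmxBr mulmxBl homb // homb'.
- have [EA Eb Ea] := homD k Dk; have [EA' Eb' Ea'] := homD' k Dk.
  by rewrite !mulmxBr !mulmxBl EA EA' Eb Eb' Ea Ea' !subrr !scale0r.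
- have [EC ED] := homV k Vk; have [EC' ED'] := homV' k Vk.
  by rewrite !mulmxBr !mulmxBl EC ED EC' ED'.
Qed.

Lemma chi_neq0 g : gauge_group g -> chi g != 0.
Proof.
by move=> Gg; apply/prodf_neq0 => V _; rewrite -unitfE -unitmxE.
Qed.

(** A gauge transformation from m to m' solves an inhomogeneous linear system in
    which m' enters polynomially. Generation makes the solution unique for every
    m' in [Mtilde], so Cramer's rule expresses it through polynomials; that it
    solves the system and has the correct character are the equations of the
    orbit. The nonvanishing of the character makes the solution invertible. *)
Theorem generated_stable m : Mtilde m -> generated m -> stable_point m.
Proof.
move=> Mm gen; split=> // z z0; split; last first.
  apply: (@sub_finite_set _ _ [set (fun X => 1%:M : 'M_(d X)) : gauge F D]); last exact: finite_set1.
  move=> g [Gg /(congr1 fst) /= gm] /=; apply: gauge_ext => x le_xN.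
  have hg := gauge_hom m Gg; rewrite gm in hg.
  have h1 : intertwines 1 m m (gaugeN (fun X => 1%:M : 'M_(d X))).
    have E1 y : gaugeN (fun X => 1%:M : 'M_(d X)) y = 1%:M :> 'M[F]_(d y).
      case: (ltnP y N.+1) => [lt|le]; first exact: (gaugeNE _ (Ordinal lt)).
      by rewrite /gaugeN extend_out.
    split=> [y _|k _|k _]; rewrite !E1 !mulmx1 !mul1mx ?scale1r //.
  by have /subr0_eq := hom0_eq0 gen Mm (intertwines_sub hg h1) x.
(* The equations are all polynomials vanishing on the orbit; the point is to
   exhibit enough of them. *)
exists [set f | poly f /\ forall y, gauge_orbitz (m, z) y -> f y = 0]; first by move=> f [].
apply/seteqP; split=> [y Oy|y0 [/= My0 vanish]].
  split; last by move=> f [_]; apply.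
  by case: Oy => g Gg <- /=; apply: gauge_act_Mtilde.
pose Sol y w := exists g, [/\ gauge_group g, y = gauge_actz g (m, z) & w = gauge_vec g].
have valid p q L s i j : @hom_equation m p q L s ->
    exists R, valid_equation poly Sol R (fun y => s y i j) /\
              forall y g, L y g i j = (R y *m gauge_vec g) 0 0.
  move=> eqL; have [/(_ i j)[R PR RL] Ps] := hom_equation_linear eqL.
  exists R; split=> //; split=> // y w [g [Gg -> ->]]; rewrite -RL.
  have /(hom_equationP 1 m (gauge_actz g (m, z))) := gauge_hom m Gg.
  by move=> /(_ _ _ _ _ eqL) ->; rewrite scale1r.
have uniq_sol (w : 'cV_#|gauge_index|) : (forall R s, valid_equation poly Sol R s -> R y0 *m w = 0) -> w = 0.
  move=> Rw; have hw : intertwines 0 m y0.1 (gaugeN (vec_gauge w)).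
    apply/hom_equationP => p q L s eqL; apply/matrixP => i j.
    have [R [/Rw Rw0 RL]] := valid _ _ _ _ i j eqL.
    by rewrite RL vec_gaugeK Rw0 scale0r !mxE.
  have w0 X : vec_gauge w X = 0 by rewrite -gaugeNE (hom0_eq0 gen My0 hw).
  by rewrite -(vec_gaugeK w); apply/matrixP => i j; rewrite mxE w0 !mxE.
have [Delta [num [PDelta Pnum Delta0 cram]]] := cramer pr uniq_sol.
pose w0 := (Delta y0)^-1 *: num y0; pose E := vec_gauge w0.
have solved R s : valid_equation poly Sol R s -> (R y0 *m w0) 0 0 = s y0.
  move=> [PR Ps RS].
  have /vanish : [set f | poly f /\ forall y, gauge_orbitz (m, z) y -> f y = 0]
      (fun y => (R y *m num y) 0 0 - Delta y * s y).
    split=> [|_ [g Gg <-]].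
      by apply: (poly_sub pr); [apply: (poly_mx_mul pr)|apply: (poly_mul pr)].
    have S : Sol (gauge_actz g (m, z)) (gauge_vec g) by exists g.
    by rewrite -(cram _ _ S) -scalemxAr mxE RS // subrr.
  by move=> /subr0_eq e; rewrite -scalemxAr mxE e mulKf.
have hE : intertwines 1 m y0.1 (gaugeN E).
  apply/hom_equationP => p q L s eqL; apply/matrixP => i j.
  have [R [/solved Rs RL]] := valid _ _ _ _ i j eqL.
  by rewrite RL vec_gaugeK Rs scale1r.
have chiE0 : z = y0.2 * chi E.
  pose K := \sum_(V : NS5 D) d (rightD3 (posNS5 V)).
  have /vanish : [set f | poly f /\ forall y, gauge_orbitz (m, z) y -> f y = 0]
      (fun y => z * Delta y ^+ K - y.2 * chi (vec_gauge (num y))).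
    split=> [|_ [g Gg <-]].
      apply: (poly_sub pr); apply: (poly_mul pr).
      - exact: (poly_cst pr).
      - exact: (poly_exp pr).
      - exact: PolyZ.
      - apply: (poly_prod pr) => V; apply: (poly_det pr) => i j.
        by apply: poly_eq (Pnum (enum_rank (Tagged _ (i, j))) 0) => y; rewrite mxE.
    have S : Sol (gauge_actz g (m, z)) (gauge_vec g) by exists g.
    rewrite -(cram _ _ S).
    have -> : vec_gauge (Delta (gauge_actz g (m, z)) *: gauge_vec g) =
        fun X => Delta (gauge_actz g (m, z)) *: g X :> 'M_(d X).
      by apply: functional_extensionality_dep => X; rewrite vec_gaugeZ gauge_vecK.
    rewrite chiZ /= -/K; have := chi_neq0 Gg; move: (Delta _) (chi g) => De c c0.
    by field.
  have -> : num y0 = Delta y0 *: w0 by rewrite scalerA mulfV // scale1r.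
  have -> : vec_gauge (Delta y0 *: w0) = fun X => Delta y0 *: E X :> 'M_(d X).
    by apply: functional_extensionality_dep => X; rewrite vec_gaugeZ.
  rewrite chiZ -/K mulrCA => /subr0_eq; rewrite mulrC.
  by apply: mulfI; rewrite expf_neq0.
have chi0 : chi E != 0 by apply: contra_neq z0 => c0; rewrite chiE0 c0 mulr0.
have Eu : forall x, gaugeN E x \in unitmx.
  apply: (hom1_unitmx Mm hE) => k Vk; case/andP: (Vk) => lt_kN kV.
  have /prodf_neq0 /(_ (exist _ (Ordinal lt_kN) kV) isT) := chi0.
  by rewrite -unitfE -unitmxE -(gaugeN_right E (Ordinal lt_kN)).
have [Gg gm gE] := hom_gauge Mm My0 hE Eu.
have eE : (fun X : D3 D => gaugeN E X) = E.
  by apply: functional_extensionality_dep => X; rewrite gaugeNE.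
rewrite eE in Gg gm; exists E => //; rewrite /gauge_actz /= -gm chiE0.
by rewrite mulrCA mulVf // mulr1; case: (y0).
Qed.

End ClosedOrbits.

(** * Stable points are generated *)

(** A polynomial that vanishes at all positive integers is zero. *)
Lemma poly_vanish (F : numFieldType) (p : {poly F}) :
  (forall t, t != 0 -> p.[t] = 0) -> p.[0] = 0.
Proof.
move=> p0; suff -> : p = 0 by rewrite horner0.
apply: contraTeq isT => pn0; pose s : seq F := [seq i.+1%:R | i <- iota 0 (size p)].
have /max_poly_roots : p != 0 by [].
move=> /(_ s); rewrite size_map size_iota ltnn; apply.
  by apply/allP => _ /mapP[i _ ->]; rewrite /root p0 // pnatr_eq0.
rewrite map_inj_uniq ?iota_uniq // => i j /eqP.
by rewrite eqr_nat => /eqP[].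
Qed.

Section Degeneration.
Variables (F : fieldType).

(** Locked, so that distributivity does not rewrite inside it. *)
Definition compl p (P : 'M[F]_p) : 'M[F]_p := locked (1%:M - P).

Lemma complE p (P : 'M[F]_p) : compl P = 1%:M - P.
Proof. by rewrite /compl -lock. Qed.

Lemma addr_compl p (P : 'M[F]_p) : P + compl P = 1%:M.
Proof. by rewrite complE addrC subrK. Qed.

Lemma compl_mul p q (P : 'M[F]_p) (v : 'M[F]_(p, q)) : compl P *m v = v - P *m v.
Proof. by rewrite complE mulmxBl mul1mx. Qed.

Lemma idempotentE p (P : 'M[F]_p) : P *m P = P ->
  [/\ compl P *m P = 0, P *m compl P = 0 & compl P *m compl P = compl P].
Proof.
move=> PP; have PQ : P *m compl P = 0 by rewrite complE mulmxBr mulmx1 PP subrr.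
split=> //; first by rewrite compl_mul PP subrr.
by rewrite compl_mul PQ subr0.
Qed.

(** The conjugate of M under the one-parameter subgroup P + t^{-1} (1 - P), when
    M respects the subspaces with projectors Pl and Pr ([degenerate_conj]); unlike
    the conjugate it is defined at t = 0. *)
Definition degenerate (t : F) p q (Pl : 'M[F]_p) (Pr : 'M[F]_q) (M : 'M[F]_(p, q)) :=
  Pl *m M *m Pr + compl Pl *m M *m compl Pr + t *: (Pl *m M *m compl Pr).

Definition rep_degenerate (t : F) w p q (Pl : 'M[F]_p) (Pr : 'M[F]_q) :
    rep F w p q -> rep F w p q :=
  match w return rep F w p q -> rep F w p q with
  | D5brane => fun x => RepD5
      (degenerate t Pl Pr (opA x)) (opb x *m Pr + t *: (opb x *m compl Pr)) (opa x)
      (degenerate t Pl Pl (opB x)) (degenerate t Pr Pr (opB' x))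
  | NS5brane => fun y => RepNS5
      (degenerate t Pl Pr (opC y)) (degenerate t Pr Pl (opD y))
  end.

Lemma degenerate0 t p q (Pl : 'M[F]_p) (Pr : 'M[F]_q) : degenerate t Pl Pr 0 = 0.
Proof. by rewrite /degenerate !mulmx0 !mul0mx scaler0 !addr0. Qed.

Lemma degenerateN t p q (Pl : 'M[F]_p) (Pr : 'M[F]_q) M :
  degenerate t Pl Pr (- M) = - degenerate t Pl Pr M.
Proof. by rewrite /degenerate !mulmxN !mulNmx scalerN -!opprD. Qed.

Lemma degenerateD t p q (Pl : 'M[F]_p) (Pr : 'M[F]_q) M M' :
  degenerate t Pl Pr (M + M') = degenerate t Pl Pr M + degenerate t Pl Pr M'.
Proof.
by rewrite /degenerate !mulmxDr !mulmxDl scalerDr [X in X + _ = _]addrACA [LHS]addrACA.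
Qed.

Lemma mul_degenerate0 p q r (Pl : 'M[F]_p) (Pr : 'M[F]_q) M (v : 'M[F]_(q, r)) :
  degenerate 0 Pl Pr M *m v =
  Pl *m (M *m (Pr *m v)) + compl Pl *m (M *m (compl Pr *m v)).
Proof. by rewrite /degenerate scale0r addr0 mulmxDl !mulmxA. Qed.

Lemma degenerate_mul p q r (Pl : 'M[F]_p) (Pm : 'M[F]_q) (Pr : 'M[F]_r) M M' :
  Pm *m Pm = Pm -> Pl *m (M *m Pm) = M *m Pm -> Pm *m (M' *m Pr) = M' *m Pr ->
  degenerate 0 Pl Pm M *m degenerate 0 Pm Pr M' = degenerate 0 Pl Pr (M *m M').
Proof.
move=> PP PM PM'; have [QP PQ QQ] := idempotentE PP.
have QM : compl Pl *m (M *m Pm) = 0 by rewrite compl_mul PM subrr.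
apply: mulmx_ext => v; rewrite -mulmxA !mul_degenerate0 (mulmxDr Pm) (mulmxDr (compl Pm)).
rewrite (mulmxA Pm Pm) PP (mulmxA Pm (compl Pm)) PQ mul0mx addr0.
rewrite (mulmxA (compl Pm) Pm) QP mul0mx add0r (mulmxA (compl Pm) (compl Pm)) QQ.
congr (_ + _).
  by rewrite (mulmxA M') (mulmxA Pm) PM' -!mulmxA.
rewrite (compl_mul Pm) mulmxBr mulmxBr (mulmxA M Pm) (mulmxA (compl Pl) (M *m Pm)).
by rewrite QM mul0mx subr0 -!mulmxA.
Qed.

Lemma degenerate_conj t p q (Pl : 'M[F]_p) (Pr : 'M[F]_q) M : t != 0 ->
  Pl *m (M *m Pr) = M *m Pr ->
  degenerate t Pl Pr M = (Pl + t^-1 *: compl Pl) *m M *m (Pr + t *: compl Pr).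
Proof.
move=> t0 PM; rewrite /degenerate !mulmxDr !mulmxDl -!scalemxAl -!scalemxAr -?scalemxAl.
have -> : compl Pl *m M *m Pr = 0 by rewrite -mulmxA compl_mul PM subrr.
by rewrite scaler0 addr0 scalerA mulVf // scale1r -addrA [X in _ + X]addrC.
Qed.

Lemma degenerate_inv t p (P : 'M[F]_p) : t != 0 -> P *m P = P ->
  (P + t^-1 *: compl P) *m (P + t *: compl P) = 1%:M.
Proof.
move=> t0 PP; have [QP PQ QQ] := idempotentE PP.
rewrite mulmxDr !mulmxDl -!scalemxAl -!scalemxAr PQ -?scalemxAl QP QQ !scaler0 addr0 add0r.
by rewrite scalerA mulVf // scale1r PP addr_compl.
Qed.

End Degeneration.

Section StableGenerated.
Variables (F : numFieldType) (D : brane_diagram).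

Local Notation N := (nb5 D).
Local Notation d := (mult D).
Local Notation Y := (bigM F D * F)%type.

Definition poly_in_t (h : F -> F) : Prop := exists p : {poly F}, forall t, h t = p.[t].

Lemma poly_in_t_ring : function_ring poly_in_t.
Proof.
split=> [c|f g [p fp] [q gq]|f g [p fp] [q gq]].
- by exists c%:P => t; rewrite hornerC.
- by exists (p + q) => t; rewrite hornerD fp gq.
- by exists (p * q) => t; rewrite hornerM fp gq.
Qed.
Let pr := poly_in_t_ring.

Lemma poly_in_t_id : poly_in_t id.
Proof. by exists 'X => t; rewrite hornerX. Qed.

Lemma poly_in_t_degenerate p q (Pl : 'M[F]_p) (Pr : 'M[F]_q) M :
  poly_mx poly_in_t (fun t => degenerate t Pl Pr M).
Proof.
apply: (poly_mx_add pr); first exact: (poly_mx_cst pr).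
by apply: (poly_mx_scale pr); [apply: poly_in_t_id | apply: (poly_mx_cst pr)].
Qed.

Lemma poly_in_t_rep_degenerate w p q Pl Pr (x : rep F w p q) f : coord_rep f ->
  poly_in_t (fun t => f (rep_degenerate t Pl Pr x)).
Proof.
case: w x f => x f [] i j /=; try exact: poly_in_t_degenerate; last exact: (poly_cst pr).
apply: (@poly_mx_add _ _ _ pr _ _ (fun=> opb x *m Pr)); first exact: (poly_mx_cst pr).
by apply: (poly_mx_scale pr); [apply: poly_in_t_id | apply: (poly_mx_cst pr)].
Qed.

Variables (m : bigM F D) (Mm : Mtilde m).
Variables (S : forall x, 'cV[F]_(d x) -> Prop) (subS : subrep m S).
Variables (P : forall x, 'M[F]_(d x)).
Hypotheses (PS : forall x v, S (P x *m v)) (SP : forall x (v : 'cV_(d x)), S v -> P x *m v = v).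
Arguments S : clear implicits.

Let sS x : subspace (S x). Proof. by case: subS. Qed.
Let SB x v : S x v -> S x (beta m x *m v).
Proof.
case: subS => _ Sb _ _; case: (ltnP x N) => [/Sb|le_Nx]; first exact.
by move=> Sv; rewrite (mx_norows_eq (beta m x *m v) v (mult_ge_nb5 le_Nx)).
Qed.
Let SA k v : D5_at D k -> S k.+1 v -> S k (mA m k *m v).
Proof. by case: subS => _ _ SD _ Dk; case: (SD k Dk) => + _ _; apply. Qed.
Let SAinv k v : D5_at D k -> S k (mA m k *m v) -> S k.+1 v.
Proof. by case: subS => _ _ SD _ Dk; case: (SD k Dk) => _ + _; apply. Qed.
Let Sa k c : D5_at D k -> S k (ma m k *m c).
Proof. by case: subS => _ _ SD _ Dk; case: (SD k Dk) => _ _; apply. Qed.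
Let SC k v : NS5_at D k -> S k.+1 v -> S k (mC m k *m v).
Proof. by case: subS => _ _ _ SV Vk; case: (SV k Vk) => + _; apply. Qed.
Let SD k v : NS5_at D k -> S k v -> S k.+1 (mD m k *m v).
Proof. by case: subS => _ _ _ SV Vk; case: (SV k Vk) => _; apply. Qed.

Let respects x y (M : 'M[F]_(d y, d x)) :
  (forall v, S x v -> S y (M *m v)) -> P y *m (M *m P x) = M *m P x.
Proof. by move=> SM; apply: mulmx_ext => v; rewrite -!mulmxA SP //; apply/SM/PS. Qed.

Let PP x : P x *m P x = P x.
Proof. by apply: mulmx_ext => v; rewrite -mulmxA SP. Qed.

Let PB x : P x *m (beta m x *m P x) = beta m x *m P x.
Proof. by apply: respects => v; apply: SB. Qed.

Let PA k : D5_at D k -> P k *m (mA m k *m P k.+1) = mA m k *m P k.+1.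
Proof. by move=> Dk; apply: respects => v; apply: SA. Qed.

Let Pa k : D5_at D k -> P k *m ma m k = ma m k.
Proof. by move=> Dk; apply: mulmx_ext => v; rewrite -mulmxA SP //; apply: Sa. Qed.

Let PC k : NS5_at D k -> P k *m (mC m k *m P k.+1) = mC m k *m P k.+1.
Proof. by move=> Vk; apply: respects => v; apply: SC. Qed.

Let PD k : NS5_at D k -> P k.+1 *m (mD m k *m P k) = mD m k *m P k.
Proof. by move=> Vk; apply: respects => v; apply: SD. Qed.

Definition path_rep (t : F) : bigM F D :=
  fun k => rep_degenerate t (P (leftD3 k)) (P (rightD3 k)) (m k).

Lemma path_repE t k :
  [/\ mA (path_rep t) k = degenerate t (P k) (P k.+1) (mA m k),
      mb (path_rep t) k = mb m k *m P k.+1 + t *: (mb m k *m compl (P k.+1)),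
      ma (path_rep t) k = ma m k &
      mB (path_rep t) k = degenerate t (P k) (P k) (mB m k)] /\
  [/\ mB' (path_rep t) k = degenerate t (P k.+1) (P k.+1) (mB' m k),
      mC (path_rep t) k = degenerate t (P k) (P k.+1) (mC m k) &
      mD (path_rep t) k = degenerate t (P k.+1) (P k) (mD m k)].
Proof.
case: (ltnP k N) => [lt_kN|le_Nk]; last first.
  have [[-> -> -> ->] [-> -> ->]] := m_out (path_rep t) le_Nk.
  have [[-> -> -> ->] [-> -> ->]] := m_out m le_Nk.
  by rewrite !degenerate0 !mul0mx scaler0 addr0.
pose k' := Ordinal lt_kN; rewrite -[k]/(nat_of_ord k') !mE.
rewrite /path_rep; move: (m k') (P _) (P _).
by case: (kind D k') => x u v; rewrite /= !(degenerate0, mul0mx) ?scaler0 ?addr0.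
Qed.

Let scaling (t : F) : gauge F D := fun X => P X + t^-1 *: compl (P X).

Let scaling_unit t : t != 0 -> gauge_group (scaling t).
Proof. by move=> t0 X; have [] := mulmx1_unit (degenerate_inv t0 (PP X)). Qed.

Let scaling_inv t x : t != 0 -> (x <= N)%N ->
  gaugeN (scaling t) x = P x + t^-1 *: compl (P x) /\
  invmx (gaugeN (scaling t) x) = P x + t *: compl (P x).
Proof.
move=> t0; rewrite -ltnS => lt.
have e : gaugeN (scaling t) x = P x + t^-1 *: compl (P x) by apply: (gaugeNE _ (Ordinal lt)).
split=> //; rewrite -[RHS](mulKmx (gaugeN_unit x (scaling_unit t0))) e.
by rewrite degenerate_inv // mulmx1.
Qed.

Lemma path_rep_gauge t : t != 0 -> path_rep t = gauge_act (scaling t) m.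
Proof.
move=> t0; apply: bigM_ext => k Hk.
  have lt_kN : (k < N)%N by case/andP: Hk.
  have [[-> -> -> ->] [-> _ _]] := path_repE t k.
  have [[-> -> -> ->] [-> _ _]] := gauge_actE (scaling t) m k.
  have [gk ik] := scaling_inv t0 (ltnW lt_kN); have [gk1 ik1] := scaling_inv t0 lt_kN.
  rewrite ik ik1 gk gk1; split.
  - by rewrite degenerate_conj // PA.
  - by rewrite mulmxDr -scalemxAr.
  - by rewrite mulmxDl -scalemxAl compl_mul Pa // subrr scaler0 addr0.
  - rewrite degenerate_conj //; have := PB k.
    by rewrite beta_D5 // mulNmx mulmxN => /oppr_inj.
  - rewrite degenerate_conj //; have := PB k.+1.
    by rewrite -(beta_leftE (Mtilde_moment Mm) lt_kN) beta_left_D5 // mulNmx mulmxN => /oppr_inj.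
have lt_kN : (k < N)%N by case/andP: Hk.
have [_ [_ -> ->]] := path_repE t k; have [_ [_ -> ->]] := gauge_actE (scaling t) m k.
have [gk ik] := scaling_inv t0 (ltnW lt_kN); have [gk1 ik1] := scaling_inv t0 lt_kN.
by rewrite ik ik1 gk gk1 -!degenerate_conj // ?PC ?PD.
Qed.

Local Notation m0 := (path_rep 0).

Lemma path_rep0_beta x : beta m0 x = degenerate 0 (P x) (P x) (beta m x).
Proof.
case: (ltnP x N) => [lt|le]; last by apply/mx_norows_eq/mult_ge_nb5.
have [[_ _ _ EB] [_ EC ED]] := path_repE 0 x.
case: (brane_atP lt) => [Dx|Vx]; first by rewrite !beta_D5 // EB degenerateN.
by rewrite !beta_NS5 // EC ED degenerate_mul ?PP ?PC ?PD.
Qed.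

Lemma path_rep0_beta_left k : (k < N)%N ->
  beta_left m0 k = degenerate 0 (P k.+1) (P k.+1) (beta_left m k).
Proof.
move=> lt; have [_ [EB EC ED]] := path_repE 0 k.
case: (brane_atP lt) => [Dx|Vx]; first by rewrite !beta_left_D5 // EB degenerateN.
by rewrite !beta_left_NS5 // EC ED degenerate_mul ?PP ?PC ?PD.
Qed.

(** The limit is the direct sum of the subrepresentation and the quotient. (S1)
    holds on the subrepresentation by restriction and on the quotient, where a and
    b vanish, because A is injective there. For (S2), beta A = A beta + a b makes
    S' + im A stable under beta for every beta-stable S' in S that contains im a
    and A S, so S' + im A is everything; by injectivity on the quotient S' = S. *)
Lemma path_rep0_Mtilde : Mtilde m0.
Proof.
have mom := Mtilde_moment Mm; apply/MtildeP; split.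
  apply/moment_zeroP; split=> [k Dk|k lt]; last first.
    by rewrite path_rep0_beta_left 1?ltnW // path_rep0_beta beta_leftE // ltnW.
  have lt_kN : (k < N)%N by case/andP: Dk.
  have [[EA Eb Ea _] _] := path_repE 0 k.
  rewrite path_rep0_beta path_rep0_beta_left // EA Eb Ea beta_leftE //.
  rewrite !degenerate_mul ?PP ?PA ?PB // beta_mA // degenerateD; congr (_ + _).
  rewrite /degenerate !scale0r !addr0 !mulmxA Pa // compl_mul Pa // subrr.
  by rewrite !mul0mx addr0.
move=> k Dk; have lt_kN : (k < N)%N by case/andP: Dk.
have [[EA Eb Ea _] _] := path_repE 0 k.
have [QP PQ QQ] := idempotentE (PP k); have [QP1 PQ1 QQ1] := idempotentE (PP k.+1).
split=> [K sK KB KA Kb v Kv|T sT TB TA Ta].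
  rewrite path_rep0_beta_left // beta_leftE // in KB.
  have PAv w : K w -> mA m k *m (P k.+1 *m w) = 0.
    move=> /KA; rewrite EA mul_degenerate0 => /(congr1 (mulmx (P k))).
    rewrite mulmx0 mulmxDr (mulmxA (P k) (P k)) PP (mulmxA (P k) (compl _)) PQ mul0mx addr0.
    by rewrite (mulmxA (mA m k)) (mulmxA (P k)) PA // -mulmxA.
  have QAv w : K w -> compl (P k) *m (mA m k *m (compl (P k.+1) *m w)) = 0.
    move=> /KA; rewrite EA mul_degenerate0 => /(congr1 (mulmx (compl (P k)))).
    by rewrite mulmx0 mulmxDr (mulmxA (compl _) (P k)) QP mul0mx add0r (mulmxA (compl _) (compl _)) QQ.
  have Pv0 : P k.+1 *m v = 0.
    apply: (Mtilde_S1 Mm Dk (K := fun u => exists2 w, K w & u = P k.+1 *m w)); last by exists v.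
    - split=> [|c _ _ [w1 K1 ->] [w2 K2 ->]].
        by exists 0; [apply: subspace0 | rewrite mulmx0].
      exists (c *: w1 + w2); first by apply: subspaceD => //; apply: subspaceZ.
      by rewrite mulmxDr scalemxAr.
    - move=> _ [w Kw ->]; exists (degenerate 0 (P k.+1) (P k.+1) (beta m k.+1) *m w); first exact: KB.
      rewrite mul_degenerate0 mulmxDr (mulmxA (P _) (P _)) PP (mulmxA (P _) (compl _)) PQ1 mul0mx addr0.
      by rewrite (mulmxA (beta _ _)) (mulmxA (P k.+1)) PB -mulmxA.
    - by move=> _ [w Kw ->]; apply: PAv.
    - by move=> _ [w Kw ->]; have := Kb _ Kw; rewrite Eb scale0r addr0 mulmxA.
  have : S k.+1 (compl (P k.+1) *m v).
    apply: (SAinv Dk); have := QAv v Kv; rewrite compl_mul => /subr0_eq ->.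
    exact: PS.
  move=> /SP; rewrite mulmxA PQ1 mul0mx => /esym.
  by rewrite compl_mul Pv0 subr0.
rewrite path_rep0_beta in TB.
have ST u : S k u -> T u.
  move=> Su.
  pose T1 w := exists t1 w1, [/\ T t1, S k t1 & w = t1 + mA m k *m w1].
  have : T1 u.
    apply: (Mtilde_S2 Mm Dk (T := T1)).
    - split=> [|c _ _ [t1 [w1 [Tt1 St1 ->]]] [t2 [w2 [Tt2 St2 ->]]]].
        by exists 0, 0; rewrite mulmx0 addr0; split=> //; apply: subspace0.
      exists (c *: t1 + t2), (c *: w1 + w2); split.
      + by apply: subspaceD => //; apply: subspaceZ.
      + by apply: subspaceD => //; apply: subspaceZ.
      + by rewrite scalerDr mulmxDr -scalemxAr addrACA.
    - move=> _ [t1 [w1 [Tt1 St1 ->]]].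
      exists (beta m k *m t1 + ma m k *m (mb m k *m w1)), (beta m k.+1 *m w1); split.
      + apply: subspaceD => //; last by have := Ta (mb m k *m w1); rewrite Ea.
        have := TB _ Tt1; rewrite mul_degenerate0 (compl_mul _ t1) (SP St1) subrr !mulmx0 addr0.
        by rewrite SP //; apply: SB.
      + by apply: subspaceD => //; [apply: SB | apply: Sa].
      + rewrite mulmxDr (mulmxA (beta m k) (mA m k)) beta_mA // mulmxDl -!mulmxA.
        by rewrite -addrA [X in _ + X]addrC.
    - by move=> w; exists 0, w; rewrite add0r; split=> //; apply: subspace0.
    - move=> c; exists (ma m k *m c), 0; rewrite mulmx0 addr0; split=> //.
        by rewrite -Ea.
      exact: Sa.
  move=> [t1 [w1 [Tt1 St1 eu]]].
  have Sw1 : S k.+1 w1.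
    apply: (SAinv Dk); have -> : mA m k *m w1 = u - t1 by rewrite eu addrC addKr.
    exact: subspaceB.
  rewrite eu; apply: subspaceD => //; have := TA w1.
  rewrite EA mul_degenerate0 (compl_mul _ w1) (SP Sw1) subrr !mulmx0 addr0.
  by rewrite SP //; apply: SA.
(* T contains S, and S + im A is everything; it remains to reach im A modulo S. *)
move=> v; pose T2 w := exists u w1, S k u /\ w = u + mA m k *m w1.
have [u [w1 [Su ->]]] : T2 v.
  apply: (Mtilde_S2 Mm Dk (T := T2)).
  - split=> [|c _ _ [t1 [w1 [St1 ->]]] [t2 [w2 [St2 ->]]]].
      by exists 0, 0; rewrite mulmx0 addr0; split=> //; apply: subspace0.
    exists (c *: t1 + t2), (c *: w1 + w2); split.
      by apply: subspaceD => //; apply: subspaceZ.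
    by rewrite scalerDr mulmxDr -scalemxAr addrACA.
  - move=> _ [t1 [w1 [St1 ->]]].
    exists (beta m k *m t1 + ma m k *m (mb m k *m w1)), (beta m k.+1 *m w1); split.
      by apply: subspaceD => //; [apply: SB | apply: Sa].
    rewrite mulmxDr (mulmxA (beta m k) (mA m k)) beta_mA // mulmxDl -!mulmxA.
    by rewrite -addrA [X in _ + X]addrC.
  - by move=> w; exists 0, w; rewrite add0r; split=> //; apply: subspace0.
  - by move=> c; exists (ma m k *m c), 0; rewrite mulmx0 addr0; split=> //; apply: Sa.
apply: subspaceD; [done | exact: ST |].
have -> : mA m k *m w1 = P k *m (mA m k *m w1) + compl (P k) *m (mA m k *m w1).
  by rewrite -mulmxDl addr_compl mul1mx.
apply: subspaceD; [done | exact/ST/PS |].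
have -> : compl (P k) *m (mA m k *m w1) = mA m0 k *m (compl (P k.+1) *m w1).
  rewrite EA mul_degenerate0 (mulmxA (P k.+1)) PQ1 mul0mx !mulmx0 add0r.
  rewrite (mulmxA (compl _) (compl _)) QQ1 (compl_mul _ w1) !mulmxBr.
  suff -> : compl (P k) *m (mA m k *m (P k.+1 *m w1)) = 0 by rewrite subr0.
  by rewrite (mulmxA (mA m k)) mulmxA compl_mul PA // subrr mul0mx.
exact: TA.
Qed.

(** If the subspace is proper at some D3 brane to the right of an NS5 brane, then
    the inverse of the character tends to 0 along the path, so the limit lies in the closure of
    the orbit but not in the orbit. *)
Lemma path_rep_unstable k u : NS5_at D k -> ~ S k.+1 u -> ~ stable_point m.
Proof.
move=> Vk Su [_ /(_ 1 (oner_neq0 _))[[I polyI eqI] _]].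
(* The inverse of the character along the path, as a polynomial in t. *)
pose zpath (t : F) := \prod_(V : NS5 D) \det (P (rightD3 (posNS5 V)) + t *: compl (P (rightD3 (posNS5 V)))).
pose path t : Y := (path_rep t, zpath t).
have path_poly f : polyfun f -> poly_in_t (fun t => f (path t)).
  elim=> [c||k' h ch|h1 h2 _ IH1 _ IH2|h1 h2 _ IH1 _ IH2].
  - exact: (poly_cst pr).
  - apply: (poly_prod pr) => V; apply: (poly_det pr).
    apply: (@poly_mx_add _ _ _ pr _ _ (fun=> P (rightD3 (posNS5 V)))); first exact: (poly_mx_cst pr).
    by apply: (poly_mx_scale pr); [apply: poly_in_t_id | apply: (poly_mx_cst pr)].
  - exact: poly_in_t_rep_degenerate.
  - exact: (poly_add pr).
  - exact: (poly_mul pr).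
have path_orbit t : t != 0 -> gauge_orbitz (m, 1) (path t).
  move=> t0; exists (scaling t); first exact: scaling_unit.
  rewrite /gauge_actz /path path_rep_gauge //; congr (_, _); rewrite /= mulr1 -prodfV.
  apply: eq_bigr => V _; rewrite -det_inv -[X in invmx X](gaugeN_right (scaling t)).
  by have [_ ->] := scaling_inv t0 (ltn_ord (posNS5 V)).
have z0 : zpath 0 = 0.
  case/andP: (Vk) => lt_kN kV.
  apply/eqP/prodf_eq0; exists (exist _ (Ordinal lt_kN) kV) => //.
  rewrite scale0r addr0 -[_ == 0]negbK -unitfE -unitmxE.
  apply/negP => unitP; apply: Su.
  by rewrite -(mulKVmx unitP u); apply: PS.
have : gauge_orbitz (m, 1) (path 0).
  rewrite eqI; split; first exact: path_rep0_Mtilde.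
  move=> f If; have [p fp] := path_poly f (polyI f If).
  rewrite fp; apply: poly_vanish => t /path_orbit.
  by rewrite eqI => -[_ /(_ f If)]; rewrite fp.
move=> [g Gg /(congr1 snd)] /=; rewrite z0 mulr1 => /eqP.
by rewrite invr_eq0 (negbTE (chi_neq0 Gg)).
Qed.

End StableGenerated.

Theorem stable_generated (F : numFieldType) (D : brane_diagram) (m : bigM F D) :
  stable_point m -> generated m.
Proof.
move=> stm S subS; have [Mm _] := stm; have [sS _ SD _] := subS.
pose P x := projT1 (cid (subspace_projector (sS x))).
have PS x v : S x (P x *m v) by have [+ _] := projT2 (cid (subspace_projector (sS x))); apply.
have SP x v : S x v -> P x *m v = v by have [_] := projT2 (cid (subspace_projector (sS x))); apply.
have SV k v : NS5_at D k -> S k.+1 v.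
  move=> Vk; apply: contrapT => Sv.
  exact: (path_rep_unstable Mm subS PS SP Vk Sv stm).
have Sout x v : mult D x = 0%N -> S x v.
  by move=> dx; rewrite (mx_norows_eq v 0 dx); apply: subspace0.
elim=> [|k IH] v; first by apply/Sout/mult_first.
case: (ltnP k (nb5 D)) => [lt|le]; last by apply/Sout/mult_ge_nb5/leqW.
case: (brane_atP lt) => [Dk|Vk]; last exact: SV.
by have [_ SAinv _] := SD k Dk; apply: SAinv.
Qed.

(** * Columns of butterflies *)

Section Columns.
Variables (D : brane_diagram) (S : {set tie D}) (U : D5 D).
Local Notation N := (nb5 D).
Local Notation u := (posD5 U : nat).
Local Notation n := (nties S U).
Local Notation top := (top_height S U).

Definition in_column x (s : int) : bool := top x - (n x)%:Z < s <= top x.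

Lemma mem_dots x s : ((u, s) \in dots S x) = in_column x s.
Proof.
apply/allpairsPdep/andP => [[U' [i [_ Hi [/val_inj/val_inj e ->]]]]|[lo hi]].
  by subst U'; rewrite mem_iota in Hi; split; lia.
exists U, `|top x - s|%N; split; rewrite ?mem_enum // ?mem_iota; first lia.
congr pair; lia.
Qed.

Lemma posD5_D5_at : D5_at D u.
Proof. by rewrite /D5_at ltn_ord; apply: (valP U). Qed.

Lemma posNS5_NS5_at (V : NS5 D) : NS5_at D (posNS5 V).
Proof. by rewrite /NS5_at ltn_ord; apply: (valP V). Qed.

Definition ties_at k : nat := \sum_(V : NS5 D | (posNS5 V : nat) == k) ((U, V) \in S).

Lemma ties_at_le1 k : (ties_at k <= 1)%N.
Proof.
rewrite /ties_at; case: (pickP (fun V : NS5 D => (posNS5 V : nat) == k)) => [V Vk|no].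
  rewrite (big_pred1 V) ?leq_b1 // => V'; apply/eqP/eqP => [V'k|->]; last exact/eqP.
  by apply/val_inj/val_inj; rewrite /= (eqP Vk).
by rewrite big_pred0.
Qed.

Lemma ties_at_D5 k : D5_at D k -> ties_at k = 0%N.
Proof.
move=> /andP[_ Dk]; apply: big_pred0 => V; apply/eqP => Vk.
by have /andP[_] := posNS5_NS5_at V; rewrite is_NS5N Vk Dk.
Qed.

Lemma posNS5_neq (V : NS5 D) : (posNS5 V : nat) <> u.
Proof.
move=> e; have /andP[_] := posNS5_NS5_at V; rewrite is_NS5N e.
by have /andP[_ ->] := posD5_D5_at.
Qed.

Lemma ntiesE x (P : nat -> bool) :
  (forall V : NS5 D, covers (U, V) x = P (posNS5 V)) ->
  n x = (\sum_(V : NS5 D | P (posNS5 V)) ((U, V) \in S))%N.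
Proof.
move=> cP; rewrite /nties -sum1_card (big_mkcond (fun V : NS5 D => P _)) /=.
rewrite (reindex_onto (fun V : NS5 D => (U, V)) snd) /=; last first.
  by case=> U' V; rewrite !inE /= => /and3P[_ /eqP -> _].
rewrite (big_mkcond (fun V : NS5 D => _)) /=; apply: eq_bigr => V _.
by rewrite !inE /= !eqxx cP andbT; case: (P _); case: (_ \in S).
Qed.

Lemma nties_left x : (x <= u)%N ->
  n x = (\sum_(V : NS5 D | (posNS5 V < x)%N) ((U, V) \in S))%N.
Proof.
move=> le; apply: (ntiesE (P := fun v => (v < x)%N)) => V; have := @posNS5_neq V.
by rewrite /covers /=; lia.
Qed.

Lemma nties_right x : (u < x)%N ->
  n x = (\sum_(V : NS5 D | (x <= posNS5 V)%N) ((U, V) \in S))%N.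
Proof.
move=> le; apply: (ntiesE (P := fun v => (x <= v)%N)) => V; have := @posNS5_neq V.
by rewrite /covers /=; lia.
Qed.

Lemma nties_leftS k : (k < u)%N -> n k.+1 = (n k + ties_at k)%N.
Proof.
move=> lt; rewrite (nties_left lt) (nties_left (ltnW lt)) (bigID (fun V : NS5 D => (posNS5 V < k)%N)) /=.
by congr (_ + _)%N; apply: eq_bigl => V; lia.
Qed.

Lemma nties_rightS k : (u < k)%N -> n k = (n k.+1 + ties_at k)%N.
Proof.
move=> lt; rewrite (nties_right lt) (nties_right (leqW lt)) (bigID (fun V : NS5 D => (k < posNS5 V)%N)) /=.
by congr (_ + _)%N; apply: eq_bigl => V; lia.
Qed.

Lemma nties_first : n 0 = 0%N.
Proof. by rewrite nties_left // big_pred0. Qed.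

Lemma nties_out x : (N <= x)%N -> n x = 0%N.
Proof.
move=> le; rewrite nties_right; last by apply: leq_trans le.
by rewrite big_pred0 // => V; apply/negbTE; rewrite -ltnNge; apply: leq_trans le.
Qed.

Lemma top_heightS k : (k < u)%N -> top k = top k.+1 - (NS5_at D k)%:Z.
Proof.
move=> lt; rewrite /top_height.
have -> : (u < k)%N = false by lia.
have -> : (u < k.+1)%N = false by lia.
rewrite -opprD -PoszD; congr (- (Posz _)).
have cntE x : #|[set V : NS5 D | (x <= posNS5 V < u)%N]%SET| =
    (\sum_(V : NS5 D | (x <= posNS5 V < u)%N) 1)%N.
  by rewrite -sum1_card; apply: eq_bigl => V; rewrite inE.
rewrite !cntE (bigID (fun V : NS5 D => (k < posNS5 V)%N)) /=; congr (_ + _)%N.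
  by apply: eq_bigl => V; lia.
rewrite (eq_bigl (fun V : NS5 D => (posNS5 V : nat) == k)); last by move=> V; lia.
case Vk: (NS5_at D k).
  by case/andP: Vk => lt_kN kV; rewrite (big_pred1 (exist _ (Ordinal lt_kN) kV)).
rewrite big_pred0 // => V; apply/eqP => e.
by have := posNS5_NS5_at V; rewrite e Vk.
Qed.

Lemma top_height_D5 k : (k < u)%N -> D5_at D k -> top k = top k.+1.
Proof.
move=> lt Dk; rewrite (top_heightS lt) (_ : NS5_at D k = false) ?subr0 //.
by apply/andP => -[_]; rewrite is_NS5N; case/andP: Dk => _ ->.
Qed.

Lemma top_height_pos : top u = 0.
Proof.
rewrite /top_height ltnn; apply/eqP; rewrite oppr_eq0; apply/eqP; congr Posz.
by apply/eqP; rewrite cards_eq0; apply/eqP/setP => V; rewrite !inE; lia.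
Qed.

Lemma top_height_right x : (u < x)%N -> top x = (n u.+1)%:Z - (n u)%:Z.
Proof. by rewrite /top_height => ->. Qed.

(** Away from U a D5 brane carries no tie of U, so the number of dots and their
    heights are the same on both sides. *)
Lemma in_column_D5 k s : D5_at D k -> k <> u -> in_column k s = in_column k.+1 s.
Proof.
move=> Dk ne; have t0 := ties_at_D5 Dk.
have NV : NS5_at D k = false by apply/andP => -[_]; rewrite is_NS5N; case/andP: Dk => _ ->.
rewrite /in_column; case: (ltngtP k u) => [lt|lt|//].
  by rewrite nties_leftS // (top_heightS lt) t0 NV addn0 subr0.
by rewrite (nties_rightS lt) t0 addn0 !top_height_right // leqW.
Qed.

Lemma in_column_pos s :
  in_column u s = (- (n u)%:Z < s <= 0) /\
  in_column u.+1 s = (- (n u)%:Z < s <= (n u.+1)%:Z - (n u)%:Z).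
Proof.
rewrite /in_column top_height_pos sub0r top_height_right //; split=> //.
by rewrite addrAC subrr sub0r.
Qed.

(** An NS5 brane to the left of U lowers the top height by one and removes at most
    one dot, so the removed dot is the bottom one. *)
Lemma in_column_left_NS5 k : NS5_at D k -> (k < u)%N ->
  exists t : int, exists l l' : nat,
    [/\ (l <= l' <= l.+1)%N, forall s, in_column k s = (t - 1 - l%:Z < s <= t - 1) &
        forall s, in_column k.+1 s = (t - l'%:Z < s <= t)].
Proof.
move=> Vk lt; exists (top k.+1), (n k), (n k.+1); rewrite /in_column (top_heightS lt) Vk.
by split=> //; have := ties_at_le1 k; rewrite nties_leftS //; lia.
Qed.

Lemma in_column_right_NS5 k : NS5_at D k -> (u < k)%N ->
  exists t : int, exists l l' : nat,
    [/\ (l' <= l <= l'.+1)%N, forall s, in_column k s = (t - l%:Z < s <= t) &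
        forall s, in_column k.+1 s = (t - l'%:Z < s <= t)].
Proof.
move=> Vk lt; exists (top k), (n k), (n k.+1); rewrite /in_column !top_height_right //; last exact: leqW.
by split=> //; have := ties_at_le1 k; rewrite (nties_rightS lt); lia.
Qed.

End Columns.

Lemma size_dots_ties (D : brane_diagram) (S : {set tie D}) x :
  size (dots S x) = #|[set t in S | covers t x]%SET|.
Proof.
rewrite /dots size_allpairs_dep.
rewrite (eq_map (g := fun U => nties S U x)); last by move=> U; rewrite size_iota.
rewrite sumnE big_map big_enum /= -sum1_card.
rewrite (partition_big (fun t : tie D => t.1) xpredT) //=.
apply: eq_bigr => U _; rewrite /nties -sum1_card; apply: eq_bigl => t.
by rewrite !inE -andbA [covers _ _ && _]andbC.
Qed.

Lemma dots_D5 (D : brane_diagram) (S : {set tie D}) x c :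
  c \in dots S x -> exists2 U : D5 D, c.1 = posD5 U & in_column S U x c.2.
Proof.
move=> cx; have /allpairsPdep[U [i [_ _ e]]] := cx.
by rewrite e in cx *; exists U; rewrite //= -mem_dots.
Qed.

(** * The butterfly representation *)

Section Butterfly.
Variables (F : fieldType) (D : brane_diagram) (S : {set tie D}).
Hypothesis tieS : tie_diagram S.
Local Notation N := (nb5 D).
Local Notation d := (mult D).

Lemma size_dotsN x : size (dots S x) = d x.
Proof.
case: (ltnP x N.+1) => [lt|le]; first exact: (size_dots (Ordinal lt) tieS).
rewrite mult_ge_nb5 ?(ltnW le) // size_dots_ties; apply/eqP; rewrite cards_eq0.
apply/eqP/setP => -[U V]; rewrite !inE /covers /=; apply/negbTE; rewrite !negb_and.
have := ltn_ord (posD5 U); have := ltn_ord (posNS5 V); lia.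
Qed.

Lemma ith_dot_mem x (j : 'I_(d x)) : ith_dot S x j \in dots S x.
Proof. by rewrite mem_nth // size_dotsN. Qed.

Lemma ith_dot_inj x (i j : 'I_(d x)) : (ith_dot S x i == ith_dot S x j) = (i == j).
Proof. by rewrite nth_uniq ?size_dotsN ?uniq_dots. Qed.

Lemma ith_dot_surj x c : c \in dots S x -> exists j : 'I_(d x), ith_dot S x j = c.
Proof.
move=> cx; have lt : (index c (dots S x) < d x)%N by rewrite -size_dotsN index_mem.
by exists (Ordinal lt); rewrite /ith_dot /= nth_index.
Qed.

Definition dvec c x : 'cV[F]_(d x) := dot_vec F S c x.

Lemma dvec_ith x (j : 'I_(d x)) : dvec (ith_dot S x j) x = delta_mx j 0.
Proof. by apply/matrixP => i k; rewrite !mxE ord1 ith_dot_inj eqxx andbT. Qed.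

Lemma dvec_out c x : c \notin dots S x -> dvec c x = 0.
Proof.
move=> cx; apply/matrixP => i k; rewrite !mxE; case: eqP => // e.
by rewrite -e ith_dot_mem in cx.
Qed.

Lemma dvec_span x (v : 'cV[F]_(d x)) : v = \sum_j v j 0 *: dvec (ith_dot S x j) x.
Proof.
rewrite {1}(matrix_sum_delta v); apply: eq_bigr => j _.
by rewrite big_ord1 dvec_ith.
Qed.

Lemma dvec_ext x p (M M' : 'M[F]_(p, d x)) :
  (forall c, c \in dots S x -> M *m dvec c x = M' *m dvec c x) -> M = M'.
Proof.
move=> eqM; apply: mulmx_ext => v; rewrite (dvec_span v) !mulmx_sumr.
by apply: eq_bigr => j _; rewrite -!scalemxAr eqM ?ith_dot_mem.
Qed.

Lemma subspace_dvec x (P : 'cV[F]_(d x) -> Prop) : subspace P ->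
  (forall c, c \in dots S x -> P (dvec c x)) -> forall v, P v.
Proof.
move=> sP Pd v; rewrite (dvec_span v); apply: subspace_sum => // j _.
by apply: subspaceZ => //; apply/Pd/ith_dot_mem.
Qed.

Lemma mul_dvec x p (M : 'M[F]_(p, d x)) (f : dot -> 'cV[F]_p) c :
  (forall i j, M i j = f (ith_dot S x j) i 0) ->
  M *m dvec c x = if c \in dots S x then f c else 0.
Proof.
move=> Mf; case: ifP => [|/negbT cx]; last by rewrite dvec_out ?mulmx0.
move=> /ith_dot_surj[j <-]; rewrite dvec_ith -colE; apply/matrixP => i k.
by rewrite mxE Mf ord1.
Qed.

Lemma dot_map_dvec f x y c : dot_map F S f x y *m dvec c x =
  if c \in dots S x then dvec (f c) y else 0.
Proof. by apply: (mul_dvec (f := fun c => dvec (f c) y)) => i j; rewrite !mxE. Qed.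

Lemma dot_covec_dvec c0 x c : dot_covec F S c0 x *m dvec c x =
  ((c \in dots S x) && (c == c0))%:R%:M.
Proof.
rewrite (mul_dvec (f := fun c => (c == c0)%:R%:M)) => [|i j]; last by rewrite !mxE !ord1.
by case: ifP => // _; rewrite raddf0.
Qed.

Lemma dot_covec_map f x y c : injective f -> f c \in dots S y ->
  dot_covec F S (f c) y *m dot_map F S f x y = dot_covec F S c x.
Proof.
move=> injf fcy; apply: dvec_ext => c' c'x.
rewrite -mulmxA dot_map_dvec c'x !dot_covec_dvec c'x /= (inj_eq injf).
by case: eqP => [->|_]; rewrite ?fcy ?andbF.
Qed.

Lemma lower_inj : injective lower.
Proof. by move=> [u s] [u' s'] [-> /addIr ->]. Qed.

Local Notation mS := (butterfly F S).

Lemma butterfly_D5 k : D5_at D k ->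
  [/\ mA mS k = dot_map F S same_height k.+1 k, mb mS k = - dot_covec F S (k, 1) k.+1,
      ma mS k = dvec (k, 0) k, mB mS k = - dot_map F S lower k k &
      mB' mS k = - dot_map F S lower k.+1 k.+1].
Proof.
move=> /andP[lt kD]; pose k' := Ordinal lt; rewrite -[k]/(nat_of_ord k') !mE.
by rewrite /butterfly; move: kD; rewrite -[k]/(nat_of_ord k'); case: (kind D k').
Qed.

Lemma butterfly_NS5 k : NS5_at D k ->
  mC mS k = dot_map F S lower k.+1 k /\ mD mS k = dot_map F S same_height k k.+1.
Proof.
move=> /andP[lt kV]; pose k' := Ordinal lt; rewrite -[k]/(nat_of_ord k') !mE.
by rewrite /butterfly; move: kV; rewrite -[k]/(nat_of_ord k'); case: (kind D k').
Qed.

Lemma NS5_column_cases k (U : D5 D) (P : Prop) : NS5_at D k ->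
  (forall (e t : int) (l l' : nat), (l <= l' <= l.+1)%N /\ e = 1 \/ (l' <= l <= l'.+1)%N /\ e = 0 ->
     (forall s, in_column S U k s = (t - e - l%:Z < s <= t - e)) ->
     (forall s, in_column S U k.+1 s = (t - l'%:Z < s <= t)) -> P) -> P.
Proof.
move=> Vk cases; case: (ltngtP k (posD5 U)) => [lt|lt|e].
- have [t [l [l' [ll inl inr]]]] := in_column_left_NS5 S Vk lt.
  by apply: (cases 1 t l l') => //; left.
- have [t [l [l' [ll inl inr]]]] := in_column_right_NS5 S Vk lt.
  by apply: (cases 0 t l l') => //; [right | move=> s; rewrite subr0].
- by move: Vk; rewrite e /NS5_at is_NS5N; have /andP[-> ->] := posD5_D5_at U.
Qed.

(** C D and D C both send a dot to the one below it if the intermediate dot exists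
    on the other side; the only dot that can be missing there has no dot below it. *)
Lemma butterfly_CD k : NS5_at D k ->
  mC mS k *m mD mS k = dot_map F S lower k k /\
  mD mS k *m mC mS k = dot_map F S lower k.+1 k.+1.
Proof.
move=> Vk; have [-> ->] := butterfly_NS5 Vk.
split; apply: dvec_ext => -[u s] cx; rewrite -mulmxA !dot_map_dvec cx dot_map_dvec.
all: case: ifP => [//|/negbT]; rewrite /lower /same_height /=.
all: have [U /= cU _] := dots_D5 cx; move: cx; rewrite cU !mem_dots => cx cN.
all: rewrite dvec_out // mem_dots; move: cx cN.
all: apply: (NS5_column_cases (U := U) Vk) => e t l l' ll inl inr.
all: rewrite ?inl ?inr; lia.
Qed.

Lemma butterfly_beta x : beta mS x = dot_map F S lower x x.
Proof.
case: (ltnP x N) => [lt|le]; last by apply/mx_norows_eq/mult_ge_nb5.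
case: (brane_atP lt) => [Dx|Vx].
  by rewrite beta_D5 //; have [_ _ _ -> _] := butterfly_D5 Dx; rewrite opprK.
by rewrite beta_NS5 //; have [-> _] := butterfly_CD Vx.
Qed.

Lemma butterfly_beta_left k : (k < N)%N -> beta_left mS k = dot_map F S lower k.+1 k.+1.
Proof.
move=> lt; case: (brane_atP lt) => [Dx|Vx].
  by rewrite beta_left_D5 //; have [_ _ _ _ ->] := butterfly_D5 Dx; rewrite opprK.
by rewrite beta_left_NS5 //; have [_ ->] := butterfly_CD Vx.
Qed.

Lemma butterfly_mA k c : D5_at D k ->
  mA mS k *m dvec c k.+1 = if c \in dots S k.+1 then dvec c k else 0.
Proof. by move=> /butterfly_D5[-> _ _ _ _]; rewrite dot_map_dvec. Qed.

Lemma butterfly_mb k c : D5_at D k ->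
  mb mS k *m dvec c k.+1 = - ((c \in dots S k.+1) && (c == (k, 1)))%:R%:M.
Proof. by move=> /butterfly_D5[_ -> _ _ _]; rewrite mulNmx dot_covec_dvec. Qed.

Lemma in_column_mem_D5 k c : D5_at D k -> c.1 <> k -> (c \in dots S k) = (c \in dots S k.+1).
Proof.
move=> Dk; case: c => [u s] /= ne; apply/idP/idP => cx.
all: have [U /= e inU] := dots_D5 cx; subst u; rewrite mem_dots.
  by rewrite -in_column_D5 // => e; apply: ne.
by rewrite in_column_D5 // => e; apply: ne.
Qed.

Lemma D5_brane k : D5_at D k -> exists U : D5 D, k = posD5 U.
Proof. by case/andP=> lt kD; exists (exist _ (Ordinal lt) kD). Qed.

(** In the butterfly of U, A beta and beta A agree except on the dot of height 1 to
    the right of U, which A kills while A beta sends it to the dot of height 0, if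
    there is one; the term a b compensates. *)
Lemma butterfly_moment_D5 k : D5_at D k ->
  beta mS k *m mA mS k = mA mS k *m beta_left mS k + ma mS k *m mb mS k.
Proof.
move=> Dk; have lt : (k < N)%N by case/andP: Dk.
rewrite butterfly_beta butterfly_beta_left //.
apply: dvec_ext => c cx; rewrite mulmxDl -!mulmxA butterfly_mA // butterfly_mb // cx /=.
rewrite dot_map_dvec dot_map_dvec cx butterfly_mA // mulmxN.
have [U e] := D5_brane Dk; have [_ _ -> _ _] := butterfly_D5 Dk.
case: (eqVneq c.1 k) => [ck|/eqP ck].
  case: c cx ck => u s cx /= ck; subst u; subst k.
  move: cx; rewrite /lower /= !mem_dots; have [-> ->] := in_column_pos S U s.
  have [inl inr] := in_column_pos S U (s - 1); rewrite inr.
  rewrite xpair_eqE eqxx /= => cx; case: (ltrP 0 s) => [s0|s0]; last first.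
    have -> : (s == 1) = false by lia.
    rewrite raddf0 mulmx0 subr0.
    case/andP: (cx) => -> _ /=; case: ifP => // no.
    by rewrite dvec_out // mem_dots inl; lia.
  rewrite andbF.
  case: eqP => [s1|s1]; last first.
    rewrite raddf0 mulmx0 subr0; case: ifP => // _.
    by rewrite dvec_out // mem_dots inl; lia.
  subst s; rewrite mulmx1 subrr; case: ifP => [_|no]; first by rewrite subrr.
  rewrite dvec_out ?subrr // mem_dots; have [-> _] := in_column_pos S U 0; lia.
rewrite in_column_mem_D5 // cx; have -> : (c == (k, 1)) = false by apply/eqP => ce; rewrite ce in ck.
rewrite raddf0 mulmx0 subr0 -in_column_mem_D5 //; case: ifP => // /negbT.
by move=> /dvec_out.
Qed.

Lemma dot_covec_ith x (j : 'I_(d x)) (v : 'cV[F]_(d x)) :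
  (dot_covec F S (ith_dot S x j) x *m v) 0 0 = v j 0.
Proof.
have -> : dot_covec F S (ith_dot S x j) x = delta_mx 0 j.
  by apply/matrixP => a b; rewrite !mxE ord1 ith_dot_inj.
by rewrite -rowE mxE.
Qed.

(** The coefficients of a vector of K vanish by induction on the height above
    the bottom of the column: beta moves a coefficient down, and at the bottom
    it is read off by A or, if the butterfly has no dots to the left, by b. *)
Lemma butterfly_S1 k : D5_at D k -> S1_at mS k.
Proof.
move=> Dk K sK KB KA Kb v Kv; have lt : (k < N)%N by case/andP: Dk.
rewrite butterfly_beta_left // in KB.
have coef0 (h : nat) (U : D5 D) (s : int) : in_column S U k.+1 s ->
    s <= top_height S U k.+1 - (nties S U k.+1)%:Z + h%:Z ->
    forall v, K v -> dot_covec F S (posD5 U : nat, s) k.+1 *m v = 0.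
  elim: h s => [|h IH] s ins les w Kw.
    by move: ins; rewrite /in_column; lia.
  case ins1: (in_column S U k.+1 (s - 1)).
    rewrite -(@dot_covec_map lower k.+1 k.+1 _ lower_inj) ?mem_dots //.
    have les1 : s - 1 <= top_height S U k.+1 - (nties S U k.+1)%:Z + h%:Z by lia.
    by rewrite -mulmxA; apply: (IH _ ins1 les1); apply: KB.
  case sk: ((posD5 U : nat, s) \in dots S k).
    rewrite -(@dot_covec_map same_height k.+1 k) //.
    have [EA _ _ _ _] := butterfly_D5 Dk.
    by rewrite -mulmxA -EA KA // mulmx0.
  case: (eqVneq (posD5 U : nat) k) => [e|/eqP ne]; last first.
    by rewrite in_column_mem_D5 // mem_dots ins in sk.
  have s1 : s = 1.
    subst k; move: ins ins1 sk; rewrite mem_dots.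
    have [-> ->] := in_column_pos S U s; have [_ ->] := in_column_pos S U (s - 1); lia.
  have [_ Eb _ _ _] := butterfly_D5 Dk.
  by rewrite s1 e -[dot_covec _ _ _ _]opprK -Eb mulNmx Kb // oppr0.
apply/matrixP => j i; rewrite ord1 mxE -dot_covec_ith.
have [U e inU] := dots_D5 (ith_dot_mem j).
move: (ith_dot _ _ _) e inU => [u s] /= -> inU.
by rewrite (coef0 `|nties S U k.+1|%N U s) ?mxE //; move: inU; rewrite /in_column; lia.
Qed.

(** The column to the left of U consists of the images of its top dot under beta. *)
Lemma dvec_pos_generated (U : D5 D) (P : 'cV[F]_(d (posD5 U)) -> Prop) :
  (forall v, P v -> P (beta mS (posD5 U) *m v)) -> P (ma mS (posD5 U) *m 1%:M) ->
  forall s, in_column S U (posD5 U) s -> P (dvec (posD5 U : nat, s) (posD5 U)).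
Proof.
move=> PB Pa s; have [-> _] := in_column_pos S U s => ins.
have [j e] : exists j : nat, s = - j%:Z by exists `|s|%N; lia.
elim: j s e ins => [|j IH] s e ins.
  by have [_ _ E _ _] := butterfly_D5 (posD5_D5_at U); rewrite E mulmx1 in Pa; rewrite e.
have ins1 : - (nties S U (posD5 U))%:Z < s + 1 <= 0 by lia.
have := PB _ (IH (s + 1) ltac:(lia) ins1).
rewrite butterfly_beta dot_map_dvec mem_dots; have [-> _] := in_column_pos S U (s + 1).
by rewrite ins1 /lower /= addrK.
Qed.

Lemma butterfly_S2 k : D5_at D k -> S2_at mS k.
Proof.
move=> Dk T sT TB TA Ta; apply: subspace_dvec => // -[u s] cx.
case: (eqVneq u k) => [e|/eqP ne].
  have [U eU] := D5_brane Dk; subst u; subst k.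
  by apply: dvec_pos_generated => //; rewrite -mem_dots.
by have := TA (dvec (u, s) k.+1); rewrite butterfly_mA // -in_column_mem_D5 // cx.
Qed.

Theorem butterfly_Mtilde : Mtilde mS.
Proof.
apply/MtildeP; split; last by move=> k Dk; split; [apply: butterfly_S1 | apply: butterfly_S2].
apply/moment_zeroP; split=> [k|k lt]; first exact: butterfly_moment_D5.
by rewrite butterfly_beta butterfly_beta_left // ltnW.
Qed.

(** A subrepresentation as in [generated] contains the dots to the left of U, being
    images of the top dot under beta, C and A. To the right of U it contains the
    dots of the first column because A maps them into it, and the others as their
    images under D or by the same argument for A. *)
Theorem butterfly_generated : generated mS.
Proof.
move=> T [sT TB TD TV].
suff gen U x s : in_column S U x s -> T x (dvec (posD5 U : nat, s) x).
  move=> x; apply: subspace_dvec => // -[u s] cx.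
  by have [U /= -> inU] := dots_D5 cx; apply: gen.
have gen_pos s' : in_column S U (posD5 U) s' -> T (posD5 U) (dvec (posD5 U : nat, s') (posD5 U)).
  apply: dvec_pos_generated => [v|]; first exact/TB/ltn_ord.
  by have [_ _ Ta] := TD _ (posD5_D5_at U).
case: (leqP x (posD5 U)) => [le|].
  have [j e] : exists j, (x + j = posD5 U)%N by exists (posD5 U - x)%N; lia.
  elim: j x s {le} e => [|j IH] x s e ins.
    by have ex : x = posD5 U; [lia | subst x; apply: gen_pos].
  have lt : (x < posD5 U)%N by lia.
  have := IH x.+1 _ ltac:(lia) => {}IH.
  case: (brane_atP (ltn_trans lt (ltn_ord _))) => [Dx|Vx].
    have [TA _ _] := TD x Dx; have ins1 : in_column S U x.+1 s by rewrite -in_column_D5 //; lia.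
    by have := TA _ (IH _ ins1); rewrite butterfly_mA // mem_dots ins1.
  have [t [l [l' [ll inl inr]]]] := in_column_left_NS5 S Vx lt.
  have ins1 : in_column S U x.+1 (s + 1) by move: ins; rewrite inl inr; lia.
  have [TC _] := TV x Vx; have := TC _ (IH _ ins1).
  by have [-> _] := butterfly_NS5 Vx; rewrite dot_map_dvec mem_dots ins1 /lower /= addrK.
elim: x s => // k IH s le ins.
case: (ltnP k N) => [lt|geN]; last first.
  by move: ins; rewrite /in_column nties_out; [lia | apply: leqW].
case: (brane_atP lt) => [Dk|Vk].
  have [_ TAinv _] := TD k Dk; apply: TAinv; rewrite butterfly_mA // mem_dots ins.
  have [e|ne] := eqVneq k (posD5 U); last first.
    by apply: IH; [lia | rewrite in_column_D5 //; apply/eqP].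
  subst k; case insu : (in_column S U (posD5 U) s); first exact: gen_pos.
  by rewrite dvec_out ?mem_dots ?insu //; apply: subspace0.
have neV : k <> posD5 U.
  by move=> e; move: Vk; rewrite e /NS5_at is_NS5N; have /andP[-> ->] := posD5_D5_at U.
have [t [l [l' [ll inl inr]]]] := in_column_right_NS5 S (U := U) Vk ltac:(lia).
have ins1 : in_column S U k s by move: ins; rewrite inl inr; lia.
have [_ TD'] := TV k Vk; have := TD' _ (IH s ltac:(lia) ins1).
by have [_ ->] := butterfly_NS5 Vk; rewrite dot_map_dvec mem_dots ins1.
Qed.

Theorem butterfly_stable : stable_point mS.
Proof. exact: generated_stable butterfly_Mtilde butterfly_generated. Qed.

End Butterfly.

(** * Torus action *)

Section GaugeComposition.
Variables (F : fieldType) (D : brane_diagram).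
Implicit Types (m : bigM F D) (g : gauge F D) (t : (D5 D -> F) * F).

Local Notation N := (nb5 D).
Local Notation d := (mult D).

Definition gauge_mul g g' : gauge F D := fun X => g X *m g' X.
Definition gauge_inv g : gauge F D := fun X => invmx (g X).

Lemma gauge_mul_unit g g' : gauge_group g -> gauge_group g' -> gauge_group (gauge_mul g g').
Proof. by move=> Gg Gg' X; rewrite unitmx_mul Gg Gg'. Qed.

Lemma gauge_inv_unit g : gauge_group g -> gauge_group (gauge_inv g).
Proof. by move=> Gg X; rewrite unitmx_inv Gg. Qed.

Lemma invmx_mul n (A B : 'M[F]_n) : A \in unitmx -> B \in unitmx ->
  invmx (A *m B) = invmx B *m invmx A.
Proof.
move=> uA uB; rewrite -[LHS]mulmx1 -(mulmxV uA) -[X in _ *m (X *m _)]mulmx1 -(mulmxV uB).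
by rewrite !mulmxA -(mulmxA _ A B) mulVmx ?unitmx_mul ?uA // mul1mx.
Qed.

Lemma gauge_actM g g' m : gauge_group g -> gauge_group g' ->
  gauge_act (gauge_mul g g') m = gauge_act g (gauge_act g' m).
Proof.
move=> Gg Gg'; apply: functional_extensionality_dep => k; rewrite /gauge_act /gauge_mul.
have [ul ur] := (Gg (leftD3 k), Gg (rightD3 k)).
have [ul' ur'] := (Gg' (leftD3 k), Gg' (rightD3 k)).
move: (m k) (g _) (g _) (g' _) (g' _) ul ur ul' ur'.
by case: (kind D k) => x gl gr gl' gr' ul ur ul' ur' /=; rewrite !invmx_mul // !mulmxA.
Qed.

Lemma gauge_actK g m : gauge_group g -> gauge_act (gauge_inv g) (gauge_act g m) = m.
Proof.
move=> Gg; apply: functional_extensionality_dep => k; rewrite /gauge_act /gauge_inv.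
have [ul ur] := (Gg (leftD3 k), Gg (rightD3 k)); move: (m k) (g _) (g _) ul ur.
case: (kind D k) => [[A b a B B'] | [C E]] gl gr ul ur /=.
  by rewrite !invmxK !mulmxA !mulVmx // !mul1mx !mulmxKV.
by rewrite !invmxK !mulmxA !mulVmx // !mul1mx !mulmxKV.
Qed.

Lemma gauge_orbit_refl m : gauge_orbit m m.
Proof.
exists (fun X => 1%:M); first by move=> X; apply: unitmx1.
apply: functional_extensionality_dep => k; rewrite /gauge_act; move: (m k).
by case: (kind D k) => -[] * /=; rewrite !invmx1 !mulmx1 !mul1mx.
Qed.

Lemma gauge_orbit_act g m : gauge_group g -> gauge_orbit (gauge_act g m) = gauge_orbit m.
Proof.
move=> Gg; apply/seteqP; split=> _ [g' Gg' <-].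
  by exists (gauge_mul g' g); [apply: gauge_mul_unit | apply: gauge_actM].
exists (gauge_mul g' (gauge_inv g)); first exact/gauge_mul_unit/gauge_inv_unit.
by rewrite gauge_actM ?gauge_actK //; apply: gauge_inv_unit.
Qed.

Lemma torus_gaugeC t g m : torus_act t (gauge_act g m) = gauge_act g (torus_act t m).
Proof.
apply: functional_extensionality_dep => k; rewrite /gauge_act /torus_act.
move: (m k) (g _) (g _); case: (kind D k) => x gl gr /=.
  by rewrite -!scalemxAr -!scalemxAl.
by rewrite -!scalemxAr -!scalemxAl.
Qed.

(** The torus action commutes with the gauge action, so it is enough to move the
    representative m itself. *)
Lemma torus_fixedP m :
  torus_fixed (gauge_orbit m) <->
  forall t, torus t -> exists2 g, gauge_group g & torus_act t m = gauge_act g m.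
Proof.
split=> [fix_m t Tt|fix_m t Tt].
  have : gauge_orbit m (torus_act t m).
    by rewrite -{1}(fix_m t Tt); exists m => //; apply: gauge_orbit_refl.
  by move=> [g Gg <-]; exists g.
have [g Gg tm] := fix_m t Tt; apply/seteqP; split=> [_ [_ [g' Gg' <-] <-]|_ [g' Gg' <-]].
  rewrite torus_gaugeC tm -gauge_actM //.
  by exists (gauge_mul g' g) => //; apply: gauge_mul_unit.
exists (gauge_act (gauge_mul g' (gauge_inv g)) m).
  by eexists; last reflexivity; apply/gauge_mul_unit/gauge_inv_unit.
rewrite torus_gaugeC tm -gauge_actM //; last exact/gauge_mul_unit/gauge_inv_unit.
rewrite gauge_actM //; last by apply/gauge_mul_unit => //; apply/gauge_inv_unit.
by rewrite gauge_actM ?gauge_actK //; apply: gauge_inv_unit.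
Qed.

Definition line_weightN (tau : D5 D -> F) (k : nat) : F :=
  @extend N (fun=> F) (fun=> 1) (fun k : 'I_N => line_weight tau k) k.

Lemma torus_actE t m k :
  [/\ mA (torus_act t m) k = mA m k,
      mb (torus_act t m) k = t.2 *: (line_weightN t.1 k *: mb m k),
      ma (torus_act t m) k = (line_weightN t.1 k)^-1 *: ma m k &
      mB (torus_act t m) k = t.2 *: mB m k] /\
  [/\ mB' (torus_act t m) k = t.2 *: mB' m k,
      mC (torus_act t m) k = t.2 *: mC m k &
      mD (torus_act t m) k = mD m k].
Proof.
case: (ltnP k N) => [lt_kN|le_Nk]; last first.
  have [[-> -> -> ->] [-> -> ->]] := m_out (torus_act t m) le_Nk.
  have [[-> -> -> ->] [-> -> ->]] := m_out m le_Nk.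
  by rewrite !scaler0.
pose k' := Ordinal lt_kN; rewrite -[k]/(nat_of_ord k') !mE.
have -> : line_weightN t.1 k' = line_weight t.1 k' by apply: (@extendE N (fun=> F)).
rewrite /torus_act; move: (m k') (line_weight _ _).
by case: (kind D k') => x s; rewrite /= ?scaler0.
Qed.

(** The equation [torus_act t m = gauge_act g m] without inverses. *)
Definition torus_relations t m (g : forall x, 'M[F]_(d x)) : Prop :=
  [/\ forall x, (x < N)%N -> g x *m beta m x = t.2 *: (beta m x *m g x),
      forall k, D5_at D k -> [/\ g k *m mA m k = mA m k *m g k.+1,
         mb m k = t.2 *: (line_weightN t.1 k *: (mb m k *m g k.+1)) &
         g k *m ma m k = (line_weightN t.1 k)^-1 *: ma m k] &
      forall k, NS5_at D k -> g k *m mC m k = t.2 *: (mC m k *m g k.+1) /\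
         g k.+1 *m mD m k = mD m k *m g k].

Lemma torus_relationsP t m g : moment_zero m -> gauge_group g ->
  torus_act t m = gauge_act g m <-> torus_relations t m (gaugeN g).
Proof.
move=> mom Gg; have u x : gaugeN g x \in unitmx by apply: gaugeN_unit.
have conjP p q (X : 'M[F]_p) (Y : 'M[F]_q) (M M' : 'M[F]_(p, q)) : Y \in unitmx ->
    M = X *m M' *m invmx Y <-> X *m M' = M *m Y.
  by move=> uY; split=> [->|->]; rewrite ?mulmxKV ?mulmxK.
split=> [tg|[rb rD rV]].
  have eqs k := (torus_actE t m k, gauge_actE g m k); rewrite tg in eqs.
  split=> [x lt|k Dk|k Vk].
  - have [[[_ _ _ e] [_ eC eD]] [[_ _ _ e'] [_ eC' eD']]] := eqs x.
    case: (brane_atP lt) => [Dx|Vx].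
      rewrite beta_D5 // mulmxN mulNmx scalerN scalemxAl; congr (- _).
      by apply/conjP; rewrite // -e -e'.
    rewrite beta_NS5 //.
    have eC2 : gaugeN g x *m mC m x = t.2 *: mC m x *m gaugeN g x.+1.
      by apply/conjP; rewrite // -eC -eC'.
    have eD2 : gaugeN g x.+1 *m mD m x = mD m x *m gaugeN g x.
      by apply/conjP; rewrite // -eD' eD.
    by rewrite mulmxA eC2 -mulmxA eD2 -!scalemxAl mulmxA.
  - have [[[eA eb ea _] _] [[eA' eb' ea' _] _]] := eqs k; split.
    + by apply/conjP; rewrite // -eA' eA.
    + by rewrite !scalemxAl -eb eb' mulmxKV.
    + by rewrite -ea ea'.
  - have [[_ [_ eC eD]] [_ [_ eC' eD']]] := eqs k; split.
    + by rewrite scalemxAl; apply/conjP; rewrite // -eC -eC'.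
    + by apply/conjP; rewrite // -eD' eD.
apply: bigM_ext => k Hk.
all: have lt : (k < N)%N by case/andP: Hk.
  have [[-> -> -> ->] [-> _ _]] := torus_actE t m k.
  have [[-> -> -> ->] [-> _ _]] := gauge_actE g m k.
  have [rA rb' ra] := rD k Hk; rewrite ra; split=> //.
  - exact/conjP.
  - by rewrite {2}rb' -!scalemxAl mulmxK.
  - apply/conjP => //; have := rb k lt; rewrite beta_D5 // mulmxN mulNmx scalerN.
    by rewrite scalemxAl => /oppr_inj.
  - apply/conjP => //; move: (rb k.+1); rewrite -beta_leftE // beta_left_D5 //.
    rewrite mulmxN mulNmx scalerN scalemxAl; case: (ltnP k.+1 N) => [_ /(_ isT)|le _].
      exact: oppr_inj.
    by apply/mx_norows_eq/mult_ge_nb5.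
have [_ [_ -> ->]] := torus_actE t m k; have [_ [_ -> ->]] := gauge_actE g m k.
have [rC rD'] := rV k Hk; split; last exact/conjP.
by apply/conjP; rewrite // rC scalemxAl.
Qed.

End GaugeComposition.
Arguments line_weightN {F} D tau k.

Section ButterflyTorus.
Variables (F : fieldType) (D : brane_diagram) (S : {set tie D}).
Hypothesis tieS : tie_diagram S.
Implicit Types (t : (D5 D -> F) * F) (c : dot).
Local Notation N := (nb5 D).
Local Notation d := (mult D).
Local Notation mS := (butterfly F S).

(** The weight forced by D, A and a_U, which preserve the height or start at height
    0, and by beta and C, which lower the height and have weight hbar. *)
Definition dot_weight (t : (D5 D -> F) * F) (c : dot) : F :=
  (line_weightN D t.1 c.1)^-1 * t.2 ^ (- c.2).

Lemma line_weightN_neq0 t k : torus t -> line_weightN D t.1 k != 0.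
Proof.
move=> [tau0 _]; case: (ltnP k N) => [lt|le]; last first.
  by rewrite /line_weightN extend_out ?oner_neq0.
have -> : line_weightN D t.1 k = line_weight t.1 (Ordinal lt) by apply: (extendE _ _ (Ordinal lt)).
by rewrite /line_weight; case: insubP => [U _ _|_] /=; rewrite ?oner_neq0.
Qed.

Lemma dot_weight_lower t c : torus t -> dot_weight t (lower c) = t.2 * dot_weight t c.
Proof.
move=> [_ h0]; rewrite /dot_weight /lower /= opprB addrC expfzDr //.
by rewrite expr1z; ring.
Qed.

Definition dot_gauge t : gauge F D := fun X => diag_mx (\row_j dot_weight t (ith_dot S X j)).

Lemma dot_weight_neq0 t c : torus t -> dot_weight t c != 0.
Proof.
move=> Tt; rewrite mulf_neq0 ?invr_eq0 ?line_weightN_neq0 //.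
by case: Tt => _ h0; rewrite expfz_neq0.
Qed.

Lemma dot_gauge_unit t : torus t -> gauge_group (dot_gauge t).
Proof.
move=> Tt X; rewrite unitmxE det_diag unitfE; apply/prodf_neq0 => j _.
by rewrite mxE dot_weight_neq0.
Qed.

Lemma dot_gauge_dvec t x c :
  gaugeN (dot_gauge t) x *m dvec F S c x = dot_weight t c *: dvec F S c x.
Proof.
case cx: (c \in dots S x); last by rewrite dvec_out ?cx // mulmx0 scaler0.
case: (ltnP x N.+1) => [lt|le]; last by apply/mx_norows_eq/mult_ge_nb5/ltnW.
have -> : gaugeN (dot_gauge t) x = diag_mx (\row_j dot_weight t (ith_dot S x j)).
  exact: (gaugeNE (dot_gauge t) (Ordinal lt)).
have [j <-] := ith_dot_surj tieS cx; rewrite dvec_ith //.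
apply/matrixP => i k; rewrite mul_diag_mx !mxE ord1 eqxx andbT.
by case: eqP => [->|_]; rewrite ?mulr1 ?mulr0.
Qed.

Lemma butterfly_torus_relations t : torus t -> torus_relations t mS (gaugeN (dot_gauge t)).
Proof.
move=> Tt; have h0 : t.2 != 0 by case: Tt.
split=> [x lt|k Dk|k Vk].
- rewrite butterfly_beta //; apply: (dvec_ext tieS) => c cx.
  rewrite -scalemxAl -!mulmxA dot_gauge_dvec -scalemxAr dot_map_dvec // cx.
  by rewrite dot_gauge_dvec dot_weight_lower // scalerA.
- have [EA Eb Ea _ _] := butterfly_D5 F S Dk; split.
  + apply: (dvec_ext tieS) => c cx; rewrite EA -!mulmxA dot_gauge_dvec -scalemxAr.
    by rewrite dot_map_dvec // cx dot_gauge_dvec.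
  + apply: (dvec_ext tieS) => c cx; rewrite -!scalemxAl -mulmxA dot_gauge_dvec -scalemxAr.
    rewrite butterfly_mb // cx /= !scalerA; case: eqP => [->|_]; last by rewrite raddf0 oppr0 scaler0.
    rewrite /dot_weight /= mulrA mulfK ?line_weightN_neq0 // mulfV ?scale1r //.
  + by rewrite Ea dot_gauge_dvec /dot_weight /= oppr0 expr0z mulr1.
- have [EC ED] := butterfly_NS5 F S Vk; rewrite EC ED; split; apply: (dvec_ext tieS) => c cx.
  + rewrite -scalemxAl -!mulmxA dot_gauge_dvec -scalemxAr dot_map_dvec // cx.
    by rewrite dot_gauge_dvec dot_weight_lower // scalerA.
  + by rewrite -!mulmxA dot_gauge_dvec -scalemxAr dot_map_dvec // cx dot_gauge_dvec.
Qed.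

Theorem butterfly_torus_fixed : torus_fixed (gauge_orbit mS).
Proof.
apply/torus_fixedP => t Tt; exists (dot_gauge t); first exact: dot_gauge_unit.
apply/torus_relationsP; [|exact: dot_gauge_unit|exact: butterfly_torus_relations].
exact/Mtilde_moment/butterfly_Mtilde.
Qed.

End ButterflyTorus.

(** * Weight decomposition of a torus fixed point *)

Definition raise (c : dot) : dot := (c.1, c.2 + 1).

Lemma raiseK : cancel raise lower.
Proof. by case=> u s; rewrite /lower /raise /= addrK. Qed.

Lemma lowerK : cancel lower raise.
Proof. by case=> u s; rewrite /lower /raise /= subrK. Qed.

Lemma sum_supp (V : nmodType) (T : eqType) (r s : seq T) (f : T -> V) :
  uniq r -> uniq s -> {subset r <= s} -> (forall c, c \notin r -> f c = 0) ->
  \sum_(c <- s) f c = \sum_(c <- r) f c.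
Proof.
move=> ur us rs f0; rewrite (bigID (mem r)) /= [X in _ + X]big1 ?addr0 => [|c /f0 //].
rewrite -big_filter; apply: perm_big; apply: uniq_perm; rewrite ?filter_uniq //.
by move=> c; rewrite mem_filter; case cr: (c \in r) => //=; apply: rs.
Qed.

(** Otherwise all the lam j would be roots of the characteristic polynomial. *)
Lemma no_infinite_spectrum (F : fieldType) n (M : 'M[F]_n) (lam : nat -> F)
    (v : nat -> 'rV[F]_n) :
  injective lam -> (forall j, v j *m M = lam j *: v j) -> exists j, v j = 0.
Proof.
move=> inj eig; apply: contrapT => /forallNP vn0.
have /max_poly_roots : char_poly M != 0 by rewrite monic_neq0 ?char_poly_monic.
move=> /(_ (map lam (iota 0 n.+1))); rewrite map_inj_uniq // iota_uniq.
rewrite size_map size_iota size_char_poly ltnn => H.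
suff : all (root (char_poly M)) (map lam (iota 0 n.+1)) by move=> /H /(_ isT).
apply/allP => _ /mapP[j _ ->]; rewrite -eigenvalue_root_char.
by apply/eigenvalueP; exists (v j) => //; apply/eqP/vn0.
Qed.

Section Weights.
Variables (F : fieldType) (D : brane_diagram) (m : bigM F D).
Local Notation N := (nb5 D).
Local Notation d := (mult D).

(** What is used of a gauge transformation G that acts on m as a generic torus
    element: its eigenvalues are compared with the weights w of dots. *)
Variables (G : forall x, 'M[F]_(d x)) (w : dot -> F) (h : F).
Hypotheses (w_inj : injective w) (h_neq0 : h != 0).
Hypothesis w_lower : forall c, w (lower c) = h * w c.
Hypothesis G_beta : forall x, G x *m beta m x = h *: (beta m x *m G x).
Hypothesis G_A : forall k, D5_at D k -> G k *m mA m k = mA m k *m G k.+1.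
Hypothesis G_b : forall k, D5_at D k -> mb m k *m G k.+1 = w (k, 1) *: mb m k.
Hypothesis G_a : forall k, D5_at D k -> G k *m ma m k = w (k, 0) *: ma m k.
Hypothesis G_C : forall k, NS5_at D k -> G k *m mC m k = h *: (mC m k *m G k.+1).
Hypothesis G_D : forall k, NS5_at D k -> G k.+1 *m mD m k = mD m k *m G k.

Hypotheses (Mm : Mtilde m) (gen : generated m).

Definition eigen x c (v : 'cV[F]_(d x)) : Prop := G x *m v = w c *: v.

Lemma eigen_subspace x c : subspace (eigen (x := x) c).
Proof.
rewrite /eigen; split=> [|k v v' e e']; first by rewrite mulmx0 scaler0.
by rewrite mulmxDr -scalemxAr e e' scalerDr !scalerA mulrC.
Qed.

Lemma eigen0 x c : eigen (x := x) c 0.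
Proof. by case: (eigen_subspace x c). Qed.

Lemma eigenZ x c k (v : 'cV[F]_(d x)) : eigen c v -> eigen c (k *: v).
Proof. exact: (@subspaceZ _ _ _ k v (eigen_subspace x c)). Qed.

Lemma eigenB x c (v v' : 'cV[F]_(d x)) : eigen c v -> eigen c v' -> eigen c (v - v').
Proof. exact: (@subspaceB _ _ _ v v' (eigen_subspace x c)). Qed.

Lemma eigen_beta x c v : eigen c v -> eigen (lower c) (beta m x *m v).
Proof.
by rewrite /eigen => e; rewrite mulmxA G_beta -scalemxAl -mulmxA e -scalemxAr scalerA w_lower.
Qed.

Lemma eigen_A k c v : D5_at D k -> eigen c v -> eigen c (mA m k *m v).
Proof. by rewrite /eigen => Dk e; rewrite mulmxA G_A // -mulmxA e scalemxAr. Qed.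

Lemma eigen_a k u : D5_at D k -> eigen (k, 0) (ma m k *m u).
Proof. by rewrite /eigen => Dk; rewrite mulmxA G_a // scalemxAl. Qed.

Lemma eigen_C k c v : NS5_at D k -> eigen c v -> eigen (lower c) (mC m k *m v).
Proof.
by rewrite /eigen => Vk e; rewrite mulmxA G_C // -scalemxAl -mulmxA e -scalemxAr scalerA w_lower.
Qed.

Lemma eigen_D k c v : NS5_at D k -> eigen c v -> eigen c (mD m k *m v).
Proof. by rewrite /eigen => Vk e; rewrite mulmxA G_D // -mulmxA e scalemxAr. Qed.

(** The covectors b beta^j; they pair nontrivially with the weight (k, j + 1)
    only ([b_beta_eigen]). *)
Fixpoint b_beta k j : 'rV[F]_(d k.+1) :=
  if j is j'.+1 then b_beta k j' *m beta m k.+1 else mb m k.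

Lemma b_beta_G k j : D5_at D k -> b_beta k j *m G k.+1 = w (k, j.+1%:Z) *: b_beta k j.
Proof.
move=> Dk; elim: j => [|j IH] /=; first exact: G_b.
have e : beta m k.+1 *m G k.+1 = h^-1 *: (G k.+1 *m beta m k.+1).
  by rewrite G_beta scalerA mulVf // scale1r.
rewrite -mulmxA e -scalemxAr mulmxA IH -scalemxAl scalerA; congr (_ *: _).
have -> : (k, j.+1%:Z) = lower (k, j.+2%:Z) by rewrite /lower /=; congr pair; lia.
by rewrite w_lower mulrA mulVf // mul1r.
Qed.

Lemma b_beta_eigen k j c v : D5_at D k -> eigen c v -> c <> (k, j.+1%:Z) ->
  b_beta k j *m v = 0.
Proof.
move=> Dk e ne; have := congr1 (mulmx^~ v) (b_beta_G j Dk).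
rewrite /= -mulmxA e -scalemxAr -scalemxAl => /eqP; rewrite -subr_eq0 -scalerBl.
rewrite scaler_eq0 subr_eq0 => /orP[/eqP/w_inj //|/eqP //].
Qed.

Lemma b_eigen k c v : D5_at D k -> eigen c v -> c <> (k, 1) -> mb m k *m v = 0.
Proof. by move=> Dk; apply: (b_beta_eigen (j := 0) Dk). Qed.

(** The nonzero b beta^j are eigenvectors of G for distinct eigenvalues. *)
Lemma b_beta_out k : D5_at D k -> exists J, forall j, (J <= j)%N -> b_beta k j = 0.
Proof.
move=> Dk.
have [|J J0] := @no_infinite_spectrum F _ (G k.+1) (fun j => w (k, j.+1%:Z)) (b_beta k) _ (fun j => b_beta_G j Dk).
  by move=> i j /w_inj[].
exists J; elim=> [|j IH]; first by case: J J0.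
rewrite leq_eqVlt => /orP[/eqP <- //|]; rewrite ltnS => /IH /= ->.
by rewrite mul0mx.
Qed.

(** The largest beta-stable subspace of ker A on which b vanishes is cut out by
    A and the covectors b beta^j, because A beta = beta A there. *)
Lemma S1_b_beta k (v : 'cV[F]_(d k.+1)) : D5_at D k -> mA m k *m v = 0 ->
  (forall j, b_beta k j *m v = 0) -> v = 0.
Proof.
move=> Dk Av bv.
pose K (v : 'cV[F]_(d k.+1)) := mA m k *m v = 0 /\ forall j, b_beta k j *m v = 0.
apply: (Mtilde_S1 Mm Dk (K := K)) => //.
- split=> [|c v1 v2 [A1 b1] [A2 b2]]; first by split=> *; rewrite mulmx0.
  by split=> *; rewrite mulmxDr -scalemxAr ?A1 ?A2 ?b1 ?b2 scaler0 addr0.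
- move=> u [Au bu]; split=> [|j]; last by rewrite mulmxA; apply: (bu j.+1).
  have := congr1 (mulmx^~ u) (beta_mA (Mtilde_moment Mm) Dk).
  by rewrite /= mulmxDl -!mulmxA Au (bu 0) !mulmx0 addr0.
- by move=> u [].
- by move=> u [_ /(_ 0)].
Qed.

Lemma A_injective k c v : D5_at D k -> (forall j : nat, c <> (k, j.+1%:Z)) ->
  eigen c v -> mA m k *m v = 0 -> v = 0.
Proof.
by move=> Dk ne e Av; apply: (S1_b_beta Dk) => // j; apply: b_beta_eigen (ne j).
Qed.

Lemma eigen_independent x (r : seq dot) (f : dot -> 'cV[F]_(d x)) :
  uniq r -> (forall c, c \in r -> eigen c (f c)) -> \sum_(c <- r) f c = 0 ->
  forall c, c \in r -> f c = 0.
Proof.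
elim: r f => // c0 r IH f /= /andP[c0r ur] ef sum0.
have f0 c : c \in r -> f c = 0.
  move=> cr; have c0c : c != c0 by apply: contraNneq c0r => <-.
  suff /eqP : (w c - w c0) *: f c = 0.
    by rewrite scaler_eq0 subr_eq0 (inj_eq w_inj) (negbTE c0c) => /eqP.
  apply: (IH (fun c => (w c - w c0) *: f c)) => //.
    move=> c' c'r; apply: eigenZ.
    by apply: ef; rewrite inE c'r orbT.
  have := congr1 (mulmx (G x)) sum0; rewrite mulmx0 => e1.
  have := congr1 (fun v => w c0 *: v) sum0; rewrite scaler0 => e2.
  move: e1; rewrite -[RHS]e2 => /eqP; rewrite -subr_eq0 => /eqP.
  rewrite !big_cons mulmxDr scalerDr (ef c0) ?mem_head // opprD addrACA subrr add0r.
  rewrite mulmx_sumr scaler_sumr -sumrB => e; rewrite -[RHS]e; apply: eq_big_seq => c' c'r.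
  by rewrite (ef c') ?scalerBl // inE c'r orbT.
move=> c; rewrite inE => /orP[/eqP ->|]; last exact: f0.
by move: sum0; rewrite big_cons big_seq big1 ?addr0 // => c' /f0.
Qed.

(** The finite support is explicit because the dots form an infinite type. *)
Definition weight_dec x (v : 'cV[F]_(d x)) (f : dot -> 'cV[F]_(d x)) : Prop :=
  (forall c, eigen c (f c)) /\
  exists r, [/\ uniq r, forall c, c \in r -> D5_at D c.1,
                forall c, c \notin r -> f c = 0 & v = \sum_(c <- r) f c].

Lemma weight_dec_lin x k (v v' : 'cV[F]_(d x)) f f' :
  weight_dec v f -> weight_dec v' f' ->
  weight_dec (k *: v + v') (fun c => k *: f c + f' c).
Proof.
move=> [ef [r [ur Dr fr ->]]] [ef' [r' [ur' Dr' fr' ->]]].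
split; first by move=> c; have [_] := eigen_subspace x c; apply.
have sub : {subset r <= undup (r ++ r')} by move=> c; rewrite mem_undup mem_cat => ->.
have sub' : {subset r' <= undup (r ++ r')}.
  by move=> c; rewrite mem_undup mem_cat => ->; rewrite orbT.
exists (undup (r ++ r')); split; rewrite ?undup_uniq //.
- by move=> c; rewrite mem_undup mem_cat => /orP[/Dr|/Dr'].
- move=> c cN; rewrite fr ?fr' ?scaler0 ?addr0 //.
    by apply: contraNN cN => /sub'.
  by apply: contraNN cN => /sub.
- rewrite big_split /= -scaler_sumr.
  by rewrite (sum_supp ur _ sub fr) ?(sum_supp ur' _ sub' fr') ?undup_uniq.
Qed.

Lemma weight_dec0 x (f : dot -> 'cV[F]_(d x)) : weight_dec 0 f -> forall c, f c = 0.
Proof.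
move=> [ef [r [ur _ fr sum0]]] c; case cr: (c \in r); last by rewrite fr ?cr.
by apply: (eigen_independent ur _ (esym sum0) cr).
Qed.

Lemma weight_dec_uniq x (v : 'cV[F]_(d x)) f f' :
  weight_dec v f -> weight_dec v f' -> forall c, f c = f' c.
Proof.
move=> df df' c; have := weight_dec_lin (-1) df df'.
by rewrite scaleN1r addNr => /weight_dec0 /(_ c); rewrite scaleN1r addrC => /subr0_eq.
Qed.

Lemma weight_dec_eigen x c (v : 'cV[F]_(d x)) : D5_at D c.1 -> eigen c v ->
  weight_dec v (fun c' => if c' == c then v else 0).
Proof.
move=> Dc ev; split=> [c'|].
  case: eqP => [->|_] //; exact: eigen0.
exists [:: c]; split=> // [c'|c'|]; rewrite ?inE.
- by move=> /eqP ->.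
- by move=> /negbTE ->.
- by rewrite big_seq1 eqxx.
Qed.

Lemma weight_dec_map x y (M : 'M[F]_(d y, d x)) (sg tu : dot -> dot) v f :
  cancel sg tu -> cancel tu sg -> (forall c, (sg c).1 = c.1) ->
  (forall c u, eigen (x := x) c u -> eigen (x := y) (sg c) (M *m u)) ->
  weight_dec v f -> weight_dec (M *m v) (fun c => M *m f (tu c)).
Proof.
move=> sgK tuK sg1 eM [ef [r [ur Dr fr ->]]]; split=> [c|].
  by rewrite -{1}(tuK c); apply/eM/ef.
exists (map sg r); split.
- by rewrite map_inj_uniq //; apply: can_inj sgK.
- by move=> _ /mapP[c /Dr Dc ->]; rewrite sg1.
- move=> c cN; rewrite fr ?mulmx0 //; apply: contraNN cN => cr.
  by rewrite -(tuK c) map_f.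
- by rewrite mulmx_sumr big_map; apply: eq_bigr => c _; rewrite sgK.
Qed.

Definition decomposable x (v : 'cV[F]_(d x)) : Prop := exists f, weight_dec v f.

Lemma decomposable_subspace x : subspace (decomposable (x := x)).
Proof.
split=> [|k v v' [f df] [f' df']]; last by eexists; apply: weight_dec_lin df df'.
exists (fun=> 0); split=> [c|]; first exact: eigen0.
by exists [::]; rewrite big_nil.
Qed.

Lemma decomposable_eigen x c (v : 'cV[F]_(d x)) : D5_at D c.1 -> eigen c v -> decomposable v.
Proof. by move=> Dc ev; eexists; apply: weight_dec_eigen ev. Qed.

(** Removes the weights of r from v; a recursion on vectors, which avoids matrix
    polynomials in dimension zero. *)
Fixpoint kill x (r : seq dot) (v : 'cV[F]_(d x)) : 'cV[F]_(d x) :=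
  if r is c :: r' then kill r' (G x *m v - w c *: v) else v.

Lemma kill_additive x r (v v' : 'cV[F]_(d x)) : kill r (v + v') = kill r v + kill r v'.
Proof.
elim: r v v' => //= c r IH v v'.
by rewrite -IH mulmxDr scalerDr opprD addrACA.
Qed.

Lemma kill_eigen x r c (v : 'cV[F]_(d x)) : eigen c v ->
  kill r v = (\prod_(c' <- r) (w c - w c')) *: v.
Proof.
elim: r v => [|c' r IH] v ev /=; first by rewrite big_nil scale1r.
rewrite IH; last first.
  apply: eigenB; last exact: eigenZ.
  by rewrite ev; apply: eigenZ.
by rewrite ev -scalerBl scalerA big_cons mulrC.
Qed.

Lemma kill_dec x r (v : 'cV[F]_(d x)) f r0 : (forall c, eigen c (f c)) ->
  {subset r0 <= r} -> v = \sum_(c <- r0) f c -> kill r v = 0.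
Proof.
move=> ef sub ->.
have kill0 : kill r 0 = 0 :> 'cV[F]_(d x).
  by apply: (addrI (kill r 0)); rewrite -kill_additive !addr0.
rewrite (big_morph _ (kill_additive r) kill0) big_seq big1 // => c /sub cr.
rewrite (kill_eigen r (ef c)) (_ : \prod_(_ <- _) _ = 0) ?scale0r //.
by apply/eqP; rewrite prodf_seq_eq0; apply/hasP; exists c; rewrite /= ?subrr.
Qed.

Lemma kill_A k r v : D5_at D k -> mA m k *m kill r v = kill r (mA m k *m v).
Proof.
move=> Dk; elim: r v => //= c r IH v.
by rewrite IH mulmxBr !mulmxA -G_A // -scalemxAr.
Qed.

Lemma kill_b_beta k r j v : D5_at D k ->
  b_beta k j *m kill r v = (\prod_(c <- r) (w (k, j.+1%:Z) - w c)) *: (b_beta k j *m v).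
Proof.
move=> Dk; elim: r v => [|c r IH] v /=; first by rewrite big_nil scale1r.
rewrite IH mulmxBr mulmxA b_beta_G // -scalemxAl -scalemxAr -scalerBl scalerA big_cons.
by rewrite mulrC.
Qed.

(** If v is killed by the factors of c0 and r, then
    (G - w c0) v is a sum of weight vectors f c with c in r, and subtracting the
    (w c - w c0)^{-1} f c from v leaves a vector of weight c0. *)
Lemma kill_decomposable x r (v : 'cV[F]_(d x)) : uniq r ->
  (forall c, c \in r -> D5_at D c.1) -> kill r v = 0 -> decomposable v.
Proof.
move=> ur Dr; suff : kill r v = 0 -> exists2 f, forall c, c \in r -> eigen c (f c) &
    v = \sum_(c <- r) f c.
  move=> dec /dec[f ef ->]; apply: (subspace_sum (decomposable_subspace x)) => c cr.
  by apply: (decomposable_eigen (c := c)); [apply: Dr | apply: ef].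
elim: r v ur {Dr} => [|c0 r IH] v /= => [_ ->|/andP[c0r ur] /(IH _ ur)[f ef sumf]].
  by exists (fun=> 0) => //; rewrite big_nil.
pose f' c := (w c - w c0)^-1 *: f c; pose v' := \sum_(c <- r) f' c.
have ef' c : c \in r -> eigen c (f' c).
  by move=> cr; apply: eigenZ; apply: ef.
have ev0 : eigen c0 (v - v').
  have e : G x *m v' - w c0 *: v' = G x *m v - w c0 *: v.
    rewrite sumf mulmx_sumr scaler_sumr -sumrB !big_seq; apply: eq_bigr => c cr.
    rewrite ef' // -scalerBl scalerA mulfV ?scale1r // subr_eq0 (inj_eq w_inj).
    by apply: contraNneq c0r => <-.
  rewrite /eigen mulmxBr scalerBr.
  have -> : G x *m v = (G x *m v' - w c0 *: v') + w c0 *: v by rewrite e subrK.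
  by rewrite addrAC [G x *m v' - _]addrC addrK addrC.
exists (fun c => if c == c0 then v - v' else f' c) => [c|].
  by rewrite inE; case: eqP => [-> //|_ /= /ef'].
rewrite big_cons eqxx big_seq; under eq_bigr => c cr.
  rewrite (_ : (c == c0) = false); last by apply: contraNF c0r => /eqP <-.
  over.
by rewrite -big_seq subrK.
Qed.

(** Sums of weight vectors satisfy the hypotheses of [generated]. If A w is such
    a sum, then a product of factors G - w_c kills A w and, for enough c of the
    form (k, j+1), also every b beta^j w; by (S1) it kills w. *)
Theorem all_decomposable x (v : 'cV[F]_(d x)) : decomposable v.
Proof.
apply: (gen (S := fun x v => decomposable (x := x) v)); split.
- exact: decomposable_subspace.
- move=> y u _ [f df]; exists (fun c => beta m y *m f (raise c)).
  by apply: (weight_dec_map lowerK raiseK _ _ df) => // c z; apply: eigen_beta.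
- move=> k Dk; split=> [u [f df]|u [f [ef [r [ur Dr fr Au]]]]|u].
  + exists (fun c => mA m k *m f c).
    by apply: (@weight_dec_map _ _ _ id id _ _ _ _ _ _ df) => // c z; apply: eigen_A.
  + have [J J0] := b_beta_out Dk.
    pose r1 := undup (r ++ [seq ((k, j.+1%:Z) : dot) | j <- iota 0 J]).
    apply: (kill_decomposable (r := r1)); first exact: undup_uniq.
      by move=> c; rewrite mem_undup mem_cat => /orP[/Dr //|/mapP[j _ ->]].
    apply: (S1_b_beta Dk) => [|j].
      rewrite kill_A // (kill_dec ef _ Au) // => c cr.
      by rewrite mem_undup mem_cat cr.
    case: (leqP J j) => [/J0 ->|lt]; first by rewrite mul0mx.
    rewrite kill_b_beta // (_ : \prod_(_ <- _) _ = 0) ?scale0r //.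
    apply/eqP; rewrite prodf_seq_eq0; apply/hasP; exists (k, j.+1%:Z); last by rewrite /= subrr.
    by rewrite mem_undup mem_cat map_f ?orbT // mem_iota.
  + by apply: (decomposable_eigen (c := (k, 0))) => //; apply: eigen_a.
- move=> k Vk; split=> u [f df].
  + exists (fun c => mC m k *m f (raise c)).
    by apply: (weight_dec_map lowerK raiseK _ _ df) => // c z; apply: eigen_C.
  + exists (fun c => mD m k *m f c).
    by apply: (@weight_dec_map _ _ _ id id _ _ _ _ _ _ df) => // c z; apply: eigen_D.
Qed.

Definition comp x (v : 'cV[F]_(d x)) : dot -> 'cV[F]_(d x) := projT1 (cid (all_decomposable v)).

Lemma comp_dec x (v : 'cV[F]_(d x)) : weight_dec v (comp v).
Proof. exact: projT2 (cid (all_decomposable v)). Qed.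

Lemma comp_eigen x c (v : 'cV[F]_(d x)) : eigen c (comp v c).
Proof. by have [] := comp_dec v. Qed.

Lemma comp_lin x k (v v' : 'cV[F]_(d x)) c : comp (k *: v + v') c = k *: comp v c + comp v' c.
Proof. exact: (weight_dec_uniq (comp_dec _) (weight_dec_lin k (comp_dec v) (comp_dec v'))). Qed.

Lemma comp0 x c : comp (0 : 'cV[F]_(d x)) c = 0.
Proof. exact: (weight_dec0 (comp_dec 0)). Qed.

Lemma comp_sum x (v : 'cV[F]_(d x)) : exists r, [/\ uniq r, forall c, c \in r -> D5_at D c.1,
  forall c, c \notin r -> comp v c = 0 & v = \sum_(c <- r) comp v c].
Proof. by have [_] := comp_dec v. Qed.

(** A weight whose first component is not the position of a D5 brane does not
    occur in any decomposition. *)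
Lemma eigen_D5_at x c (v : 'cV[F]_(d x)) : eigen c v -> ~~ D5_at D c.1 -> v = 0.
Proof.
move=> ev Dc; have [r [ur Dr _ e]] := comp_sum v.
have cr : c \notin r by apply: contraNN Dc => /Dr.
pose f c' := if c' == c then - v else comp v c'.
suff : f c = 0 by rewrite /f eqxx => /eqP; rewrite oppr_eq0 => /eqP.
apply: (@eigen_independent x (c :: r) f); rewrite ?mem_head //=.
- by rewrite cr.
- move=> c' _; rewrite /f; case: eqP => [->|_]; last exact: comp_eigen.
  by rewrite -scaleN1r; apply: eigenZ.
- rewrite big_cons {1}/f eqxx {1}e -sumrN -big_split /= big_seq big1 // => c' c'r.
  by rewrite /f (_ : (c' == c) = false) ?addNr //; apply: contraNF cr => /eqP <-.
Qed.

Lemma comp_id x c (v : 'cV[F]_(d x)) c' : eigen c v ->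
  comp v c' = if c' == c then v else 0.
Proof.
move=> ev; case Dc: (D5_at D c.1).
  exact: (weight_dec_uniq (comp_dec v) (weight_dec_eigen Dc ev)).
by rewrite (eigen_D5_at ev) ?Dc // comp0 if_same.
Qed.

Lemma comp_beta x (v : 'cV[F]_(d x)) c : comp (beta m x *m v) c = beta m x *m comp v (raise c).
Proof.
apply: (weight_dec_uniq (comp_dec _) (f' := fun c => beta m x *m comp v (raise c))).
by apply: (weight_dec_map lowerK raiseK _ _ (comp_dec v)) => // c' z; apply: eigen_beta.
Qed.

Lemma comp_A k v c : D5_at D k -> comp (mA m k *m v) c = mA m k *m comp v c.
Proof.
move=> Dk; apply: (weight_dec_uniq (comp_dec _) (f' := fun c => mA m k *m comp v c)).
apply: (@weight_dec_map _ _ _ id id _ _ _ _ _ _ (comp_dec v)) => // c' z.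
exact: eigen_A.
Qed.

Lemma comp_C k v c : NS5_at D k -> comp (mC m k *m v) c = mC m k *m comp v (raise c).
Proof.
move=> Vk; apply: (weight_dec_uniq (comp_dec _) (f' := fun c => mC m k *m comp v (raise c))).
by apply: (weight_dec_map lowerK raiseK _ _ (comp_dec v)) => // c' z; apply: eigen_C.
Qed.

Lemma comp_D k v c : NS5_at D k -> comp (mD m k *m v) c = mD m k *m comp v c.
Proof.
move=> Vk; apply: (weight_dec_uniq (comp_dec _) (f' := fun c => mD m k *m comp v c)).
apply: (@weight_dec_map _ _ _ id id _ _ _ _ _ _ (comp_dec v)) => // c' z.
exact: eigen_D.
Qed.

(** (S2) for the space of vectors that agree with a vector of im A outside the
    weights (k, s), which contains im a and is stable under beta because b
    vanishes on the other weights. *)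
Lemma A_surjective k c (v : 'cV[F]_(d k)) : D5_at D k -> c.1 <> k -> eigen c v ->
  exists2 u, eigen c u & v = mA m k *m u.
Proof.
move=> Dk ck ev.
pose T (v : 'cV[F]_(d k)) := exists u, forall c, c.1 <> k -> comp v c = mA m k *m comp u c.
have [u Tu] : T v.
  apply: (Mtilde_S2 Mm Dk (T := T)).
  - split=> [|l v1 v2 [u1 e1] [u2 e2]].
      by exists 0 => c' _; rewrite !comp0 mulmx0.
    by exists (l *: u1 + u2) => c' ne; rewrite !comp_lin e1 ?e2 // mulmxDr scalemxAr.
  - move=> v1 [u1 e1]; exists (beta m k.+1 *m u1) => c' ne.
    rewrite !comp_beta e1 // !mulmxA (beta_mA (Mtilde_moment Mm) Dk) mulmxDl -[ma m k *m _ *m _]mulmxA.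
    rewrite (b_eigen Dk (comp_eigen _ _)) ?mulmx0 ?addr0 //.
    by move=> e; apply: ne; move: (congr1 fst e).
  - by move=> u1; exists u1 => c' _; rewrite comp_A.
  - move=> u1; exists 0 => c' ne; rewrite comp0 mulmx0 (comp_id _ (eigen_a u1 Dk)).
    by case: eqP => // e; move: ne; rewrite e.
exists (comp u c); first exact: comp_eigen.
by rewrite -Tu // (comp_id _ ev) eqxx.
Qed.

(** * The part of a torus fixed point that belongs to one D5 brane *)

Section OneButterfly.
Variable U : D5 D.
Local Notation u := (posD5 U : nat).
Let Du : D5_at D u := posD5_D5_at U.
Let mom : moment_zero m := Mtilde_moment Mm.

Definition on_line (V : lmodType F) (e v : V) : Prop := exists k, v = k *: e.

Lemma on_line0 (V : lmodType F) (e : V) : on_line e 0.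
Proof. by exists 0; rewrite scale0r. Qed.

Lemma on_line_lin (V : lmodType F) (e v v' : V) k :
  on_line e v -> on_line e v' -> on_line e (k *: v + v').
Proof. by move=> [a ->] [b ->]; exists (k * a + b); rewrite scalerDl scalerA. Qed.

Lemma on_lineZ (V : lmodType F) (e v : V) k : on_line e v -> on_line e (k *: v).
Proof. by move=> [a ->]; exists (k * a); rewrite scalerA. Qed.

Lemma on_line_refl (V : lmodType F) (e : V) : on_line e e.
Proof. by exists 1; rewrite scale1r. Qed.

Fixpoint beta_a x j : 'cV[F]_(d x) :=
  if j is j'.+1 then beta m x *m beta_a x j' else ma m x.

Fixpoint left_vec j x (s : int) : 'cV[F]_(d x) :=
  if j is j'.+1 then
    if D5_at D x then mA m x *m left_vec j' x.+1 s else mC m x *m left_vec j' x.+1 (s + 1)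
  else if s <= 0 then beta_a x `|s|%N else 0.

(** The vector of the dot (u, s) to the left of U, obtained from [a_U] by
    descending in the column of U and then moving left through [C] and [A]; the
    first argument of [left_vec] is the distance to U. *)
Definition e_left x s : 'cV[F]_(d x) := left_vec (u - x) x s.

Lemma e_left_pos s : e_left u s = if s <= 0 then beta_a u `|s|%N else 0.
Proof. by rewrite /e_left subnn. Qed.

Lemma e_left_D5 k s : (k < u)%N -> D5_at D k -> e_left k s = mA m k *m e_left k.+1 s.
Proof. by move=> lt Dk; rewrite /e_left -(subnSK lt) /= Dk. Qed.

Lemma NS5_D5N k : NS5_at D k -> D5_at D k = false.
Proof. by move=> /andP[_]; rewrite is_NS5N /D5_at => /negbTE ->; rewrite andbF. Qed.

Lemma e_left_NS5 k s : (k < u)%N -> NS5_at D k -> e_left k s = mC m k *m e_left k.+1 (s + 1).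
Proof. by move=> lt Vk; rewrite /e_left -(subnSK lt) /= NS5_D5N. Qed.

Lemma left_induction (P : nat -> Prop) : P u ->
  (forall k, (k < u)%N -> P k.+1 -> P k) -> forall x, (x <= u)%N -> P x.
Proof.
move=> Pu Pk x le; have [j e] : exists j, (x + j = u)%N by exists (u - x)%N; lia.
elim: j x e {le} => [|j IH] x e; first by have -> : x = u by lia.
by apply: Pk; [lia | apply: IH; lia].
Qed.

Lemma eigen_beta_a j : eigen (u, - j%:Z) (beta_a u j).
Proof.
elim: j => [|j IH] /=; first by rewrite oppr0 /eigen G_a.
have := eigen_beta IH; rewrite /lower /=; have -> : - j%:Z - 1 = - j.+1%:Z by lia.
by [].
Qed.

Lemma eigen_e_left x s : (x <= u)%N -> eigen (u, s) (e_left x s).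
Proof.
move=> le; move: x le s; apply: left_induction => [s|k lt IH s].
  rewrite e_left_pos; case: ifP => s0; last exact: eigen0.
  by have := eigen_beta_a `|s|%N; have -> : - `|s|%N%:Z = s by lia.
case: (brane_atP (ltn_trans lt (ltn_ord (posD5 U)))) => [Dk|Vk].
  by rewrite (e_left_D5 _ lt Dk); apply: eigen_A.
rewrite (e_left_NS5 _ lt Vk); have := eigen_C Vk (IH (s + 1)).
by rewrite /lower /= addrK.
Qed.

Lemma beta_mA_eigen k c v : D5_at D k -> c <> (k, 1) -> eigen c v ->
  mA m k *m (beta m k.+1 *m v) = beta m k *m (mA m k *m v).
Proof.
move=> Dk ne ev; rewrite !mulmxA (beta_mA mom Dk) mulmxDl -[ma m k *m _ *m _]mulmxA.
by rewrite (b_eigen Dk ev ne) mulmx0 addr0.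
Qed.

Lemma neq_pos k (s s' : int) : k <> u -> (u, s) <> (k, s').
Proof. by move=> ne [e _]; apply: ne. Qed.

(** beta commutes with C, and with A on the weights of U because b of another D5
    brane vanishes there. *)
Lemma e_left_beta x s : (x <= u)%N -> on_line (e_left x (s - 1)) (beta m x *m e_left x s).
Proof.
move=> le; move: x le s; apply: left_induction => [s|k lt IH s].
  rewrite !e_left_pos; case s0: (s <= 0); last by rewrite mulmx0; apply: on_line0.
  have -> : (s - 1 <= 0) = true by lia.
  have -> : `|s - 1|%N = `|s|%N.+1 by lia.
  exact: on_line_refl.
have ne : k <> u by lia.
case: (brane_atP (ltn_trans lt (ltn_ord (posD5 U)))) => [Dk|Vk].
  rewrite !(e_left_D5 _ lt Dk) -(beta_mA_eigen Dk (@neq_pos k s 1 ne) (eigen_e_left s lt)).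
  by have [a ->] := IH s; exists a; rewrite scalemxAr.
rewrite !(e_left_NS5 _ lt Vk) mulmxA beta_mC // -mulmxA; have [a] := IH (s + 1).
have -> : s + 1 - 1 = s - 1 + 1 by lia.
by move=> ->; exists a; rewrite scalemxAr.
Qed.

(** The subrepresentation generated by [a_U] in the weights of U, cut out on
    weight vectors. To the right of U it is the preimage under A and the image
    under D. *)
Fixpoint good_right x (s : int) : 'cV[F]_(d x) -> Prop :=
  match x with
  | 0 => fun=> True
  | k.+1 => fun v =>
      if k == u then on_line (e_left k s) (mA m k *m v)
      else if D5_at D k then good_right s (mA m k *m v)
      else exists v', [/\ eigen (u, s) v', good_right s v' & v = mD m k *m v']
  end.

Definition good x s (v : 'cV[F]_(d x)) : Prop :=
  if (x <= u)%N then on_line (e_left x s) v else good_right s v.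

Lemma good_left x s v : (x <= u)%N -> good (x := x) s v = on_line (e_left x s) v.
Proof. by rewrite /good => ->. Qed.

Lemma good_posS s v : good (x := u.+1) s v = on_line (e_left u s) (mA m u *m v).
Proof. by rewrite /good ltnn /= eqxx. Qed.

Lemma good_right_D5 k s v : (u < k)%N -> D5_at D k ->
  good (x := k.+1) s v = good s (mA m k *m v).
Proof.
move=> lt Dk; have [e1 [e2 e3]] : (k.+1 <= u)%N = false /\ (k <= u)%N = false /\ (k == u) = false by lia.
by rewrite /good e1 e2 /= e3 Dk.
Qed.

Lemma good_right_NS5 k s v : (u < k)%N -> NS5_at D k -> good (x := k.+1) s v =
  exists v', [/\ eigen (u, s) v', good s v' & v = mD m k *m v'].
Proof.
move=> lt Vk; have [e1 [e2 e3]] : (k.+1 <= u)%N = false /\ (k <= u)%N = false /\ (k == u) = false by lia.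
by rewrite /good e1 e2 /= e3 NS5_D5N.
Qed.

Lemma right_induction (P : nat -> Prop) : P u.+1 ->
  (forall k, (u < k)%N -> (k < N)%N -> P k -> P k.+1) ->
  forall x, (u < x)%N -> (x <= N)%N -> P x.
Proof.
move=> Pu Pk; elim=> // k IH lt le; case: (eqVneq k u) => [-> //|ne].
by apply: Pk => //; [lia | apply: IH; lia].
Qed.

Lemma good_linear x s a (v v' : 'cV[F]_(d x)) : (x <= N)%N ->
  good s v -> good s v' -> good s (a *: v + v').
Proof.
move=> le; case: (leqP x u) => [lu|lt].
  by rewrite !good_left //; apply: on_line_lin.
move: x lt le v v'; apply: right_induction => [v v'|k lt ltN IH v v'].
  by rewrite !good_posS mulmxDr -scalemxAr; apply: on_line_lin.
case: (brane_atP ltN) => [Dk|Vk].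
  by rewrite !good_right_D5 // mulmxDr -scalemxAr; apply: IH.
rewrite !good_right_NS5 // => -[v1 [e1 g1 ->]] [v2 [e2 g2 ->]].
exists (a *: v1 + v2); split; [|exact: IH|by rewrite mulmxDr scalemxAr].
by have [_] := eigen_subspace k (u, s); apply.
Qed.

Lemma good0 x s : (x <= N)%N -> good s (0 : 'cV[F]_(d x)).
Proof.
move=> le; case: (leqP x u) => [lu|lt]; first by rewrite good_left //; apply: on_line0.
move: x lt le; apply: right_induction => [|k lt ltN IH].
  by rewrite good_posS mulmx0; apply: on_line0.
case: (brane_atP ltN) => [Dk|Vk]; first by rewrite good_right_D5 // mulmx0.
by rewrite good_right_NS5 //; exists 0; rewrite mulmx0; split=> //; apply: eigen0.
Qed.

Lemma good_beta x s (v : 'cV[F]_(d x)) : (x <= N)%N -> eigen (u, s) v -> good s v ->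
  good (s - 1) (beta m x *m v).
Proof.
move=> le; case: (leqP x u) => [lu _|lt].
  rewrite !good_left // => -[a ->]; rewrite -scalemxAr; apply: on_lineZ.
  exact: e_left_beta.
move: x lt le v; apply: right_induction => [v ev|k lt ltN IH v ev].
  rewrite !good_posS => -[a Av].
  have -> : mA m u *m (beta m u.+1 *m v) = beta m u *m (mA m u *m v) - ma m u *m (mb m u *m v).
    by rewrite !mulmxA (beta_mA mom Du) mulmxDl -!mulmxA addrK.
  rewrite [X in on_line _ X]addrC -[X in on_line _ (X + _)]scaleN1r.
  apply: on_line_lin; last first.
    by rewrite Av -scalemxAr; apply/on_lineZ/e_left_beta.
  case: (eqVneq s 1) => [->|/eqP s1]; last first.
    rewrite (b_eigen Du ev) ?mulmx0; first exact: on_line0.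
    by move=> [].
  rewrite subrr e_left_pos lexx /= [mb m u *m v]mx11_scalar mul_mx_scalar.
  exact/on_lineZ/on_line_refl.
case: (brane_atP ltN) => [Dk|Vk].
  rewrite !good_right_D5 // => gv; rewrite (beta_mA_eigen Dk _ ev); last by apply: neq_pos; lia.
  by apply: IH => //; apply: eigen_A.
rewrite !good_right_NS5 // => -[v' [ev' gv' ->]].
exists (beta m k *m v'); split; [exact: (eigen_beta ev') | exact: IH |].
by rewrite !mulmxA beta_mD.
Qed.

(** [generated], applied to the vectors all of whose components of weight (U, s) are
    good. The condition on A holds by construction to the right of U, and to its
    left because A is injective on the weights of U. *)
Theorem all_good x s (v : 'cV[F]_(d x)) : (x <= N)%N -> eigen (u, s) v -> good s v.
Proof.
move=> le ev.
suff : forall x (v : 'cV[F]_(d x)) s, (x <= N)%N -> good s (comp v (u, s)).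
  by move=> /(_ x v s le); rewrite (comp_id _ ev) eqxx.
clear le ev v s x.
apply: (gen (S := fun x v => forall s, (x <= N)%N -> good s (comp v (u, s)))); split.
- move=> y; split=> [s' le|k v v' gv gv' s' le]; first by rewrite comp0; apply: good0.
  by rewrite comp_lin; apply: good_linear; [| apply: gv | apply: gv'].
- move=> y v lt gv s' le; rewrite comp_beta /raise /=.
  have -> : s' = s' + 1 - 1 by lia.
  rewrite subrK; apply: good_beta => //; [exact: comp_eigen | exact: gv].
- move=> k Dk; have ltN : (k < N)%N by case/andP: Dk.
  split=> [v gv s' _|v gv s' _|c s' _].
  + rewrite comp_A //; have := gv s' ltN; move: (comp v _) (comp_eigen (u, s') v) => {gv}v ev gv.
    case: (ltngtP k u) => [lt|lt|e].
    * move: gv; rewrite (good_left _ _ lt) (good_left _ _ (ltnW lt)) => -[a ->].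
      by exists a; rewrite (e_left_D5 _ lt Dk) scalemxAr.
    * by rewrite -good_right_D5.
    * by subst k; rewrite good_left // -good_posS.
  + have := gv s' (ltnW ltN); rewrite comp_A //.
    move: (comp v _) (comp_eigen (u, s') v) => {gv}v ev gv.
    case: (ltngtP k u) => [lt|lt|e].
    * move: gv; rewrite (good_left _ _ lt) (good_left _ _ (ltnW lt)) (e_left_D5 _ lt Dk) => -[a Av]; exists a.
      apply/subr0_eq/(A_injective Dk (c := (u, s'))); first by move=> j; apply: neq_pos; lia.
        by apply: eigenB => //; apply/eigenZ/eigen_e_left.
      by rewrite mulmxBr -scalemxAr Av subrr.
    * by rewrite good_right_D5.
    * by subst k; rewrite good_posS -good_left.
  + rewrite (comp_id _ (eigen_a c Dk)); case: eqP => [[e ->]|_]; last exact/good0/ltnW.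
    subst k; rewrite good_left // e_left_pos lexx /= [c]mx11_scalar mul_mx_scalar.
    exact/on_lineZ/on_line_refl.
- move=> k Vk; have ltN : (k < N)%N by case/andP: Vk.
  have ne : k <> u by move=> e; move: Vk; rewrite e => /NS5_D5N; rewrite Du.
  split=> v gv s' _.
  + rewrite comp_C // /raise /=; have := gv (s' + 1) ltN.
    move: (comp v _) (comp_eigen (u, s' + 1) v) => {gv}v ev gv.
    case: (ltngtP k u) => [lt|lt|//].
      move: gv; rewrite (good_left _ _ lt) (good_left _ _ (ltnW lt)) => -[a ->].
      by exists a; rewrite (e_left_NS5 _ lt Vk) scalemxAr.
    move: gv; rewrite good_right_NS5 // => -[v' [ev' gv' ->]].
    rewrite mulmxA -beta_NS5 //; have := good_beta (ltnW ltN) ev' gv'.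
    by rewrite addrK.
  + rewrite comp_D //; have := gv s' (ltnW ltN).
    move: (comp v _) (comp_eigen (u, s') v) => {gv}v ev gv.
    case: (ltngtP k u) => [lt|lt|//]; last by rewrite good_right_NS5 //; exists v.
    move: gv; rewrite (good_left _ _ lt) (good_left _ _ (ltnW lt)) => -[a ->]; rewrite (e_left_NS5 _ lt Vk) -scalemxAr.
    rewrite mulmxA -beta_left_NS5 // beta_leftE //; apply: on_lineZ.
    by have := e_left_beta (s' + 1) lt; rewrite addrK.
Qed.

Lemma eigen_left x s (v : 'cV[F]_(d x)) : (x <= u)%N -> eigen (u, s) v -> on_line (e_left x s) v.
Proof.
move=> le ev; rewrite -good_left //; apply: all_good => //.
exact: leq_trans le (ltnW (ltn_ord _)).
Qed.

Lemma D_surjective k s (v : 'cV[F]_(d k.+1)) : (u < k)%N -> NS5_at D k -> eigen (u, s) v ->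
  exists2 v', eigen (u, s) v' & v = mD m k *m v'.
Proof.
move=> lt Vk ev; have := all_good (x := k.+1) _ ev; rewrite good_right_NS5 //.
by case=> [|v' [ev' _ ->]]; [case/andP: Vk | exists v'].
Qed.

(** The weight spaces of U at one D3 brane look like a column of n dots with top
    height t: each is a line or zero, and beta descends. *)
Definition column x (t : int) (n : nat) (e : int -> 'cV[F]_(d x)) : Prop :=
  [/\ forall s, eigen (u, s) (e s), forall s, (e s != 0) = (t - n%:Z < s <= t),
      forall s v, eigen (u, s) v -> on_line (e s) v &
      forall s, s <= t -> beta m x *m e s = e (s - 1)].

Lemma column_size_uniq x t n n' e : column (x := x) t n e -> column t n' e -> n = n'.
Proof.
move=> [_ e1 _ _] [_ e2 _ _]; apply/eqP; rewrite eqn_leq; apply/andP; split.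
  by move: (e1 (t - n'%:Z)); rewrite e2; lia.
by move: (e2 (t - n%:Z)); rewrite e1; lia.
Qed.

(** The number of dots to the left of U is the nilpotency order of beta on a_U. *)
Lemma column_pos : exists l, column 0 l (e_left u).
Proof.
have inj : injective (fun j : nat => w (u, - j%:Z)) by move=> i j /w_inj[] /oppr_inj[].
have eig j : (beta_a u j)^T *m (G u)^T = w (u, - j%:Z) *: (beta_a u j)^T.
  by have e := eigen_beta_a j; rewrite -trmx_mul e linearZ.
have [j j0] := no_infinite_spectrum inj eig.
have ex0 : exists j, beta_a u j == 0 by exists j; rewrite -(trmxK (beta_a u j)) j0 trmx0.
case: (ex_minnP ex0) => l /eqP l0 lmin; exists l; split.
- by move=> s; apply: eigen_e_left.
- have out i : (l <= i)%N -> beta_a u i = 0.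
    elim: i => [|i IH]; first by case: (l) l0.
    rewrite leq_eqVlt => /orP[/eqP <- //|]; rewrite ltnS => /IH /= ->.
    by rewrite mulmx0.
  move=> s; rewrite e_left_pos sub0r; case: (lerP s 0) => s0; last by rewrite eqxx andbF.
  rewrite andbT; case: (leqP l `|s|%N) => [le|lt].
    by rewrite out // eqxx; lia.
  have -> : (beta_a u `|s|%N != 0).
    by apply/negP => /lmin; rewrite leqNgt lt.
  lia.
- by move=> s v ev; apply: eigen_left.
- move=> s s0; rewrite !e_left_pos s0; have -> : (s - 1 <= 0) = true by lia.
  by have -> : `|s - 1|%N = `|s|%N.+1 by lia.
Qed.

Lemma column_left_D5 k t n : (k < u)%N -> D5_at D k ->
  column t n (e_left k.+1) -> column t n (e_left k).
Proof.
move=> lt Dk [ee e0 el eb]; have ne : k <> u by lia.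
have eA s : e_left k s = mA m k *m e_left k.+1 s by apply: e_left_D5.
split.
- by move=> s; apply/eigen_e_left/ltnW.
- move=> s; rewrite -e0 eA; congr (~~ _); apply/eqP/eqP => [e|->]; last by rewrite mulmx0.
  by apply: (A_injective Dk (c := (u, s))) => // j; apply: neq_pos.
- by move=> s v; apply/eigen_left/ltnW.
- move=> s st; rewrite !eA -(beta_mA_eigen Dk (@neq_pos k s 1 ne) (ee s)).
  by rewrite eb.
Qed.

(** D C = beta is nonzero on every dot but the bottom one, so C can only kill the
    bottom dot. *)
Lemma column_left_NS5 k t n' : (k < u)%N -> NS5_at D k ->
  column t n' (e_left k.+1) ->
  exists2 n, (n <= n' <= n.+1)%N & column (t - 1) n (e_left k).
Proof.
move=> lt Vk [ee e0 el eb].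
have eC s : e_left k s = mC m k *m e_left k.+1 (s + 1) by apply: e_left_NS5.
have DC s : s + 1 <= t -> mD m k *m e_left k s = e_left k.+1 s.
  move=> st; rewrite eC mulmxA -beta_left_NS5 // beta_leftE ?eb ?addrK //.
  exact: (leq_trans lt (ltnW (ltn_ord _))).
pose bot := e_left k (t - n'%:Z) == 0.
exists (if bot then n'.-1 else n'); first by case: bot; lia.
split.
- by move=> s; apply/eigen_e_left/ltnW.
- move=> s; have out : e_left k.+1 (s + 1) = 0 -> e_left k s = 0 by rewrite eC => ->; rewrite mulmx0.
  case in1 : (t - n'%:Z < s + 1 <= t); last first.
    rewrite out ?eqxx; first by case: (bot); lia.
    by apply/eqP; rewrite -[_ == 0]negbK e0 in1.
  case: (eqVneq s (t - n'%:Z)) => [es|sn].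
    by rewrite es -/bot; case: (bot); lia.
  have -> : e_left k s != 0.
    have es0 : e_left k.+1 s != 0 by rewrite e0; lia.
    by apply: contraNneq es0 => e; rewrite -DC ?e ?mulmx0 //; lia.
  by case: (bot); lia.
- by move=> s v; apply/eigen_left/ltnW.
- move=> s st; rewrite !eC mulmxA beta_mC // -mulmxA eb; last by lia.
  by congr (_ *m e_left _ _); lia.
Qed.

Definition pick_vec p (P : 'cV[F]_p -> Prop) : 'cV[F]_p :=
  if pselect (exists v, P v) is left ex then projT1 (cid ex) else 0.

Lemma pick_vecP p (P : 'cV[F]_p -> Prop) v : P v -> P (pick_vec P).
Proof.
move=> Pv; rewrite /pick_vec; case: pselect => [ex|[]]; last by exists v.
exact: (projT2 (cid ex)).
Qed.

Lemma pick_vec_spec p (P : 'cV[F]_p -> Prop) : P (pick_vec P) \/ pick_vec P = 0.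
Proof.
by rewrite /pick_vec; case: pselect => [ex|nex]; [left; apply: (projT2 (cid ex)) | right].
Qed.

(** Above height 0, where A vanishes, the vector of height s is normalized by
    b beta^(s - 1), the only covector of this form that detects it. *)
Definition middle_spec k (s : int) (v : 'cV[F]_(d k.+1)) : Prop :=
  eigen (u, s) v /\
  if s <= 0 then mA m k *m v = e_left k s else b_beta k `|s|%N.-1 *m v = (-1)%:M.

Fixpoint e_right x (s : int) : 'cV[F]_(d x) :=
  match x with
  | 0 => 0
  | k.+1 =>
      if k == u then pick_vec (middle_spec (k := k) s)
      else if D5_at D k then pick_vec (fun v => eigen (u, s) v /\ mA m k *m v = e_right k s)
      else mD m k *m e_right k s
  end.

Lemma e_right_pos s : e_right u.+1 s = pick_vec (middle_spec (k := u) s).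
Proof. by rewrite /= eqxx. Qed.

Lemma eigen_middle s : eigen (u, s) (e_right u.+1 s).
Proof.
rewrite e_right_pos; case: (pick_vec_spec (middle_spec (k := u) s)) => [[]//|->].
exact: eigen0.
Qed.

Lemma A_above s (v : 'cV[F]_(d u.+1)) : 0 < s -> eigen (u, s) v -> mA m u *m v = 0.
Proof.
move=> s0 ev; have [a ->] := eigen_left (leqnn u) (eigen_A Du ev).
by rewrite e_left_pos leNgt s0 scaler0.
Qed.

Lemma neq_below s : s <= 0 -> forall j : nat, (u, s) <> (u, j.+1%:Z).
Proof. by move=> s0 j [e]; move: s0; rewrite e. Qed.

(** Up to height 0 the map A is injective; above, A and all the b beta^j but one
    vanish on the weight space, so (S1) applies. *)
Lemma middle_uniq s v v' : middle_spec (k := u) s v -> middle_spec (k := u) s v' -> v = v'.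
Proof.
move=> [ev sv] [ev' sv']; apply: subr0_eq; have evv := eigenB ev ev'.
case: (lerP s 0) sv sv' => s0 sv sv'.
  by apply: (A_injective Du (neq_below s0) evv); rewrite mulmxBr sv sv' subrr.
apply: (S1_b_beta Du) => [|j]; first exact: (A_above s0).
case: (eqVneq j `|s|%N.-1) => [->|ne]; first by rewrite mulmxBr sv sv' subrr.
by apply: (b_beta_eigen Du evv) => -[e]; move: ne; rewrite e; lia.
Qed.

Lemma middle_line s v : eigen (u, s) v -> on_line (e_right u.+1 s) v.
Proof.
move=> ev; have [->|v0] := eqVneq v 0; first exact: on_line0.
suff [a a0 sp] : exists2 a, a != 0 & middle_spec (k := u) s (a *: v).
  have e : e_right u.+1 s = a *: v.
    by rewrite e_right_pos; apply: middle_uniq (pick_vecP sp) sp.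
  by exists a^-1; rewrite e scalerA mulVf // scale1r.
case: (lerP s 0) => s0; last first.
  have bv0 : (b_beta u `|s|%N.-1 *m v) 0 0 != 0.
    apply: contraNneq v0 => b0; apply/eqP/(S1_b_beta Du) => [|j]; first exact: A_above ev.
    case: (eqVneq j `|s|%N.-1) => [->|ne]; first by rewrite [LHS]mx11_scalar b0 raddf0.
    by apply: (b_beta_eigen Du ev) => -[e]; move: ne; rewrite e; lia.
  exists (- ((b_beta u `|s|%N.-1 *m v) 0 0)^-1); first by rewrite oppr_eq0 invr_eq0.
  split; first exact: eigenZ.
  rewrite leNgt s0 /= -scalemxAr [X in _ *: X]mx11_scalar scale_scalar_mx mulNr mulVf //.
have Av0 : mA m u *m v != 0.
  by apply: contraNneq v0 => A0; apply/eqP; apply: (A_injective Du (neq_below s0) ev).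
have [a ea] := eigen_left (leqnn u) (eigen_A Du ev).
have a0 : a != 0 by apply: contraNneq Av0 => a0; rewrite ea a0 scale0r.
exists a^-1; first by rewrite invr_eq0.
split; first exact: eigenZ.
by rewrite s0 -scalemxAr ea scalerA mulVf // scale1r.
Qed.

Lemma middle_ok s : e_right u.+1 s != 0 -> middle_spec (k := u) s (e_right u.+1 s).
Proof.
rewrite e_right_pos; case: (pick_vec_spec (middle_spec (k := u) s)) => [//|->].
by rewrite eqxx.
Qed.

(** For s = 1 the moment map equation at U turns the normalization of b into
    A beta e(1) = a. *)
Lemma middle_beta s : e_right u.+1 s != 0 ->
  middle_spec (k := u) (s - 1) (beta m u.+1 *m e_right u.+1 s).
Proof.
move=> /middle_ok[ev]; move: (e_right _ _) ev => v ev spec.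
split; first exact: (eigen_beta ev).
case: (lerP s 0) spec => s0 spec.
  have -> : (s - 1 <= 0) = true by lia.
  rewrite (beta_mA_eigen Du _ ev); last by move=> [e]; move: s0; rewrite e.
  have [l [_ _ _ eb]] := column_pos.
  by rewrite spec eb.
case: (eqVneq s 1) => [s1|s1].
  subst s; rewrite /= in spec; rewrite subrr lexx.
  have := congr1 (mulmx^~ v) (beta_mA mom Du).
  rewrite /= mulmxDl -!mulmxA (A_above s0 ev) mulmx0 spec => /esym/eqP.
  by rewrite addr_eq0 e_left_pos lexx /= raddfN mulmxN mulmx1 opprK => /eqP.
have -> : (s - 1 <= 0) = false by lia.
have [j es] : exists j : nat, s = j.+2%:Z by exists (`|s|%N.-2); lia.
have -> : `|s - 1|%N.-1 = j by lia.
move: spec; have -> : `|s|%N.-1 = j.+1 by lia.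
by rewrite /= mulmxA.
Qed.

Lemma middle_next s : e_right u.+1 s != 0 ->
  beta m u.+1 *m e_right u.+1 s = e_right u.+1 (s - 1).
Proof.
move=> /middle_beta sp; rewrite [RHS]e_right_pos.
exact: middle_uniq sp (pick_vecP sp).
Qed.

(** The dots to the right of U have no gaps down to the bottom height of the column
    to its left: beta of a dot is nonzero, since A or a covector b beta^j
    detects it. *)
Lemma middle_descends l s : column 0 l (e_left u) -> e_right u.+1 s != 0 ->
  - l%:Z < s /\ (- l%:Z < s - 1 -> e_right u.+1 (s - 1) != 0).
Proof.
move=> [_ e0 _ _] es; split.
  have [ev] := middle_ok es; case: (lerP s 0) => [s0 Ae|]; last by lia.
  have : mA m u *m e_right u.+1 s != 0.
    by apply: contraNneq es => A0; apply/eqP/(A_injective Du (neq_below s0) ev).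
  by rewrite Ae e0 sub0r => /andP[].
move=> ls; have [_] := middle_beta es; rewrite -middle_next //.
case: (lerP (s - 1) 0) => s0 sp; apply/eqP => v0; move: sp; rewrite v0 mulmx0 => /esym/eqP.
  by apply/negP; rewrite e0 sub0r ls.
by rewrite raddfN oppr_eq0 => /eqP /matrixP /(_ 0 0); rewrite !mxE => /eqP; rewrite oner_eq0.
Qed.

Lemma column_middle l : column 0 l (e_left u) ->
  exists n, column (n%:Z - l%:Z) n (e_right u.+1).
Proof.
move=> cl; pose s_ (i : nat) : int := 1 - l%:Z + i%:Z.
have inj : injective (fun j : nat => w (u, s_ j)) by move=> i j /w_inj[]; rewrite /s_; lia.
have eig j : (e_right u.+1 (s_ j))^T *m (G u.+1)^T = w (u, s_ j) *: (e_right u.+1 (s_ j))^T.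
  by have e := eigen_middle (s_ j); rewrite -trmx_mul e linearZ.
have [j j0] := no_infinite_spectrum inj eig.
have ex0 : exists j, e_right u.+1 (s_ j) == 0 by exists j; rewrite -(trmxK (e_right _ _)) j0 trmx0.
case: (ex_minnP ex0) => n /eqP n0 nmin; exists n.
have nonzero s : (e_right u.+1 s != 0) = (n%:Z - l%:Z - n%:Z < s <= n%:Z - l%:Z).
  case: (lerP s (- l%:Z)) => [le|lt].
    rewrite (_ : (_ && _) = false); last by lia.
    by apply/negbTE/negP => /(middle_descends cl)[]; lia.
  have [i es] : exists i, s = s_ i by exists (absz (s - 1 + l%:Z)); rewrite /s_; lia.
  rewrite es (_ : (_ && _) = (i < n)%N); last by rewrite /s_; lia.
  case: ltnP => [lt_in|le_ni]; first by apply/negP => /nmin; lia.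
  apply/negbTE; rewrite negbK.
  elim: i le_ni {s lt es} => [|i IH]; first by rewrite leqn0 => /eqP n00; rewrite n00 in n0; rewrite n0.
  rewrite leq_eqVlt => /orP[/eqP <-|]; first by rewrite n0.
  rewrite ltnS => /IH; apply: contraLR => /(middle_descends cl)[_].
  have -> : s_ i.+1 - 1 = s_ i by rewrite /s_; lia.
  by apply; rewrite /s_; lia.
split=> [s|//|s v|s sn]; [exact: eigen_middle | exact: middle_line |].
have [es|es] := eqVneq (e_right u.+1 s) 0; last exact: middle_next.
rewrite es mulmx0; apply/esym/eqP; rewrite -[_ == 0]negbK nonzero.
by have := nonzero s; rewrite es eqxx; lia.
Qed.

Lemma column_right_D5 k t n : (u < k)%N -> D5_at D k -> column t n (e_right k) ->
  column t n (e_right k.+1) /\ forall s, mA m k *m e_right k.+1 s = e_right k s.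
Proof.
move=> lt Dk [ee e0 el eb]; have ne : k <> u by lia.
have spec s : eigen (u, s) (e_right k.+1 s) /\ mA m k *m e_right k.+1 s = e_right k s.
  have [v ev Av] := A_surjective Dk (c := (u, s)) (fun e : u = k => ne (esym e)) (ee s).
  rewrite /= (negbTE (introN eqP ne)) Dk.
  exact: (@pick_vecP _ (fun v => eigen (u, s) v /\ mA m k *m v = e_right k s) v).
have A0 s v : eigen (u, s) v -> mA m k *m v = 0 -> v = 0.
  by move=> ev; apply: (A_injective Dk _ ev) => j; apply: neq_pos.
split=> [|s]; last by have [] := spec s.
split=> [s|s|s v ev|s st].
- by have [] := spec s.
- have [ev Av] := spec s; rewrite -e0 -Av; congr (~~ _); apply/eqP/eqP => [->|/(A0 s _ ev) //].
  by rewrite mulmx0.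
- have [a Av] := el s _ (eigen_A Dk ev); exists a; apply: subr0_eq.
  have [ev' Av'] := spec s; apply: (A0 s); first by apply: eigenB => //; apply: eigenZ.
  by rewrite mulmxBr -scalemxAr Av' Av subrr.
- apply: subr0_eq; have [ev Av] := spec s; have [ev' Av'] := spec (s - 1).
  apply: (A0 (s - 1)); first by apply: eigenB => //; apply: (eigen_beta ev).
  by rewrite mulmxBr (beta_mA_eigen Dk (@neq_pos k s 1 ne) ev) Av Av' eb // subrr.
Qed.

Lemma e_right_NS5 k s : (u < k)%N -> NS5_at D k -> e_right k.+1 s = mD m k *m e_right k s.
Proof.
move=> lt Vk; have e : (k == u) = false by lia.
by rewrite /= e (NS5_D5N Vk); exact: erefl.
Qed.

(** As C D = beta, the map D can only kill the bottom dot. *)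
Lemma column_right_NS5 k t n : (u < k)%N -> NS5_at D k -> column t n (e_right k) ->
  exists2 n', (n' <= n <= n'.+1)%N & column t n' (e_right k.+1).
Proof.
move=> lt Vk [ee e0 el eb]; have eD s := e_right_NS5 s lt Vk.
have CD s : s <= t -> mC m k *m e_right k.+1 s = e_right k (s - 1).
  by move=> st; rewrite eD mulmxA -beta_NS5 // eb.
pose bot := e_right k.+1 (t - n%:Z + 1) == 0.
exists (if bot then n.-1 else n); first by case: bot; lia.
split.
- by move=> s; rewrite eD; apply: eigen_D.
- move=> s; case ins : (t - n%:Z < s <= t); last first.
    have es : e_right k s = 0 by apply/eqP; rewrite -[_ == 0]negbK e0 ins.
    by rewrite eD es mulmx0 eqxx; case: (bot); lia.
  case: (eqVneq s (t - n%:Z + 1)) => [es|sn].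
    by rewrite es -/bot; case: (bot); lia.
  have -> : e_right k.+1 s != 0.
    have es0 : e_right k (s - 1) != 0 by rewrite e0; lia.
    by apply: contraNneq es0 => e; rewrite -CD ?e ?mulmx0 //; lia.
  by case: (bot); lia.
- move=> s v ev; have [v' ev' ->] := D_surjective lt Vk ev.
  by have [a ->] := el s v' ev'; exists a; rewrite eD scalemxAr.
- by move=> s st; rewrite !eD mulmxA beta_mD // -mulmxA eb.
Qed.

Definition e_dot x s : 'cV[F]_(d x) := if (x <= u)%N then e_left x s else e_right x s.

Lemma e_dot_left x s : (x <= u)%N -> e_dot x s = e_left x s.
Proof. by rewrite /e_dot => ->. Qed.

Lemma e_dot_right x s : (u < x)%N -> e_dot x s = e_right x s.
Proof. by move=> lt; rewrite /e_dot leqNgt lt. Qed.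

Lemma e_dot_leftE x : (x <= u)%N -> e_dot x = e_left x.
Proof. by move=> le; apply: funext => s; apply: e_dot_left. Qed.

Lemma e_dot_rightE x : (u < x)%N -> e_dot x = e_right x.
Proof. by move=> le; apply: funext => s; apply: e_dot_right. Qed.

(** To the left of U the heights do not depend on the tie diagram, so any [S0] can
    measure them before the tie diagram of the point is known. *)
Theorem columns (S0 : {set tie D}) : exists n : nat -> nat,
  (forall x, (x <= N)%N -> column (if (x <= u)%N then top_height S0 U x
                                  else (n u.+1)%:Z - (n u)%:Z) (n x) (e_dot x)) /\
  [/\ forall k, D5_at D k -> k <> u -> n k = n k.+1,
      forall k, NS5_at D k -> (k < u)%N -> (n k <= n k.+1 <= (n k).+1)%N &
      forall k, NS5_at D k -> (u < k)%N -> (n k.+1 <= n k <= (n k.+1).+1)%N].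
Proof.
have [l cl] := column_pos; have [r cr] := column_middle cl.
pose t x := if (x <= u)%N then top_height S0 U x else r%:Z - l%:Z.
have tl x : (x <= u)%N -> t x = top_height S0 U x by rewrite /t => ->.
have tr x : (u < x)%N -> t x = r%:Z - l%:Z by move=> lt; rewrite /t leqNgt lt.
have uN : (u < N)%N := ltn_ord _.
have ex_left x : (x <= u)%N -> exists n, column (t x) n (e_dot x).
  move: x; apply: left_induction => [|k lt [n]].
    by exists l; rewrite tl // top_height_pos e_dot_leftE.
  rewrite !tl ?(ltnW lt) // !e_dot_leftE ?(ltnW lt) // => cn.
  case: (brane_atP (ltn_trans lt uN)) => [Dk|Vk].
    by exists n; rewrite (top_height_D5 S0 lt Dk); apply: column_left_D5.
  have [n' _ cn'] := column_left_NS5 lt Vk cn; exists n'.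
  by rewrite (top_heightS S0 lt) Vk.
have ex_right x : (u < x)%N -> (x <= N)%N -> exists n, column (t x) n (e_dot x).
  move: x; apply: right_induction => [|k lt ltN [n]].
    by exists r; rewrite tr // e_dot_rightE.
  have lt1 : (u < k.+1)%N by lia.
  rewrite (tr _ lt) (tr _ lt1) (e_dot_rightE lt) (e_dot_rightE lt1) => cn.
  case: (brane_atP ltN) => [Dk|Vk].
    by exists n; have [] := column_right_D5 lt Dk cn.
  by have [n' _ cn'] := column_right_NS5 lt Vk cn; exists n'.
have /choice[n nP] : forall x, exists n, (x <= N)%N -> column (t x) n (e_dot x).
  move=> x; case: (leqP x N) => [le|//]; last by exists 0%N.
  by case: (leqP x u) => [/ex_left[n cn]|/ex_right /(_ le) [n cn]]; exists n.
have nu : n u = l.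
  have := nP u (ltnW uN); rewrite tl // top_height_pos e_dot_leftE // => /column_size_uniq; exact.
have nuS : n u.+1 = r.
  have := nP u.+1 uN; rewrite tr // e_dot_rightE // => /column_size_uniq; exact.
exists n; split; first by move=> x le; rewrite nu nuS; apply: nP.
split=> [k Dk ne|k Vk lt|k Vk lt].
- have ltN : (k < N)%N by case/andP: Dk.
  have := nP k (ltnW ltN); have := nP k.+1 ltN.
  case: (ltngtP k u) => [lt|lt|//].
    rewrite !tl ?(ltnW lt) // !e_dot_leftE ?(ltnW lt) // => ck1.
    rewrite (top_height_D5 S0 lt Dk) => ck.
    exact: column_size_uniq ck (column_left_D5 lt Dk ck1).
  have lt1 : (u < k.+1)%N by lia.
  rewrite (tr _ lt) (tr _ lt1) (e_dot_rightE lt) (e_dot_rightE lt1) => ck1 ck.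
  by have [ck' _] := column_right_D5 lt Dk ck; apply: column_size_uniq ck' ck1.
- have ltN : (k < N)%N by case/andP: Vk.
  have := nP k (ltnW ltN); have := nP k.+1 ltN.
  rewrite !tl ?(ltnW lt) // !e_dot_leftE ?(ltnW lt) // => ck1.
  have [n' le cn'] := column_left_NS5 lt Vk ck1.
  by rewrite (top_heightS S0 lt) Vk => ck; rewrite (column_size_uniq ck cn').
- have ltN : (k < N)%N by case/andP: Vk.
  have := nP k (ltnW ltN); have := nP k.+1 ltN.
  have lt1 : (u < k.+1)%N by lia.
  rewrite (tr _ lt) (tr _ lt1) (e_dot_rightE lt) (e_dot_rightE lt1) => ck1 ck.
  have [n' le cn'] := column_right_NS5 lt Vk ck.
  by rewrite (column_size_uniq ck1 cn').
Qed.

Lemma has_column x : (x <= N)%N -> exists t n, column t n (e_dot x).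
Proof.
by move=> le; have [n [cn _]] := columns finset.set0; do 2 eexists; apply: (cn x le).
Qed.

Lemma e_dot_beta x s : (x <= N)%N -> e_dot x s != 0 -> beta m x *m e_dot x s = e_dot x (s - 1).
Proof.
move=> le; have [t [n [_ e0 _ eb]]] := has_column le.
by rewrite e0 => /andP[_ st]; apply: eb.
Qed.

Lemma e_dot_A k s : D5_at D k -> e_dot k.+1 s != 0 -> mA m k *m e_dot k.+1 s = e_dot k s.
Proof.
move=> Dk; have ltN : (k < N)%N by case/andP: Dk.
case: (ltngtP k u) => [lt|lt|e].
- by rewrite (e_dot_left _ lt) (e_dot_left _ (ltnW lt)) (e_left_D5 _ lt Dk).
- have [t [n]] := has_column (ltnW ltN); rewrite (e_dot_rightE lt) => /(column_right_D5 lt Dk)[_ eA] _.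
  have lt1 : (u < k.+1)%N by lia.
  by rewrite (e_dot_right _ lt1); apply: eA.
- subst k; rewrite e_dot_right // e_dot_left // => /middle_ok[ev].
  by case: (lerP s 0) => s0 // _; rewrite (A_above s0 ev) e_left_pos leNgt s0.
Qed.

Lemma e_dot_C k s : NS5_at D k -> e_dot k.+1 s != 0 ->
  mC m k *m e_dot k.+1 s = e_dot k (s - 1).
Proof.
move=> Vk; have ltN : (k < N)%N by case/andP: Vk.
case: (ltngtP k u) => [lt|lt|e].
- by rewrite (e_dot_left _ lt) (e_dot_left _ (ltnW lt)) (e_left_NS5 _ lt Vk) subrK.
- have lt1 : (u < k.+1)%N by lia.
  have := @e_dot_beta k s (ltnW ltN); rewrite !(e_dot_right _ lt) (e_dot_right _ lt1).
  rewrite (e_right_NS5 _ lt Vk) beta_NS5 // -mulmxA => eb e0; apply: eb.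
  by apply: contraNneq e0 => ->; rewrite mulmx0.
- by have := NS5_D5N Vk; rewrite e Du.
Qed.

Lemma e_dot_D k s : NS5_at D k -> e_dot k s != 0 -> mD m k *m e_dot k s = e_dot k.+1 s.
Proof.
move=> Vk; have ltN : (k < N)%N by case/andP: Vk.
case: (ltngtP k u) => [lt|lt|e].
- have := @e_dot_beta k.+1 (s + 1) ltN.
  rewrite !(e_dot_left _ lt) !(e_dot_left _ (ltnW lt)) (e_left_NS5 _ lt Vk) addrK.
  rewrite -beta_leftE // beta_left_NS5 // -mulmxA => eb e0; apply: eb.
  by apply: contraNneq e0 => ->; rewrite mulmx0.
- have lt1 : (u < k.+1)%N by lia.
  by rewrite (e_dot_right _ lt) (e_dot_right _ lt1) (e_right_NS5 _ lt Vk) => _; exact: erefl.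
- by have := NS5_D5N Vk; rewrite e Du.
Qed.

Lemma e_dot_a : e_dot u 0 = ma m u.
Proof. by rewrite e_dot_left // e_left_pos lexx. Qed.

Lemma eigen_e_dot x s : (x <= N)%N -> eigen (u, s) (e_dot x s).
Proof. by move=> le; have [t [n []]] := has_column le. Qed.

Lemma e_dot_b k s : D5_at D k -> e_dot k.+1 s != 0 ->
  mb m k *m e_dot k.+1 s = - ((u, s) == (k, 1))%:R%:M.
Proof.
move=> Dk; have ltN : (k < N)%N by case/andP: Dk.
move=> e0; have [[e s1]|ne] := ((u, s) : dot) =P (k, 1); last first.
  by rewrite raddf0 oppr0 (b_eigen Dk (eigen_e_dot s ltN)).
subst k s; move: e0; rewrite e_dot_right // => /middle_ok[_] /=.
by rewrite raddfN.
Qed.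

End OneButterfly.

(** * Torus fixed points are butterflies *)

Definition point_column_size (U : D5 D) : nat -> nat := projT1 (cid (columns U finset.set0)).

Lemma point_column_sizeP (U : D5 D) :
  (forall x, (x <= N)%N -> column U (if (x <= posD5 U)%N then top_height finset.set0 U x
      else (point_column_size U (posD5 U).+1)%:Z - (point_column_size U (posD5 U))%:Z)
      (point_column_size U x) (e_dot U x)) /\
  [/\ forall k, D5_at D k -> k <> posD5 U -> point_column_size U k = point_column_size U k.+1,
      forall k, NS5_at D k -> (k < posD5 U)%N ->
        (point_column_size U k <= point_column_size U k.+1 <= (point_column_size U k).+1)%N &
      forall k, NS5_at D k -> (posD5 U < k)%N ->
        (point_column_size U k.+1 <= point_column_size U k <= (point_column_size U k.+1).+1)%N].
Proof. exact: projT2 (cid (columns U finset.set0)). Qed.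

(** Forced by the shape of butterflies, where the column of U changes size exactly
    at the NS5 branes tied to U. *)
Definition ties_of_point : {set tie D} :=
  [set p : tie D | point_column_size p.1 (posNS5 p.2) != point_column_size p.1 (posNS5 p.2).+1]%SET.
Local Notation S := ties_of_point.

Lemma point_column_size0 U x : d x = 0%N -> (x <= N)%N -> point_column_size U x = 0%N.
Proof.
move=> dx le; have [/(_ x le)[_ e0 _ _] _] := point_column_sizeP U.
set t := (if _ then _ else _) in e0.
by have := e0 t; rewrite (mx_norows_eq (e_dot U x t) 0 dx) eqxx; lia.
Qed.

Lemma ties_at_point U k : NS5_at D k ->
  ties_at S U k = (point_column_size U k != point_column_size U k.+1).
Proof.
move=> /andP[lt kV]; rewrite /ties_at (big_pred1 (exist _ (Ordinal lt) kV)) => [|V] //.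
by rewrite inE.
Qed.

(** Both sides vanish at the outer D3 branes and change alike at each 5-brane. *)
Lemma nties_point U x : (x <= N)%N -> nties S U x = point_column_size U x.
Proof.
have [_ [nD nl nr]] := point_column_sizeP U; have uN : (posD5 U < N)%N := ltn_ord _.
case: (leqP x (posD5 U)) => [|lt le].
  elim: x => [_ _|k IH lt le].
    by rewrite nties_first point_column_size0 //; apply: mult_first.
  rewrite nties_leftS // IH ?(ltnW lt) ?(ltnW le) //.
  case: (brane_atP le) => [Dk|Vk].
    by rewrite (ties_at_D5 S U Dk) addn0; have := @nD _ Dk; lia.
  by rewrite ties_at_point //; have := nl k Vk lt; lia.
have [j e] : exists j, (x + j = N)%N by exists (N - x)%N; lia.
elim: j x lt le e => [|j IH] x lt le e.
  have xN : x = N by lia.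
  by rewrite nties_out ?xN // point_column_size0 //; apply: mult_last.
rewrite nties_rightS // IH; [|lia..].
have ltN : (x < N)%N by lia.
case: (brane_atP ltN) => [Dk|Vk].
  by rewrite (ties_at_D5 S U Dk) addn0; have := @nD _ Dk; lia.
by rewrite ties_at_point //; have := nr x Vk lt; lia.
Qed.

Lemma column_point U x : (x <= N)%N ->
  column U (top_height S U x) (nties S U x) (e_dot U x).
Proof.
move=> le; have [/(_ x le) + _] := point_column_sizeP U; rewrite nties_point //.
have uN : (posD5 U < N)%N := ltn_ord _.
rewrite /top_height; case: (ltnP (posD5 U) x) => lt //.
by rewrite !nties_point // ltnW.
Qed.

Definition e_vec x (c : dot) : 'cV[F]_(d x) :=
  if [pick U : D5 D | (posD5 U : nat) == c.1] is Some U then e_dot U x c.2 else 0.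

Lemma e_vecE x U s : e_vec x (posD5 U : nat, s) = e_dot U x s.
Proof.
rewrite /e_vec; case: pickP => [U' /eqP /= e|/(_ U)]; last by rewrite eqxx.
by have -> : U' = U by apply/val_inj/val_inj.
Qed.

Lemma e_vec_dots x c : (x <= N)%N -> (e_vec x c != 0) = (c \in dots S x).
Proof.
move=> le; case: c => u s; case cd: (_ \in _).
  have [U /= e inU] := dots_D5 cd; subst u; rewrite e_vecE.
  by have [_ -> _ _] := column_point U le.
rewrite /e_vec; case: pickP => [U /eqP /= e|_]; last by rewrite eqxx.
by have [_ -> _ _] := column_point U le; rewrite -cd -e mem_dots.
Qed.

Lemma e_vec_line x c (v : 'cV[F]_(d x)) : (x <= N)%N -> eigen c v -> on_line (e_vec x c) v.
Proof.
move=> le ev; case: c ev => u s ev; case Du: (D5_at D u); last first.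
  by rewrite (eigen_D5_at ev) ?Du //; apply: on_line0.
have [U e] := D5_brane Du; subst u; rewrite e_vecE.
by have [_ _ el _] := column_point U le; apply: el.
Qed.

Lemma eigen_e_vec x c : (x <= N)%N -> eigen c (e_vec x c).
Proof.
move=> le; case: c => u s; rewrite /e_vec; case: pickP => [U /eqP /= <-|_]; last exact: eigen0.
by have [] := column_point U le.
Qed.

Lemma e_vec_span x (v : 'cV[F]_(d x)) : (x <= N)%N ->
  exists k : dot -> F, v = \sum_(c <- dots S x) k c *: e_vec x c.
Proof.
move=> le; have [r [ur _ fr e]] := comp_sum v.
have /choice[k kP] : forall c, exists a, comp v c = a *: e_vec x c.
  by move=> c; apply: e_vec_line => //; apply: comp_eigen.
exists k; rewrite {1}e; have sub : {subset r <= undup (r ++ dots S x)}.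
  by move=> c; rewrite mem_undup mem_cat => ->.
have sub' : {subset dots S x <= undup (r ++ dots S x)}.
  by move=> c; rewrite mem_undup mem_cat => ->; rewrite orbT.
rewrite -(sum_supp ur (undup_uniq _) sub fr).
rewrite (sum_supp (uniq_dots S x) (undup_uniq _) sub'); last first.
  move=> c cN; rewrite kP; have -> : e_vec x c = 0; last by rewrite scaler0.
  by apply/eqP; rewrite -[_ == 0]negbK e_vec_dots.
by apply: eq_bigr => c _.
Qed.

Lemma e_vec_free x (k : dot -> F) : (x <= N)%N ->
  \sum_(c <- dots S x) k c *: e_vec x c = 0 -> forall c, c \in dots S x -> k c = 0.
Proof.
move=> le sum0 c cd.
have := eigen_independent (uniq_dots S x) (f := fun c => k c *: e_vec x c) _ sum0 cd.
move=> /(_ (fun c' _ => eigenZ (k c') (eigen_e_vec c' le))) /eqP.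
by rewrite scaler_eq0 -[e_vec x c == 0]negbK e_vec_dots // cd orbF => /eqP.
Qed.

(** The vectors of the dots are independent, having distinct weights, and span the
    space, which decomposes into weight lines. *)
Lemma size_dots_point x : (x <= N)%N -> size (dots S x) = d x.
Proof.
move=> le; set n := size _.
pose M := \matrix_(i < d x, j < n) e_vec x (nth (0%N, 0) (dots S x) j) i 0.
have MP (k : dot -> F) : M *m (\col_j k (nth (0%N, 0) (dots S x) j)) =
    \sum_(c <- dots S x) k c *: e_vec x c.
  apply/matrixP => i j; rewrite ord1 mxE (big_nth (0%N, 0)) big_mkord summxE.
  by apply: eq_bigr => j' _; rewrite !mxE mulrC.
apply/eqP; rewrite eqn_leq; apply/andP; split.
  have : row_free M^T.
    rewrite -kermx_eq0; apply/eqP/row_matrixP => i; rewrite row0.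
    set z := row i _; have wM : z *m M^T = 0.
      by rewrite /z -row_mul mulmx_ker row0.
    pose k (c : dot) : F := if insub (index c (dots S x)) is Some j then z 0 (j : 'I_n) else 0.
    have kE (j : 'I_n) : k (nth (0%N, 0) (dots S x) j) = z 0 j.
      by rewrite /k index_uniq ?uniq_dots ?ltn_ord // valK.
    apply/matrixP => a j; rewrite ord1 [RHS]mxE -kE; apply: (e_vec_free le); last first.
      exact/mem_nth/ltn_ord.
    rewrite -MP; apply: trmx_inj; rewrite trmx_mul trmx0 -wM; congr (_ *m _).
    by apply/matrixP => a' j'; rewrite (ord1 a') [LHS]mxE [LHS]mxE kE.
  by move/row_freeP => [B /mulmx1_min].
have /choice[W MW] : forall j : 'I_(d x), exists w : 'cV_n, M *m w = delta_mx j 0.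
  by move=> j; have [k ->] := e_vec_span (delta_mx j 0) le; eexists; apply: MP.
apply: (@mulmx1_min _ _ _ M (\matrix_(i, j) W j i 0)).
apply/matrixP => i j; have /matrixP /(_ i 0) := MW j; rewrite !mxE eqxx andbT => <-.
by apply: eq_bigr => l _; rewrite !mxE.
Qed.

Lemma tie_diagram_point : tie_diagram S.
Proof.
by move=> X; rewrite -size_dots_ties size_dots_point // -ltnS ltn_ord.
Qed.
Let tieS := tie_diagram_point.

Local Notation mS := (butterfly F S).

Definition butterfly_iso x : 'M[F]_(d x) := \matrix_(i, j) e_vec x (ith_dot S x j) i 0.

Lemma butterfly_iso_dvec x c : (x <= N)%N -> butterfly_iso x *m dvec F S c x = e_vec x c.
Proof.
move=> le; rewrite (mul_dvec tieS (f := e_vec x)) => [|i j]; last by rewrite mxE.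
by case: ifP => // /negbT; rewrite -e_vec_dots // negbK => /eqP.
Qed.

Lemma butterfly_iso_unit x : butterfly_iso x \in unitmx.
Proof.
case: (leqP x N) => [le|lt]; last by apply: injective_unitmx => v _; apply/mx_norows_eq/mult_ge_nb5/ltnW.
have /choice[W EW] : forall j : 'I_(d x), exists w, butterfly_iso x *m w = delta_mx j 0 :> 'cV_(d x).
  move=> j; have [k ->] := e_vec_span (delta_mx j 0) le.
  exists (\sum_(c <- dots S x) k c *: dvec F S c x); rewrite mulmx_sumr.
  by apply: eq_bigr => c _; rewrite -scalemxAr butterfly_iso_dvec.
have /mulmx1_unit[] // : butterfly_iso x *m (\matrix_(i, j) W j i 0) = 1%:M.
apply/matrixP => i j; have /matrixP /(_ i 0) := EW j; rewrite !mxE eqxx andbT => <-.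
by apply: eq_bigr => l _; rewrite !mxE.
Qed.

Lemma e_vec_neq0 x c : (x <= N)%N -> c \in dots S x ->
  exists2 U : D5 D, c = (posD5 U : nat, c.2) & e_dot U x c.2 != 0.
Proof.
move=> le cd; have [U e inU] := dots_D5 cd; exists U; first by case: c e {cd inU} => u s /= ->.
by have [_ -> _ _] := column_point U le.
Qed.

Lemma butterfly_iso_intertwines : intertwines 1 mS m butterfly_iso.
Proof.
split=> [x lt|k Dk|k Vk].
- apply: (dvec_ext tieS) => c cd; rewrite -!mulmxA butterfly_beta // dot_map_dvec // cd.
  rewrite ?(butterfly_iso_dvec _ (ltnW lt)) ?(butterfly_iso_dvec _ lt).
  have [U e e0] := e_vec_neq0 (ltnW lt) cd.
  by rewrite e /lower /= !e_vecE e_dot_beta // ltnW.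
- have lt : (k < N)%N by case/andP: Dk.
  split; last first.
  + have [_ _ -> _ _] := butterfly_D5 F S Dk; rewrite scale1r (butterfly_iso_dvec _ (ltnW lt)).
    by have [U e] := D5_brane Dk; subst k; rewrite e_vecE e_dot_a.
  + apply: (dvec_ext tieS) => c cd; rewrite scale1r -mulmxA (butterfly_iso_dvec _ lt) (butterfly_mb _ tieS _ Dk) cd /=.
    by have [U e e0] := e_vec_neq0 lt cd; rewrite e e_vecE e_dot_b.
  + apply: (dvec_ext tieS) => c cd; rewrite -!mulmxA (butterfly_mA _ tieS _ Dk) cd.
    rewrite ?(butterfly_iso_dvec _ (ltnW lt)) ?(butterfly_iso_dvec _ lt).
    by have [U e e0] := e_vec_neq0 lt cd; rewrite e !e_vecE e_dot_A.
- have lt : (k < N)%N by case/andP: Vk.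
  have [-> ->] := butterfly_NS5 F S Vk.
  split; apply: (dvec_ext tieS) => c cd; rewrite -!mulmxA dot_map_dvec // cd.
  + rewrite ?(butterfly_iso_dvec _ (ltnW lt)) ?(butterfly_iso_dvec _ lt).
    by have [U e e0] := e_vec_neq0 lt cd; rewrite e /lower /= !e_vecE e_dot_C.
  + rewrite ?(butterfly_iso_dvec _ (ltnW lt)) ?(butterfly_iso_dvec _ lt).
    by have [U e e0] := e_vec_neq0 (ltnW lt) cd; rewrite e !e_vecE e_dot_D.
Qed.

Theorem weighted_point_butterfly :
  exists2 T : {set tie D}, tie_diagram T & gauge_orbit m = gauge_orbit (butterfly F T).
Proof.
exists S; first exact: tieS.
have [Gg -> _] := hom_gauge (butterfly_Mtilde F tieS) Mm butterfly_iso_intertwines butterfly_iso_unit.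
exact: gauge_orbit_act.
Qed.

End Weights.

(** * A torus element that separates all dots *)

Section GenericTorusElement.
Variables (F : numFieldType) (D : brane_diagram).
Local Notation N := (nb5 D).
Local Notation d := (mult D).

(** Odd weights on the lines and hbar = 2, so that the weight of a dot is an odd
    number up to inversion times a power of two. *)
Definition generic_element : (D5 D -> F) * F :=
  (fun U => (posD5 U).*2.+1%:R, 2%:R).

Definition generic_weight (c : dot) : F := c.1.*2.+1%:R^-1 * 2%:R ^ (- c.2).

Lemma generic_element_torus : torus generic_element.
Proof. by split=> [U|] /=; rewrite pnatr_eq0. Qed.

Lemma generic_weight_inj : injective generic_weight.
Proof.
have two0 : 2%:R != 0 :> F by rewrite pnatr_eq0.
have odd0 k : k.*2.+1%:R != 0 :> F by rewrite pnatr_eq0.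
suff le_inj u s u' s' : s <= s' -> generic_weight (u, s) = generic_weight (u', s') ->
    (u, s) = (u', s').
  move=> [u s] [u' s'] e; case: (lerP s s') => ss; first exact: le_inj.
  by apply/esym/le_inj => //; apply: ltW.
rewrite /generic_weight /= => ss e.
have [n en] : exists n : nat, s' = s + n%:Z by exists (absz (s' - s)); lia.
have : u'.*2.+1%:R * 2%:R ^+ n = u.*2.+1%:R :> F.
  move: e; rewrite en opprD expfzDr // -exprnN.
  have h0 : 2%:R ^ (- s) != 0 :> F by rewrite expfz_neq0.
  have n0 : 2%:R ^+ n != 0 :> F by rewrite expf_neq0.
  move: (2%:R ^ (- s)) (2%:R ^+ n) h0 n0 (odd0 u) (odd0 u') => p q p0 q0.
  move: (u.*2.+1%:R : F) (u'.*2.+1%:R : F) => a b a0 b0 e.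
  have -> : b * q = a^-1 * p * (a * b * q / p) by field; rewrite a0 p0.
  by rewrite e; field; rewrite b0 p0 q0.
rewrite -natrX -natrM => /eqP; rewrite eqr_nat => /eqP e2.
case: n en e2 => [|n] en e2.
  by rewrite en addr0; congr pair; move: e2; rewrite expn0 muln1; lia.
by move: (congr1 odd e2); rewrite oddM oddX /= !odd_double /=.
Qed.

Lemma generic_line_weight k : D5_at D k ->
  line_weightN D generic_element.1 k = k.*2.+1%:R.
Proof.
move=> /D5_brane[U ->]; have -> : line_weightN D generic_element.1 (posD5 U) =
  line_weight generic_element.1 (posD5 U) by apply: (@extendE N (fun=> F)).
rewrite /line_weight; case: insubP => [U' _ e|] /=; first by rewrite -e.
by rewrite /posD5 (valP U).
Qed.

Theorem fixed_point_butterfly (m : bigM F D) :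
  stable_point m -> torus_fixed (gauge_orbit m) ->
  exists2 S : {set tie D}, tie_diagram S & gauge_orbit m = gauge_orbit (butterfly F S).
Proof.
move=> stm /torus_fixedP /(_ _ generic_element_torus)[g Gg].
have [Mm _] := stm; have gen := stable_generated stm.
move=> /(torus_relationsP _ (Mtilde_moment Mm) Gg)[gb gD gV].
have two0 : 2%:R != 0 :> F by rewrite pnatr_eq0.
apply: (@weighted_point_butterfly _ _ m (gaugeN g) generic_weight 2%:R) => //.
- exact: generic_weight_inj.
- by move=> [u s]; rewrite /generic_weight /= opprB addrC expfzDr // expr1z; ring.
- by move=> x; case: (ltnP x N) => [/gb //|le]; apply/mx_norows_eq/mult_ge_nb5.
- by move=> k /gD[].
- move=> k Dk; have [_ + _] := gD k Dk; rewrite generic_line_weight //= => {2}->.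
  rewrite /generic_weight /= !scalerA -[LHS]scale1r; congr (_ *: _).
  have o0 : k.*2.+1%:R != 0 :> F by rewrite pnatr_eq0.
  by rewrite exprN1 mulfVK // mulVf.
- move=> k Dk; have [_ _ ->] := gD k Dk; rewrite generic_line_weight //.
  by rewrite /generic_weight /= oppr0 expr0z mulr1.
- by move=> k /gV[].
- by move=> k /gV[].
Qed.

End GenericTorusElement.

Theorem theorem4p8 (R : realType) (D : brane_diagram) :
  (forall O : set (bigM R[i] D),
     bow_variety O -> torus_fixed O ->
     exists2 S : {set tie D}, tie_diagram S & O = gauge_orbit (butterfly R[i] S)) /\
  (forall S : {set tie D},
     tie_diagram S ->
     stable_point (butterfly R[i] S) /\ torus_fixed (gauge_orbit (butterfly R[i] S))).
Proof.
split=> [_ [m stm <-] fixm|S tieS]; first exact: fixed_point_butterfly.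
by split; [apply: butterfly_stable | apply: butterfly_torus_fixed].
Qed.
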